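(* Let $\mathbb{G}$ be a self-affine carpet with attractor $\Lambda$ such that at least one of the following holds: (a) both $\mathrm{p}_1\mathbb{G}$ and $\mathrm{p}_2\mathbb{G}$ satisfy the asymptotic weak separation condition (AWSC); or (b) $\mathbb{G}$ satisfies coordinate ordering and the asymptotic neighbour condition (ANC), and $\mathrm{p}_2\mathbb{G}$ satisfies the AWSC. Then the box-counting dimension of $\Lambda$ exists and $$\dim_{\mathrm B}(\Lambda)=\max_{\ell\in\{1,2\}}\limsup_{\delta\to0}\Bigg(\frac{\log\#\mathbb{S}_\delta^\ell}{-\log\delta}+\dim_{\mathrm B}(\mathrm{p}_\ell\Lambda)\Bigg(1+\frac{\log\mathfrak{M}_{\dim_{\mathrm B}(\mathrm{p}_\ell\Lambda)}\big(|r_{S,\ell}|\,:\,S\in\mathbb{S}_\delta^\ell\big)}{-\log\delta}\Bigg)\Bigg),$$ where $\mathfrak{M}_p(x_1,\dots,x_n)=\big(\frac1n\sum_{i=1}^nx_i^p\big)^{1/p}$ is the power mean with exponent $p$ (the expression in the outer parentheses being interpreted as $-\infty$ when $\mathbb{S}_\delta^\ell=\emptyset$). Moreover, $$\dim_{\mathrm B}(\Lambda)=\limsup_{\delta\to0}\max\{D_\delta^1,D_\delta^2\}=\limsup_{n\to\infty}\max\{d_n^1,d_n^2\},$$ where for $\ell\in\{1,2\}$ the quantities $D_\delta^\ell$ and $d_n^\ell$ are the unique real solutions of $$\sum_{S\in\mathbb{S}_\delta}\left(\frac{|r_{S,\ell}|}{|r_{S,3-\ell}|}\right)^{\dim_{\mathrm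 B}(\mathrm{p}_\ell\Lambda)}|r_{S,3-\ell}|^{D_\delta^\ell}=1,\qquad\sum_{S\in\mathbb{G}_n}\left(\frac{|r_{S,\ell}|}{|r_{S,3-\ell}|}\right)^{\dim_{\mathrm B}(\mathrm{p}_\ell\Lambda)}|r_{S,3-\ell}|^{d_n^\ell}=1.$$ Furthermore, for any $\ell\in\{1,2\}$ such that $\mathrm{p}_\ell\mathbb{G}$ satisfies the AWSC, in the last formula $d_n^\ell$ can be replaced by $\mathfrak{D}_n^\ell$, the unique real solution of $$\sum_{S\in\mathbb{G}_n}\left(\frac{|r_{S,\ell}|}{|r_{S,3-\ell}|}\right)^{s_n^\ell}|r_{S,3-\ell}|^{\mathfrak{D}_n^\ell}=1,$$ where $s_n^\ell$ is the similarity dimension of $\mathrm{p}_\ell\mathbb{G}_n$, i.e. $\sum_{R\in\mathrm{p}_\ell\mathbb{G}_n}|r_R|^{s_n^\ell}=1$ with $|r_R|$ the contraction ratio of $R$.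
   Context: A self-affine carpet is a finite set $\mathbb{G}=\{S_i\}_{i\in\Sigma}$ of (distinct) maps $S(x,y)=(r_{S,1}x+t_{S,1},\,r_{S,2}y+t_{S,2})$ of $\mathbb{R}^2$ with $|r_{S,\ell}|\in(0,1)$. Its attractor $\Lambda$ is the unique non-empty compact set with $\Lambda=\bigcup_{S\in\mathbb{G}}S(\Lambda)$. Write $\mathrm{p}_1(x,y)=x$, $\mathrm{p}_2(x,y)=y$; $\mathrm{p}_\ell S$ is the map $u\mapsto r_{S,\ell}u+t_{S,\ell}$ of $\mathbb{R}$; for a finite set $\mathbb{F}$ of such maps, $\mathrm{p}_\ell\mathbb{F}=\{\mathrm{p}_\ell S:S\in\mathbb{F}\}$ as a set. $\mathrm{p}_\ell\mathbb{G}$ is a self-similar IFS on $\mathbb{R}$ with attractor $\mathrm{p}_\ell\Lambda$ (whose box-counting dimension exists). Standing assumption: $\mathrm{conv}(\mathrm{p}_1\Lambda)\times\mathrm{conv}(\mathrm{p}_2\Lambda)=[0,1]^2$. $\mathbb{G}_n=\{S_1\circ\dots\circ S_n:S_i\in\mathbb{G}\}$ as a set of maps. Coordinate ordering: $|r_{S,1}|\le|r_{S,2}|$ for all $S\in\mathbb{G}$. Words. For an IFS $\{S_i\}_{i\in\Sigma}$ of distinct maps and a word $\mathbf{i}=i_1\dots i_n$ put $S_{\mathbf{i}}=S_{i_1}\circ\dots\circ S_{i_n}$, and let $\mathbf{i}-$ be $\mathbf{i}$ with its last letter deleted ($S$ of the empty word is the identity). Fix sets $\Sigma^{\{n\}}\subseteq\Sigma^n$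 with $\Sigma^{\{1\}}=\Sigma$ such that for each $n$: $\mathbf{i}\mapsto S_{\mathbf{i}}$ is a bijection from $\Sigma^{\{n\}}$ onto the set of all $n$-fold compositions, and $\mathbf{i}-\in\Sigma^{\{n\}}$ for every $\mathbf{i}\in\Sigma^{\{n+1\}}$. Let $\Sigma^{\{*\}}=\bigcup_{n\ge1}\Sigma^{\{n\}}$. AWSC. Let $\{S_i\}_{i\in\Sigma}$ be a self-similar IFS on $\mathbb{R}$ with attractor $K$; $|\cdot|$ denotes diameter. For $\delta\in(0,1]$ let $\mathcal{M}_\delta=\{S_{\mathbf{i}}:\mathbf{i}\in\Sigma^{\{*\}},\ |S_{\mathbf{i}}(K)|\le\delta<|S_{\mathbf{i}-}(K)|\}$ and $g(\delta)=\sup_{\gamma\in[\delta,1]}\sup_{x\in\mathbb{R}}\#\{S\in\mathcal{M}_\gamma:S(K)\cap B(x,\gamma)\ne\emptyset\}$. The AWSC holds if $\lim_{\delta\to0}\log g(\delta)/(-\log\delta)=0$. For a self-affine carpet, with $r_{\mathbf{i},\ell}=\prod_m r_{S_{i_m},\ell}$ (empty product $=1$), let $\Delta_\delta=\{\mathbf{i}\in\Sigma^{\{*\}}:\min\{|r_{\mathbf{i},1}|,|r_{\mathbf{i},2}|\}\le\delta<\min\{|r_{\mathbf{i}-,1}|,|r_{\mathbf{i}-,2}|\}\}$, $\Delta^1_\delta=\{\mathbf{i}\in\Delta_\delta:|r_{\mathbf{i},1}|>|r_{\mathbf{i},2}|\}$, $\Delta^2_\delta=\{\mathbf{i}\in\Delta_\delta:|r_{\mathbf{i},2}|\ge|r_{\mathbf{i},1}|\}$,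 and $\mathbb{S}_\delta=\{S_{\mathbf{i}}:\mathbf{i}\in\Delta_\delta\}$, $\mathbb{S}^\ell_\delta=\{S_{\mathbf{i}}:\mathbf{i}\in\Delta^\ell_\delta\}$ (sets of maps). ANC. Let $f(\delta)=\sup_{\gamma\in[\delta,1]}\sup_{x\in\mathbb{R}^2}\#\{S\in\mathbb{S}_\gamma:S(\Lambda)\cap B(x,\gamma)\ne\emptyset\}$. The ANC holds if $\log f(\delta)/\log\delta\to0$ as $\delta\to0$. *)

(* Defs.v *)
From mathcomp Require Import all_boot all_order all_algebra finmap.
From mathcomp Require Import all_classical all_reals all_analysis.

Set Implicit Arguments.
Unset Strict Implicit.
Unset Printing Implicit Defensive.

Import Order.TTheory GRing.Theory Num.Theory.
Import numFieldNormedType.Exports.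

Local Open Scope classical_set_scope.
Local Open Scope ring_scope.

(* Coordinates are indexed by bool: false is the first coordinate, true the
   second, so that ~~ l stands for 3 - l. *)
Definition pcoord (T : Type) (l : bool) (p : T * T) : T := if l then p.2 else p.1.

(* The pair (r, t) encodes the map u |-> r u + t, and a pair of such pairs
   encodes a map of the plane acting coordinatewise. Since the coefficients
   are determined by the map, sets of codes are the same as sets of maps. *)
Definition aff (R : realType) : Type := (R * R)%type.
Definition cmap (R : realType) : Type := (aff R * aff R)%type.

Definition aff_fun (R : realType) (f : aff R) (u : R) : R := f.1 * u + f.2.
Definition aff_id (R : realType) : aff R := (1, 0).
Definition aff_comp (R : realType) (f g : aff R) : aff R :=
  (f.1 * g.1, f.1 * g.2 + f.2).

Definition cmap_fun (R : realType) (S : cmap R) (x : R * R) : R * R :=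
  (aff_fun S.1 x.1, aff_fun S.2 x.2).
Definition cmap_id (R : realType) : cmap R := (aff_id R, aff_id R).
Definition cmap_comp (R : realType) (S T : cmap R) : cmap R :=
  (aff_comp S.1 T.1, aff_comp S.2 T.2).

Lemma aff_fun_inj (R : realType) : injective (@aff_fun R).
Proof.
move=> [r t] [r' t'] E; have := congr1 (@^~ 0) E; have := congr1 (@^~ 1) E.
rewrite /aff_fun /= !mulr1 !mulr0 !add0r => + tE; rewrite tE.
by move=> /addIr ->.
Qed.

Lemma aff_compE (R : realType) (f g : aff R) :
  aff_fun (aff_comp f g) = aff_fun f \o aff_fun g.
Proof. by apply/funext => u; rewrite /aff_fun /= mulrDr mulrA addrA. Qed.

Lemma cmap_compE (R : realType) (S T : cmap R) :
  cmap_fun (cmap_comp S T) = cmap_fun S \o cmap_fun T.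
Proof. by apply/funext => x; rewrite /cmap_fun /= !aff_compE. Qed.

Definition aff_word (R : realType) (w : seq (aff R)) : aff R :=
  foldr (@aff_comp R) (aff_id R) w.
Definition cmap_word (R : realType) (w : seq (cmap R)) : cmap R :=
  foldr (@cmap_comp R) (cmap_id R) w.

Definition contr (R : realType) (l : bool) (S : cmap R) : R := `|(pcoord l S).1|.

Definition is_carpet (R : realType) (G : {fset cmap R}) : Prop :=
  forall S, S \in G -> forall l, 0 < contr l S < 1.

Definition is_attractor (R : realType) (G : {fset cmap R}) (L : set (R * R)) : Prop :=
  [/\ L !=set0, compact L & L = \bigcup_(S in [set` G]) (cmap_fun S @` L)].

Definition conv_hull (R : realType) (A : set R) : set R :=
  smallest (@convex_set R R^o) A.

Definition coordinate_ordering (R : realType) (G : {fset cmap R}) : Prop :=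
  forall S, S \in G -> contr false S <= contr true S.

Definition proj_ifs (R : realType) (l : bool) (G : {fset cmap R}) : {fset aff R} :=
  [fset pcoord l S | S in G]%fset.

Section Words.
Variable T : choiceType.

Definition words (G : {fset T}) (n : nat) : set (seq T) :=
  [set w | size w = n /\ {subset w <= G}].

Definition parent (w : seq T) : seq T := take (size w).-1 w.

(* The letters are the maps of the IFS G themselves, ev w is the composition
   along the word w, and W n (n >= 1) is a choice of Sigma^{n}. *)
Definition reduced_words (ev : seq T -> T) (G : {fset T})
    (W : nat -> set (seq T)) : Prop :=
  [/\ W 1%N = words G 1,
      forall n, (0 < n)%N -> W n `<=` words G n,
      forall n, (0 < n)%N -> set_bij (W n) (ev @` words G n) ev &
      forall n w, (0 < n)%N -> W n.+1 w -> W n (parent w)].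

Definition all_words (W : nat -> set (seq T)) : set (seq T) :=
  \bigcup_(n in [set n | (0 < n)%N]) W n.

End Words.

Definition comps (R : realType) (G : {fset cmap R}) (n : nat) : set (cmap R) :=
  @cmap_word R @` words G n.

(* fset_set sends infinite sets to the empty one; for contractions only finite
   families are counted below, and the suprema of their sizes are bounded. *)
Definition ncard (R : realType) (T : choiceType) (A : set T) : R :=
  (#|` fset_set A|%fset)%:R.

Definition dist1 (R : realType) (x y : R) : R := `|x - y|.
(* The norm of the product type R * R is the sup norm, hence this. *)
Definition dist2 (R : realType) (x y : R * R) : R :=
  Num.sqrt ((x.1 - y.1) ^+ 2 + (x.2 - y.2) ^+ 2).

Definition cball (R : realType) (X : Type) (dist : X -> X -> R) (x : X) (r : R) : set X :=
  [set y | dist x y <= r].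

Definition diam (R : realType) (A : set R) : R :=
  sup [set dist1 x y | x in A & y in A].

Definition covering_number (R : realType) (X : choiceType) (dist : X -> X -> R)
    (A : set X) (d : R) : R :=
  inf [set (size s)%:R | s in
        [set s : seq X | A `<=` \bigcup_(x in [set` s]) cball dist x d]].

Definition box_ratio (R : realType) (X : choiceType) (dist : X -> X -> R)
    (A : set X) (d : R) : R :=
  ln (covering_number dist A d) / - ln d.

Definition box_dim_exists (R : realType) (X : choiceType) (dist : X -> X -> R)
    (A : set X) : Prop :=
  cvg (box_ratio dist A d @[d --> 0^'+]).

Definition box_dim (R : realType) (X : choiceType) (dist : X -> X -> R)
    (A : set X) : R :=
  lim (box_ratio dist A d @[d --> 0^'+]).

(* The functions f and g of the neighbour and separation conditions, for a
   family (fam c) of maps at each scale c and an attractor K. *)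
Definition neighbours (R : realType) (T : choiceType) (X : Type)
    (dist : X -> X -> R) (app : T -> X -> X) (K : set X)
    (fam : R -> set T) (d : R) : R :=
  sup [set sup [set ncard R [set S | fam c S /\ (app S @` K) `&` cball dist x c !=set0]
                | x in setT]
       | c in `[d, 1]].

Definition awsc_family (R : realType) (K : set R) (W : nat -> set (seq (aff R)))
    (d : R) : set (aff R) :=
  @aff_word R @` [set w | all_words W w /\
    diam (aff_fun (aff_word w) @` K) <= d
      < diam (aff_fun (aff_word (parent w)) @` K)].

Definition AWSC (R : realType) (K : set R) (W : nat -> set (seq (aff R))) : Prop :=
  ln (neighbours (@dist1 R) (@aff_fun R) K (awsc_family K W) d) / - ln d
    @[d --> 0^'+] --> (0 : R).

Section Carpet.
Variable R : realType.
Implicit Types (W : nat -> set (seq (cmap R))) (l : bool) (d : R).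

Definition word_ratio l (w : seq (cmap R)) : R := \prod_(S <- w) contr l S.

Definition min_ratio (w : seq (cmap R)) : R :=
  Num.min (word_ratio false w) (word_ratio true w).

Definition Delta W d : set (seq (cmap R)) :=
  [set w | all_words W w /\ min_ratio w <= d < min_ratio (parent w)].

Definition Delta_ W l d : set (seq (cmap R)) :=
  [set w | Delta W d w /\
    if l then word_ratio true w >= word_ratio false w
    else word_ratio false w > word_ratio true w].

Definition stopped W d : set (cmap R) := @cmap_word R @` Delta W d.
Definition stopped_ W l d : set (cmap R) := @cmap_word R @` Delta_ W l d.

Definition ANC (L : set (R * R)) W : Prop :=
  ln (neighbours (@dist2 R) (@cmap_fun R) L (stopped W) d) / ln d
    @[d --> 0^'+] --> (0 : R).

Definition power_mean (T : choiceType) (p : R) (x : T -> R) (A : set T) : R :=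
  ((ncard R A)^-1 * \sum_(S \in A) x S `^ p) `^ p^-1.

Definition dim_term (L : set (R * R)) W l d : \bar R :=
  let s := box_dim (@dist1 R) (pcoord l @` L) in
  if stopped_ W l d == set0 then -oo%E
  else (ln (ncard R (stopped_ W l d)) / - ln d
        + s * (1 + ln (power_mean s (contr l) (stopped_ W l d)) / - ln d))%:E.

(* All the equations for the dimension approximations have the form
   pressure l A s t = 1, with unknown t. *)
Definition pressure l (A : set (cmap R)) (s t : R) : R :=
  \sum_(S \in A) (contr l S / contr (~~ l) S) `^ s * contr (~~ l) S `^ t.

Definition similarity_sum (F : set (aff R)) (s : R) : R :=
  \sum_(f \in F) `|f.1| `^ s.

End Carpet.

Definition unique_root (R : realType) (F : R -> R) (x : R) : Prop :=
  unique (fun y => F y = 1) x.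

(* Main.v *)
(** Let N be the covering number of L, let s_l be the box dimension of the l-th
projection K_l, and for S in S_d let l be the coordinate with the larger ratio.
The image of S has short side at most d, so covering it by d-balls amounts to
covering K_l at scale d / r_{S,l}, which takes about (r_{S,l} / d)^{s_l} balls.
Summing over S_d gives a quantity Z(d) with N(d) <= d^{-o(1)} Z(d); its two halves
are the sums in the dimension formula.

Conversely, under the ANC fix d and iterate the maps of S_d with long side l. All
their ratios are at least r0 d, so pulling balls back through one map at a time
shows that a ball of radius (r0 d)^n meets at most d^{-o(n)} of the n-fold
products, counted as words; hence N((r0 d)^n) >= (d^{o(1)} Z(d))^n up to a
constant, and Fekete's argument makes ln N / - ln d and ln Z / - ln d converge to
a common limit a. The same argument, applied to disjoint pieces of K_l, gives the
existence of s_l. The AWSC of both projections implies the ANC, because S is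
determined by its two projections.

Since a <= s_1 + s_2, the pressure sum over S_d with exponent a + eta is at most a
positive power of d, while with exponent a - eta one of the two sums is at least a
negative power of d. Splitting G_n into scales (a geometric series) and S_d into
word lengths (logarithmically many) transfers this to G_n. Finally s_l <= s_n^l
always, the AWSC gives s_n^l -> s_l, and a small change of this exponent moves the
root of the pressure equation only a little. *)

Require Import Defs.
From mathcomp Require Import all_boot all_order all_algebra finmap.
From mathcomp Require Import all_classical all_reals all_analysis.
From mathcomp Require Import ring lra zify.

Set Implicit Arguments.
Unset Strict Implicit.
Unset Printing Implicit Defensive.

Import Order.TTheory GRing.Theory Num.Theory.
Import numFieldNormedType.Exports.

Local Open Scope classical_set_scope.
Local Open Scope ring_scope.

(** * Finite sums and covering numbers *)

Section SeqSums.
Variable R : realType.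

(** The sum Z mixes the exponents s_1 and s_2 and does not multiply when maps are composed; its half
    with a fixed long direction l does, because the ratios in direction l multiply and a single
    exponent is used. This is why one half at a time is iterated. The larger half is at least Z / 2,
    and the factor 2, though it enters the n-th power, disappears in d^(o(1)) since it does not
    depend on d. The iterates need not be stopped words: only the lower bound (r0 d)^n for their
    ratios matters, and repeated products do no harm, because the bound for a ball counts words. The
    scales reached in this way are the powers of r0 d; monotonicity of N fills the gaps between them
    at the price of a factor independent of n. The pressure equation for l also runs over the maps
    whose long direction is the other one, for which K_l is the wrong projection. The inequality a
    <= s_1 + s_2 controls exactly these maps. *)

Lemma ler_sum_sub (T : eqType) (s t : seq T) (F : T -> R) :
  uniq s -> {subset s <= t} -> (forall x, x \in t -> 0 <= F x) ->
  \sum_(x <- s) F x <= \sum_(x <- t) F x.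
Proof.
elim: s t => [|x s IH] t /= us st F0.
  by rewrite big_nil big_seq sumr_ge0.
have xt : x \in t by apply: st; rewrite mem_head.
case/andP: us => xs us.
rewrite (perm_big _ (perm_to_rem xt)) !big_cons lerD2l.
apply: IH => // [y ys|y /mem_rem/F0//].
have : y \in t by apply: st; rewrite inE ys orbT.
rewrite (perm_mem (perm_to_rem xt)) inE => /predU1P[yx|//].
by rewrite yx (negbTE xs) in ys.
Qed.

Lemma mem_flatten_map (T : eqType) (I : Type) (ks : seq I) (t : I -> seq T) x :
  (x \in flatten (map t ks)) = has (fun k => x \in t k) ks.
Proof. by elim: ks => //= k ks IH; rewrite mem_cat IH. Qed.

Lemma ler_sum_cover (T : eqType) (I : Type) (ks : seq I) (s : seq T)
    (t : I -> seq T) (F : T -> R) :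
  uniq s -> (forall x, x \in s -> has (fun k => x \in t k) ks) ->
  (forall x, 0 <= F x) ->
  \sum_(x <- s) F x <= \sum_(k <- ks) \sum_(x <- t k) F x.
Proof.
move=> us st F0; rewrite -[leRHS](big_map t predT (fun u => \sum_(x <- u) F x)).
rewrite -big_flatten; apply: ler_sum_sub => // x /st.
by rewrite mem_flatten_map.
Qed.

(** Incident pairs are counted from both sides. In the lower bounds for covering numbers [Is] lists
    pieces of the set, with repetitions counted separately, and [s] the centres of a cover. *)
Lemma double_count (I X : eqType) (Is : seq I) (s : seq X)
    (meets : I -> X -> bool) (m : I -> nat) M :
  (forall x, x \in s -> (count (meets^~ x) Is <= M)%N) ->
  (forall i, i \in Is -> (m i <= count (meets i) s)%N) ->
  (\sum_(i <- Is) m i <= M * size s)%N.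
Proof.
move=> hM hm; apply: (@leq_trans (\sum_(i <- Is) \sum_(x <- s) meets i x)%N).
  rewrite big_seq [leqRHS]big_seq; apply: leq_sum => i /hm.
  by rewrite -sum1_count big_mkcond.
rewrite exchange_big /= mulnC; have -> : (size s * M = \sum_(x <- s) M)%N.
  by rewrite big_const_seq count_predT iter_addn_0 mulnC.
rewrite big_seq [leqRHS]big_seq; apply: leq_sum => x /hM.
by rewrite -sum1_count big_mkcond.
Qed.

End SeqSums.

(* Empty when [A] is infinite. *)
Definition els (T : choiceType) (A : set T) : seq T := enum_fset (fset_set A).

Section Els.
Variable T : choiceType.
Implicit Types A B : set T.

Lemma mem_els A : finite_set A -> forall x, (x \in els A) = (x \in A).
Proof. by move=> Af x; rewrite -in_fset_set. Qed.

Lemma elsP A x : finite_set A -> x \in els A <-> A x.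
Proof. by move=> Af; rewrite mem_els// inE. Qed.

Lemma uniq_els A : uniq (els A).
Proof. exact: fset_uniq. Qed.

Lemma ncard_els (R : realType) A : ncard R A = (size (els A))%:R.
Proof. by []. Qed.

Lemma size_els_sub A B : finite_set B -> A `<=` B -> (size (els A) <= size (els B))%N.
Proof.
move=> Bf AB; have Af := sub_finite_set AB Bf.
by apply: uniq_leq_size (uniq_els _) _ => x; rewrite !mem_els// !inE; apply: AB.
Qed.

Lemma size_els_le A (s : seq T) : (forall x, A x -> x \in s) -> (size (els A) <= size s)%N.
Proof.
move=> As; have Af : finite_set A by apply: sub_finite_set (finite_seq s).
by apply: uniq_leq_size (uniq_els _) _ => x /elsP -/(_ Af)/As.
Qed.

Lemma size_els_ge A (s : seq T) : finite_set A -> uniq s ->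
  (forall x, x \in s -> A x) -> (size s <= size (els A))%N.
Proof. by move=> Af us sA; apply: uniq_leq_size => // x /sA /elsP; apply. Qed.

Lemma fsbig_els (R : realType) A (F : T -> R) : finite_set A ->
  \sum_(x \in A) F x = \sum_(x <- els A) F x.
Proof. by move=> Af; rewrite fsbig_finite. Qed.

End Els.

Section Covering.
Variables (R : realType) (X : choiceType) (dist : X -> X -> R).
Implicit Types (A B : set X) (d : R) (s : seq X).

Definition covers A d s := A `<=` \bigcup_(x in [set` s]) cball dist x d.

Lemma covering_number_le A d s :
  covers A d s -> covering_number dist A d <= (size s)%:R.
Proof.
move=> As; apply: ge_inf; last by exists s.
by exists 0 => _ [t _ <-].
Qed.

(** An infimum of natural numbers is a minimum. The cover [s0] excludes the empty family of covers,
    whose infimum would be 0 by default. *)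
Lemma covering_number_attained A d s0 : covers A d s0 ->
  exists2 s, covers A d s & covering_number dist A d = (size s)%:R.
Proof.
move=> As0; have exn : exists n, `[< exists2 s, covers A d s & size s = n >].
  by exists (size s0); apply/asboolP; exists s0.
case: (ex_minnP exn) => n /asboolP[s As sn] minn; exists s => //.
apply/le_anti; rewrite covering_number_le//=; apply: lb_le_inf.
  by exists (size s)%:R, s.
by move=> _ [t At <-]; rewrite ler_nat sn minn//; apply/asboolP; exists t.
Qed.

Lemma sub_covers A B d d' s : B `<=` A -> d <= d' -> covers A d s -> covers B d' s.
Proof.
move=> BA dd' As x /BA/As[c cs cx]; exists c => //.
exact: le_trans dd'.
Qed.

Lemma covering_number_mono A B d d' s : covers A d s -> B `<=` A -> d <= d' ->
  covering_number dist B d' <= covering_number dist A d.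
Proof.
move=> /covering_number_attained[t At ->] BA dd'.
by apply: covering_number_le; exact: sub_covers At.
Qed.

Lemma covering_number_ge1 A d s : covers A d s -> A !=set0 ->
  1 <= covering_number dist A d.
Proof.
move=> /covering_number_attained[t At ->] [x /At[c]].
by case: t {At} => //= ? ? _ _; rewrite ler1n.
Qed.

End Covering.

(** * Exponents at scale 0 *)

Section Asymptotics.
Variable R : realType.
Implicit Types (F N Z : R -> R) (a b c d e x y : R).

Lemma near_right0 (P : R -> Prop) :
  (\forall d \near 0^'+, P d) <->
  exists2 e, 0 < e & forall d, 0 < d < e -> P d.
Proof.
split=> [[e /= e0 He]|[e e0 He]].
  exists e => // d /andP[d0 de]; apply: He => //=.
  by rewrite sub0r normrN gtr0_norm.
by near=> d; apply: He; apply/andP; split.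
Unshelve. all: by end_near. Qed.

Lemma near_in01 : \forall d \near (0 : R)^'+, 0 < d < 1.
Proof. by near=> d; apply/andP; split. Unshelve. all: by end_near. Qed.

Lemma Nln_gt0 d : 0 < d < 1 -> 0 < - ln d.
Proof. by move=> /ln_lt0; rewrite oppr_gt0. Qed.

Lemma powR_le_ln d x y : 0 < d -> 0 < y -> (d `^ x <= y) = (x * ln d <= ln y).
Proof. by move=> d0 y0; rewrite -[LHS]ler_ln ?posrE ?powR_gt0// ln_powR. Qed.

Lemma ln_le_powR d x y : 0 < d -> 0 < y -> (y <= d `^ x) = (ln y <= x * ln d).
Proof. by move=> d0 y0; rewrite -[LHS]ler_ln ?posrE ?powR_gt0// ln_powR. Qed.

Lemma powR_lt_ln d x y : 0 < d -> 0 < y -> (d `^ x < y) = (x * ln d < ln y).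
Proof. by move=> d0 y0; rewrite -[LHS]ltr_ln ?posrE ?powR_gt0// ln_powR. Qed.

Lemma powRDn0 d x y : 0 < d -> d `^ (x + y) = d `^ x * d `^ y.
Proof. by move=> d0; rewrite powRD// lt0r_neq0// implybT. Qed.

Lemma powRV x y : 0 <= x -> x^-1 `^ y = x `^ (- y).
Proof. by move=> x0; rewrite -powR_inv1// -powRrM mulN1r. Qed.

Lemma near_const_le_powRN c e : 0 < e -> \forall d \near 0^'+, c <= d `^ (- e).
Proof.
move=> e0; case: (ltP 0 c) => c0; last first.
  by near=> d; apply: (le_trans c0); exact: powR_ge0.
near=> d; rewrite ln_le_powR//.
(* The threshold solves d^(-e) = c. *)
have : d < expR (- (ln c / e)) by near: d; apply: nbhs_right_lt; exact: expR_gt0.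
rewrite -ltr_ln ?posrE ?expR_gt0// expRK => h.
have : e * ln d < e * - (ln c / e) by rewrite ltr_pM2l.
by rewrite mulrN mulrCA divff ?gt_eqF// mulr1; lra.
Unshelve. all: by end_near. Qed.

(** Multiplying by - ln d > 0 turns the limit into two power bounds. Positivity of [F] matters
    because [ln] is 0 off the positive reals. *)
Lemma ln_ratio_cvgP F a : (\forall d \near 0^'+, 0 < F d) ->
  (ln (F d) / - ln d @[d --> 0^'+] --> a) <->
  (forall e, 0 < e ->
     \forall d \near 0^'+, d `^ (- (a - e)) <= F d <= d `^ (- (a + e))).
Proof.
move=> F0; split=> [/cvgrPdist_le H e e0|H].
  near=> d; have d01 : 0 < d < 1 by near: d; exact: near_in01.
  have Fd : 0 < F d by near: d.
  have ld := Nln_gt0 d01; case/andP: d01 => d0 d1.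
  have := near (H e e0) d; move/(_ _) => h.
  have : `|a - ln (F d) / - ln d| <= e by near: d; exact: H.
  rewrite ler_norml powR_le_ln// ln_le_powR// => /andP[h1 h2].
  have h3 : ln (F d) / - ln d <= a + e by lra.
  have h4 : a - e <= ln (F d) / - ln d by lra.
  rewrite ler_pdivrMr// in h3; rewrite ler_pdivlMr// in h4.
  by apply/andP; split; lra.
apply/cvgrPdist_le => e e0; near=> d.
have d01 : 0 < d < 1 by near: d; exact: near_in01.
have Fd : 0 < F d by near: d.
have ld := Nln_gt0 d01; case/andP: d01 => d0 d1.
have : d `^ (- (a - e)) <= F d <= d `^ (- (a + e)) by near: d; exact: H.
rewrite powR_le_ln// ln_le_powR// => /andP[h1 h2].
rewrite ler_norml; apply/andP; split.
  suff : ln (F d) / - ln d <= a + e by lra.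
  by rewrite ler_pdivrMr//; lra.
suff : a - e <= ln (F d) / - ln d by lra.
by rewrite ler_pdivlMr//; lra.
Unshelve. all: by end_near. Qed.

Lemma limf_esup_le (T : choiceType) (X : filteredType T) (H : set_system X) (f : X -> \bar R) a :
  (forall e, 0 < e -> \forall d \near H, (f d <= (a + e)%:E)%E) ->
  (limf_esup f H <= a%:E)%E.
Proof.
move=> h; apply/lee_addgt0Pr => e e0; apply: ge_ereal_inf.
exists (ereal_sup (f @` [set d | (f d <= (a + e)%:E)%E])).
  by exists [set d | (f d <= (a + e)%:E)%E] => //; exact: h.
by apply: ge_ereal_sup => _ [d /= hd <-]; rewrite -EFinD.
Qed.

Lemma limf_esup_ge (T : choiceType) (X : filteredType T) (H : set_system X) (f : X -> \bar R) a :
  (forall e (A : set X), 0 < e -> H A -> exists2 d, A d & ((a - e)%:E <= f d)%E) ->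
  (a%:E <= limf_esup f H)%E.
Proof.
move=> h; apply/lee_subgt0Pr => e e0; apply: le_ereal_inf_tmp => _ [A HA <-].
have [d Ad ad] := h e A e0 HA; apply: le_ereal_sup_tmp.
by exists (f d) => //; exists d.
Qed.

Lemma limf_esup_lt (T : choiceType) (X : filteredType T) (H : set_system X)
    (f : X -> \bar R) (b : \bar R) :
  Filter H -> (limf_esup f H < b)%E -> \forall d \near H, (f d < b)%E.
Proof.
move=> FH /ereal_inf_lt[_ [A HA <-] hA]; apply: filterS HA => d Ad.
by apply: le_lt_trans hA; apply: ereal_sup_ubound; exists d.
Qed.

End Asymptotics.

(** * Growth exponents along the powers of one scale *)

Section Fekete.
Variable R : realType.
Implicit Types (F N Z : R -> R) (a b c d e x y : R).

Lemma exprn_small q y : 0 <= q < 1 -> 0 < y -> exists n, q ^+ n < y.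
Proof.
move=> /andP[q0 q1] y0.
have /cvgr0Pnorm_lt/(_ _ y0) : q ^+ n @[n --> \oo] --> (0 : R).
  by apply: cvg_expr; rewrite ger0_norm.
case=> n _ /(_ n (leqnn _)) /= h; exists n.
by rewrite ger0_norm ?exprn_ge0// in h.
Qed.

Lemma exprn_between q y : 0 < q < 1 -> 0 < y <= 1 ->
  exists n, q ^+ n.+1 < y <= q ^+ n.
Proof.
move=> /andP[q0 q1] /andP[y0 y1].
have ex : exists n, q ^+ n < y by apply: exprn_small => //; rewrite ltW.
case: (ex_minnP ex) => -[|n] hn minn; first by move: hn; rewrite expr0 ltNge y1.
exists n; rewrite hn /= leNgt; apply/negP => /minn.
by rewrite ltnn.
Qed.

Lemma powR_exprn q x n : 0 <= q -> (q ^+ n) `^ x = (q `^ x) ^+ n.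
Proof.
by move=> q0; rewrite -(powR_mulrn n q0) -powRrM mulrC powRrM powR_mulrn ?powR_ge0.
Qed.

(** For eventually positive [F] this is convergence of ln F / - ln d to [a], by [ln_ratio_cvgP]. *)
Definition has_exponent F a := forall e, 0 < e ->
  \forall d \near 0^'+, d `^ (- (a - e)) <= F d <= d `^ (- (a + e)).

Lemma le_powRN d x y : 0 < d < 1 -> (d `^ (- x) <= d `^ (- y)) = (x <= y).
Proof.
move=> d01; have ld := Nln_gt0 d01; case/andP: d01 => d0 d1.
rewrite powR_le_ln ?powR_gt0// ln_powR.
have -> : (x <= y) = (x * - ln d <= y * - ln d) by rewrite ler_pM2r.
by congr (_ <= _); ring.
Qed.

(* One scale [d] at which [Z] is large bounds [N] from below at all scales
   [(c * d) ^+ n], and [N] is monotone in between. *)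
Lemma submultiplicative_exponent N Z c B : 0 < c <= 1 ->
  (forall d, 0 < d < 1 -> 1 <= N d) ->
  (forall d d', 0 < d -> d <= d' -> d' < 1 -> N d' <= N d) ->
  (\forall d \near 0^'+, N d <= d `^ (- B)) ->
  (forall e, 0 < e -> \forall d \near 0^'+, N d <= d `^ (- e) * Z d) ->
  (forall e, 0 < e -> \forall d \near 0^'+, exists2 k, 0 < k &
     forall n, (0 < n)%N -> k * (Z d * d `^ e) ^+ n <= N ((c * d) ^+ n)) ->
  exists2 a, 0 <= a & has_exponent N a /\ has_exponent Z a.
Proof.
move=> /andP[c0 c1] N1 Nmono NB NZ ZN.
(* [sup E] is the lower growth exponent of [N], finite because of [B]; the point is that [Z] cannot
   grow faster. *)
pose E := [set x | \forall d \near 0^'+, d `^ (- x) <= N d].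
have E0 : E 0.
  rewrite /E /=; near=> d; rewrite oppr0 powRr0 N1//.
  by near: d; exact: near_in01.
have ubE : ubound E B.
  move=> x Ex; near (0:R)^'+ => d.
  have d01 : 0 < d < 1 by near: d; exact: near_in01.
  rewrite -(le_powRN _ _ d01); apply: (@le_trans _ _ (N d)).
    by near: d.
  by near: d.
have supE : has_sup E by split; [exists 0|exists B].
pose a := sup E; have a0 : 0 <= a by apply: ub_le_sup => //; exists B.
have Nlo e : 0 < e -> \forall d \near 0^'+, d `^ (- (a - e)) <= N d.
  move=> e0; have [x Ex ax] := sup_adherent e0 supE.
  near=> d; have d01 : 0 < d < 1 by near: d; exact: near_in01.
  apply: (@le_trans _ _ (d `^ (- x))); last by near: d.
  by rewrite le_powRN// ltW.
have Zup e : 0 < e -> \forall d \near 0^'+, Z d <= d `^ (- (a + e)).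
  (* Of the four [u], one pays for the factor d^u in the iteration bound, one for the constant 2
     c^(-x), and two separate [x] from [a]. A large [Z d] then puts [x] into [E]. *)
  move=> e0; pose u := e / 4; have u0 : 0 < u by rewrite divr_gt0.
  have eE : e = 4 * u by rewrite /u; lra.
  near=> d; have d01 : 0 < d < 1 by near: d; exact: near_in01.
  have [k k0 hk] : exists2 k, 0 < k &
     forall n, (0 < n)%N -> k * (Z d * d `^ u) ^+ n <= N ((c * d) ^+ n).
    by near: d; exact: ZN.
  have cd : 2 * c `^ (- (a + 2 * u)) <= d `^ (- u).
    by near: d; exact: near_const_le_powRN.
  rewrite leNgt; apply/negP => hZ.
  case/andP: (d01) => d0 d1.
  pose x := a + 2 * u; pose q := c * d.
  have q0 : 0 < q by rewrite mulr_gt0.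
  have q1 : q < 1 by rewrite (le_lt_trans _ d1)// ler_piMl// ltW.
  suff /(ub_le_sup (ex_intro _ B ubE)) : E x by rewrite /x -/a; lra.
  have M_ge : 2 * q `^ (- x) <= Z d * d `^ u.
    apply: (@le_trans _ _ (d `^ (- (a + e)) * d `^ u)); last first.
      by rewrite ler_wpM2r ?powR_ge0// ltW.
    rewrite powRM ?(ltW c0) ?(ltW d0)// mulrA -powRDn0//.
    have -> : - (a + e) + u = - u + - x by rewrite /x eE; lra.
    rewrite powRDn0//; by rewrite ler_wpM2r// powR_ge0.
  (* The factor 2 kept in [M_ge] becomes 2^n, which outweighs both [k] and the loss q^x from
     rounding [y] to a power of [q]. *)
  have [n0 hn0] : exists n0, (2^-1 : R) ^+ n0 < k * q `^ x.
    by apply: exprn_small; [lra|rewrite mulr_gt0// powR_gt0].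
  rewrite /E /=; near=> y.
  have y01 : 0 < y < 1 by near: y; exact: near_in01.
  have ysm : y < q ^+ n0.+1.
    by near: y; apply: nbhs_right_lt; rewrite exprn_gt0.
  case/andP: (y01) => y0 y1.
  have [||n /andP[yn1 yn]] := @exprn_between q y; [by rewrite q0|by rewrite y0 ltW|].
  have nn0 : (n0 < n)%N.
    rewrite -ltnS ltnNge; apply/negP => nn0.
    have : q ^+ n0.+1 <= q ^+ n.+1 by rewrite ler_wiXn2l// ltW.
    by move=> /le_lt_trans/(_ yn1)/lt_trans/(_ ysm); rewrite ltxx.
  have n_gt0 : (0 < n)%N by apply: leq_trans nn0.
  have qn1 : q ^+ n < 1 by rewrite exprn_ilt1// ?ltW// -lt0n.
  apply: le_trans (Nmono _ _ y0 yn qn1).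
  apply: le_trans (hk _ n_gt0).
  apply: (@le_trans _ _ (k * (2 * q `^ (- x)) ^+ n)); last first.
    have M0 : 0 <= 2 * q `^ (- x) by rewrite mulr_ge0 ?powR_ge0.
    by rewrite ler_pM2l// lerXn2r ?nnegrE// (le_trans M0).
  apply: (@le_trans _ _ ((q ^+ n.+1) `^ (- x))).
    rewrite powR_le_ln ?powR_gt0 ?exprn_gt0// ln_powR !mulNr lerN2.
    rewrite ler_wpM2l//; first by rewrite /x; lra.
    by rewrite ler_ln ?posrE ?exprn_gt0// ltW.
  rewrite powR_exprn ?(ltW q0)// exprSr exprMn mulrA [leRHS]mulrC.
  rewrite ler_wpM2l ?exprn_ge0 ?powR_ge0//.
  rewrite powRN -ler_pdivrMr ?exprn_gt0// mulrC -exprVn.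
  rewrite ler_pdivrMr ?powR_gt0//.
  apply: le_trans (ltW hn0); rewrite ler_wiXn2l ?(ltnW nn0)//; lra.
have Zlo e : 0 < e -> \forall d \near 0^'+, d `^ (- (a - e)) <= Z d.
  move=> e0; have e2 : 0 < e / 2 by lra.
  near=> d; have d01 : 0 < d < 1 by near: d; exact: near_in01.
  have d0 : 0 < d by case/andP: d01.
  have h1 : d `^ (- (a - e / 2)) <= N d by near: d; exact: Nlo.
  have h2 : N d <= d `^ (- (e / 2)) * Z d by near: d; exact: NZ.
  have := le_trans h1 h2; rewrite -ler_pdivrMl ?powR_gt0// -powRN -powRDn0//.
  by congr (_ `^ _ <= _); lra.
exists a => //; split=> e e0.
- have e2 : 0 < e / 2 by lra.
  near=> d; have d01 : 0 < d < 1 by near: d; exact: near_in01.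
  have d0 : 0 < d by case/andP: d01.
  apply/andP; split; first by near: d; exact: Nlo.
  apply: (@le_trans _ _ (d `^ (- (e / 2)) * Z d)).
    by near: d; exact: NZ.
  have -> : - (a + e) = - (e / 2) + - (a + e / 2) by lra.
  rewrite powRDn0// ler_wpM2l ?powR_ge0//.
  by near: d; exact: Zup.
- near=> d; apply/andP; split; near: d; [exact: Zlo|exact: Zup].
Unshelve. all: by end_near. Qed.

End Fekete.

(** * Stopping families of words *)

Section WordSeqs.
Variable T : choiceType.
Implicit Types (G : {fset T}) (w : seq T).

Fixpoint word_seq G n : seq (seq T) :=
  if n is n'.+1 then [seq x :: w | x <- enum_fset G, w <- word_seq G n']
  else [:: [::]].

Lemma mem_word_seq G n w : words G n w -> w \in word_seq G n.
Proof.
elim: n w => [|n IH] [|x w] [//= sw Gw].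
apply/allpairsP; exists (x, w) => /=; split=> //; first by apply: Gw; rewrite mem_head.
by apply: IH; split; [case: sw|move=> y yw; apply: Gw; rewrite inE yw orbT].
Qed.

Lemma finite_words G n : finite_set (words G n).
Proof. by apply: sub_finite_set (finite_seq (word_seq G n)) => w /mem_word_seq. Qed.

Lemma finite_bounded_words G n :
  finite_set [set w | (size w <= n)%N /\ {subset w <= G}].
Proof.
apply: sub_finite_set (finite_seq (flatten (map (word_seq G) (iota 0 n.+1)))).
move=> w [sw Gw]; apply/flatten_mapP; exists (size w).
  by rewrite mem_iota.
exact: mem_word_seq.
Qed.

Lemma parent_rcons w x : parent (rcons w x) = w.
Proof. by rewrite /parent size_rcons /= -cats1 take_size_cat. Qed.

End WordSeqs.

(** The smaller of two products is not multiplicative in the word, so only the effect of appending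
    one letter is required. This covers [min_ratio] for a carpet and the contraction ratio for an
    IFS on the line. *)
Definition ratio_bounds (R : realType) (T : choiceType) (G : {fset T})
    (m : seq T -> R) (r0 r1 : R) : Prop :=
  [/\ 0 < r0, r0 <= r1, r1 < 1, m [::] = 1 &
    forall w x, {subset rcons w x <= G} -> r0 * m w <= m (rcons w x) <= r1 * m w].

Section Stopping.
Variables (R : realType) (T : choiceType) (ev : seq T -> T) (G : {fset T}).
Variables (W : nat -> set (seq T)) (m : seq T -> R) (r0 r1 : R).
Hypothesis hW : reduced_words ev G W.
Hypothesis hm : ratio_bounds G m r0 r1.

Let r0_gt0 : 0 < r0. Proof. by case: hm. Qed.
Let r01 : r0 <= r1. Proof. by case: hm. Qed.
Let r1_lt1 : r1 < 1. Proof. by case: hm. Qed.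
Let m_nil : m [::] = 1. Proof. by case: hm. Qed.
Let m_rcons w x : {subset rcons w x <= G} -> r0 * m w <= m (rcons w x) <= r1 * m w.
Proof. by case: hm => _ _ _ _; apply. Qed.
Let r1_gt0 : 0 < r1. Proof. exact: lt_le_trans r01. Qed.

Definition cutset d := [set w | all_words W w /\ m w <= d < m (parent w)].
(* [stopped] is the case [m = min_ratio]; [awsc_family K] is the case where [m] is
   the contraction ratio, provided [K] has diameter 1. *)
Definition stop d : set T := ev @` cutset d.

Lemma reduced_word n w : (0 < n)%N -> W n w -> size w = n /\ {subset w <= G}.
Proof. by case: hW => _ h _ _ n0 Ww; exact: h Ww. Qed.

Lemma reduced_take n k w : (0 < k <= n)%N -> W n w -> W k (take k w).
Proof.
case: hW => _ _ _ hp; case/andP => k0; elim: n w => [|n IH] w.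
  by rewrite leqn0 => /eqP k_0; rewrite k_0 in k0.
rewrite leq_eqVlt => /predU1P[->|].
  by move=> Ww; rewrite take_oversize // (reduced_word _ Ww).1.
rewrite ltnS => kn Ww; have n0 : (0 < n)%N by apply: leq_trans kn.
have := IH _ kn (hp _ _ n0 Ww).
by rewrite /parent (reduced_word _ Ww).1 //= take_takel.
Qed.

Lemma reduced_ev n w : (0 < n)%N -> words G n w -> exists2 v, W n v & ev v = ev w.
Proof.
case: hW => _ _ hb _ n0 Ww; have [_ _ surj] := hb n n0.
have [|v Wv vw] := surj (ev w); first by exists w.
by exists v.
Qed.

Lemma m_bounds w : {subset w <= G} -> r0 ^+ size w <= m w <= r1 ^+ size w.
Proof.
elim/last_ind: w => [|w x IH] Gw; first by rewrite m_nil !expr0 lexx.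
have /IH/andP[h1 h2] : {subset w <= G}.
  by move=> y yw; apply: Gw; rewrite mem_rcons inE yw orbT.
have /andP[h3 h4] := m_rcons Gw; rewrite size_rcons !exprS; apply/andP; split.
  by apply: le_trans h3; rewrite ler_wpM2l// ltW.
by apply: (le_trans h4); rewrite ler_wpM2l// ltW.
Qed.

Lemma m_parent n w : (0 < n)%N -> W n w ->
  [/\ r0 * m (parent w) <= m w, m w <= r1 * m (parent w)
    & r0 ^+ n.-1 <= m (parent w) <= r1 ^+ n.-1].
Proof.
move=> n0 /(reduced_word n0); case: w / lastP => [[sw]|w x [sw Gw]].
  by rewrite -sw in n0.
have Gw' : {subset w <= G}.
  by move=> y yw; apply: Gw; rewrite mem_rcons inE yw orbT.
have /andP[h1 h2] := m_rcons Gw; rewrite parent_rcons; split=> //.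
by rewrite -sw size_rcons; exact: m_bounds.
Qed.

(** The shortest prefix with [m] at most [d] works: it is not empty because [m [::] = 1] exceeds
    [d], and prefixes of reduced words are reduced. *)
Lemma cut_prefix d n w : (0 < n)%N -> W n w -> m w <= d < 1 ->
  exists k, [/\ (0 < k <= n)%N & cutset d (take k w)].
Proof.
move=> n0 Ww /andP[wd d1]; have [sw Gw] := reduced_word n0 Ww.
have ex : exists k, m (take k w) <= d by exists n; rewrite take_oversize ?sw.
case: (ex_minnP ex) => -[|k] hk mink.
  by move: hk; rewrite take0 m_nil leNgt d1.
have kn : (k < n)%N by apply: mink; rewrite take_oversize ?sw.
exists k.+1; split=> //; split; first by exists k.+1 => //; apply: reduced_take Ww.
rewrite hk /parent size_takel ?sw//= take_takel// ltNge.
by apply/negP => /mink; rewrite ltnn.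
Qed.

Lemma cut_size d w : cutset d w -> [/\ (0 < size w)%N, W (size w) w,
  {subset w <= G}, r0 ^+ size w <= d & d < r1 ^+ (size w).-1].
Proof.
move=> [[n /= n0 Ww] /andP[wd dw]]; have [sw Gw] := reduced_word n0 Ww.
rewrite sw; split=> //.
  by have /andP[h _] := m_bounds Gw; rewrite -sw; exact: le_trans h wd.
by have [_ _ /andP[_ h]] := m_parent n0 Ww; exact: lt_le_trans h.
Qed.

Lemma cut_ratio d w : cutset d w -> r0 * d < m w <= d.
Proof.
move=> [[n /= n0 Ww] /andP[wd dw]]; rewrite wd andbT.
by have [h _ _] := m_parent n0 Ww; apply: lt_le_trans h; rewrite ltr_pM2l.
Qed.

Lemma stop_words d S : stop d S -> exists n, [/\ (0 < n)%N, (ev @` words G n) S,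
  r0 ^+ n <= d & d < r1 ^+ n.-1].
Proof.
by move=> [w /cut_size[s0 Ww Gw h1 h2] <-]; exists (size w); split=> //; exists w.
Qed.

(** A finite set serving all scales from [d] on bounds the suprema in [neighbours]; without it
    [ncard] and [sup] could fall back to their default 0. *)
Lemma stop_sub d : 0 < d -> exists2 A, finite_set A & forall c, d <= c -> stop c `<=` A.
Proof.
move=> d0; have [|n hn] := @exprn_small R r1 d _ d0; first by rewrite ltW ?r1_lt1.
exists (ev @` [set w | (size w <= n)%N /\ {subset w <= G}]).
  by apply: finite_image; exact: finite_bounded_words.
move=> c dc _ [w /cut_size[s0 Ww Gw h1 h2] <-]; exists w => //; split=> //.
have : r1 ^+ n < r1 ^+ (size w).-1 by rewrite (lt_trans hn)// (le_lt_trans dc).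
rewrite ltr_iXn2l//.
by case: (size w) s0.
Qed.

Lemma finite_stop d : 0 < d -> finite_set (stop d).
Proof.
by move=> /stop_sub[A Af hA]; apply: sub_finite_set Af; exact: hA.
Qed.

(** The last letter shrinks [m] by at least the factor [r1], so the interval from [m w] up to
    [m (parent w)] contains a power of [r1]. *)
Lemma stop_pow n w : (0 < n)%N -> W n w ->
  exists k, [/\ (n <= k)%N, r1 ^+ k.+1 < m w, r0 ^+ n <= r1 ^+ k & cutset (r1 ^+ k) w].
Proof.
move=> n0 Ww; have [sw Gw] := reduced_word n0 Ww.
have /andP[h1 h2] := m_bounds Gw; rewrite sw in h1 h2.
have [_ h3 /andP[_ h4]] := m_parent n0 Ww.
have [||k /andP[h5 h6]] := @exprn_between R r1 (m w); first by rewrite r1_gt0.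
  by rewrite (lt_le_trans _ h1) ?exprn_gt0//= (le_trans h2)// exprn_ile1// ltW.
have h7 : r1 ^+ k < m (parent w).
  by rewrite -(ltr_pM2l r1_gt0) -exprS; exact: lt_le_trans h3.
exists k; split=> //; last 2 first.
- exact: le_trans h6.
- by split; [exists n|rewrite h6].
have := lt_le_trans h7 h4; rewrite ltr_iXn2l//.
by case: (n) n0.
Qed.

Section Neighbours.
Variables (X : Type) (dist : X -> X -> R) (app : T -> X -> X) (K : set X).

Definition meeting c x := [set S | stop c S /\ (app S @` K) `&` cball dist x c !=set0].

Lemma finite_meeting c x : 0 < c -> finite_set (meeting c x).
Proof. by move=> c0; apply: sub_finite_set (finite_stop c0) => S []. Qed.

Lemma meeting_le_neighbours d c x : 0 < d -> d <= c <= 1 ->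
  ncard R (meeting c x) <= neighbours dist app K stop d.
Proof.
move=> d0 /andP[dc c1]; have [A Af hA] := stop_sub d0.
have bnd c' x' : d <= c' -> ncard R (meeting c' x') <= ncard R A.
  move=> dc'; rewrite !ncard_els ler_nat size_els_sub// => S [/(hA _ dc')].
  by [].
have bnd2 c' : d <= c' -> has_ubound [set ncard R (meeting c' x) | x in setT].
  by move=> dc'; exists (ncard R A) => _ [x' _ <-]; exact: bnd.
apply: (@le_trans _ _ (sup [set ncard R (meeting c x) | x in setT])).
  by apply: ub_le_sup; [exact: bnd2|exists x].
apply: ub_le_sup; last by exists c => //=; rewrite in_itv/= dc c1.
exists (ncard R A) => _ [c' /= + <-]; rewrite in_itv/= => /andP[dc' _].
by apply: ge_sup; [exists (ncard R (meeting c' x)), x|move=> _ [x' _ <-]; exact: bnd].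
Qed.

Lemma neighbours_le d B (x0 : X) : d <= 1 ->
  (forall c x, d <= c <= 1 -> ncard R (meeting c x) <= B) ->
  neighbours dist app K stop d <= B.
Proof.
move=> d1 hB; apply: ge_sup.
  by eexists; exists d => //=; rewrite in_itv/= lexx d1.
move=> _ [c /= + <-]; rewrite in_itv/= => cd; apply: ge_sup.
  by exists (ncard R (meeting c x0)), x0.
by move=> _ [x _ <-]; exact: hB.
Qed.

Lemma neighbours_ge1 d S x : 0 < d <= 1 -> meeting d x S ->
  1 <= neighbours dist app K stop d.
Proof.
move=> /andP[d0 d1] hS; apply: le_trans (@meeting_le_neighbours d d x d0 _); last first.
  by rewrite lexx.
rewrite ncard_els ler1n.
have : S \in els (meeting d x) by apply/elsP => //; exact: finite_meeting.
by case: (els _).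
Qed.

End Neighbours.
End Stopping.

(** * From bounds near scale 0 to bounds at all scales below a given one *)

Section GlobalBounds.
Variable R : realType.
Implicit Types (N : R -> R) (a b c d e D x y : R).

(** Whichever sign [x] has, one of the end points bounds the power; taking the sum spares later case
    distinctions. *)
Lemma powR_between x a b d : 0 < a -> a <= d <= b -> d `^ x <= a `^ x + b `^ x.
Proof.
move=> a0 /andP[ad db]; have d0 : 0 < d by apply: lt_le_trans ad.
have b0 : 0 < b by apply: lt_le_trans db.
case: (leP 0 x) => x0.
  rewrite ler_wpDl ?powR_ge0//.
  by apply: ge0_ler_powR => //; rewrite nnegrE ltW.
rewrite ler_wpDr ?powR_ge0// powR_le_ln ?powR_gt0// ln_powR.
by rewrite ler_wnM2l ?ler_ln ?posrE// ltW.
Qed.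

Lemma exponent_upper N a e D : has_exponent N a ->
  (forall d d', 0 < d -> d <= d' -> N d' <= N d) -> 0 < e ->
  exists2 C, 0 < C & forall d, 0 < d <= D -> N d <= C * d `^ (- (a + e)).
Proof.
move=> hN Nmono e0; have /near_right0[d0 d0_gt0 hd0] := hN e e0.
pose p := - (a + e); pose d1 := d0 / 2.
have d1_gt0 : 0 < d1 by rewrite divr_gt0.
have [N1_ge0|N1_lt0] := leP 0 (N d1); last first.
  exists 1 => // d /andP[dgt dD]; rewrite mul1r; case: (ltP d d0) => dd0.
    by have /andP[] := hd0 d (introT andP (conj dgt dd0)).
  apply: (@le_trans _ _ (N d1)); first by apply: Nmono => //; rewrite /d1; lra.
  by apply: (le_trans (ltW N1_lt0)); exact: powR_ge0.
pose S := d1 `^ (- p) + D `^ (- p).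
have S0 : 0 <= S by rewrite addr_ge0 ?powR_ge0.
exists (1 + N d1 * S); first by rewrite ltr_pwDl// mulr_ge0.
move=> d /andP[dgt dD]; rewrite mulrDl mul1r -/p; case: (ltP d d0) => dd0.
  rewrite ler_wpDr//; first by rewrite !mulr_ge0 ?powR_ge0.
  by have /andP[] := hd0 d (introT andP (conj dgt dd0)).
rewrite ler_wpDl ?powR_ge0//.
have h : d `^ (- p) <= S by apply: powR_between => //; rewrite dD /d1; lra.
apply: (@le_trans _ _ (N d1)); first by apply: Nmono => //; rewrite /d1; lra.
rewrite -mulrA ler_peMr//.
by rewrite -ler_pdivrMr ?powR_gt0// div1r -powRN.
Qed.

Lemma exponent_lower N a e D : has_exponent N a ->
  (forall d, 0 < d -> 1 <= N d) -> 0 < e ->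
  exists2 C, 0 < C & forall d, 0 < d <= D -> C * d `^ (- (a - e)) <= N d.
Proof.
move=> hN N1 e0; have /near_right0[d0 d0_gt0 hd0] := hN e e0.
pose p := - (a - e).
pose S := d0 `^ p + D `^ p.
have S0 : 0 <= S by rewrite addr_ge0 ?powR_ge0.
exists (1 + S)^-1; first by rewrite invr_gt0 ltr_pwDl.
move=> d /andP[dgt dD]; rewrite -/p ler_pdivrMl ?ltr_pwDl//.
have Nd1 := N1 d dgt; rewrite mulrDl mul1r; case: (ltP d d0) => dd0.
  rewrite ler_wpDr//; first by rewrite mulr_ge0// (le_trans _ Nd1).
  by have /andP[] := hd0 d (introT andP (conj dgt dd0)).
rewrite ler_wpDl//; first by rewrite (le_trans _ Nd1).
apply: (@le_trans _ _ S); last by rewrite ler_peMr.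
by apply: powR_between => //; rewrite dd0.
Qed.

End GlobalBounds.

(** * Attractors and their stopped pieces *)

Section Attractor.
Variables (R : realType) (T : choiceType) (X : Type).
Variables (comp : T -> T -> T) (tid : T) (app : T -> X -> X).
Hypothesis app_comp : forall f g, app (comp f g) = app f \o app g.
Hypothesis app_id : forall x, app tid x = x.
Variables (G : {fset T}) (K : set X).
Hypothesis hK : K = \bigcup_(S in [set` G]) (app S @` K).

Let ev := foldr comp tid.

Lemma app_ev_cat u v x : app (ev (u ++ v)) x = app (ev u) (app (ev v) x).
Proof.
by elim: u => [|f u IH] /=; [rewrite app_id|rewrite !app_comp /= IH].
Qed.

Lemma app_ev_sub w : {subset w <= G} -> app (ev w) @` K `<=` K.
Proof.
elim: w => [|f w IH] Gw _ [x Kx <-] /=; first by rewrite app_id.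
rewrite app_comp /= hK; exists f; first by rewrite /= Gw// mem_head.
exists (app (ev w) x) => //; apply: IH; last by exists x.
by move=> y yw; apply: Gw; rewrite inE yw orbT.
Qed.

Lemma app_ev_cover n x : K x -> exists w, words G n w /\ (app (ev w) @` K) x.
Proof.
elim: n x => [|n IH] x Kx.
  by exists [::]; split=> //; exists x => //=; rewrite app_id.
move: (Kx); rewrite {1}hK => -[f /= fG [y Ky yx]].
have [w [[sw Gw] [z Kz zy]]] := IH y Ky.
exists (f :: w); split.
  by split=> /=; [rewrite sw|move=> g; rewrite inE => /predU1P[->|/Gw]].
by exists z => //=; rewrite app_comp /= zy.
Qed.

Variables (W : nat -> set (seq T)) (m : seq T -> R) (r0 r1 : R).
Hypothesis hW : reduced_words ev G W.
Hypothesis hm : ratio_bounds G m r0 r1.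

(** A cylinder word through [x] need not be reduced, and only reduced words can be cut at scale [d];
    the reduced word of the same map has the same image. *)
Lemma stop_cover d x : 0 < d < 1 -> K x -> exists2 S, stop ev W m d S & (app S @` K) x.
Proof.
move=> /andP[d0 d1] Kx.
have [r0_gt0 r01 r1_lt1 _ _] := hm.
have r1_gt0 : 0 < r1 by exact: lt_le_trans r01.
have [|n hn] := @exprn_small R r1 d _ d0; first by rewrite r1_lt1 ltW.
have [w [Ww wx]] := app_ev_cover n.+1 Kx.
have [v Wv vw] := reduced_ev hW (ltn0Sn n) Ww.
have [sv Gv] := reduced_word hW (ltn0Sn n) Wv.
have mv : m v <= d.
  have /andP[_ h] := m_bounds hm Gv.
  apply: (le_trans h); rewrite sv exprS; apply: le_trans (ltW hn).
  by rewrite ler_piMl ?exprn_ge0 ?ltW.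
have [|k [kn kc]] := cut_prefix hW hm (ltn0Sn n) Wv (d := d); first by rewrite mv.
exists (ev (take k v)); first by exists (take k v).
move: wx; rewrite -vw -[in X in app (ev X)](cat_take_drop k v) => -[y Ky <-].
rewrite app_ev_cat; exists (app (ev (drop k v)) y) => //; apply: app_ev_sub; last by exists y.
by move=> z /mem_drop /Gv.
Qed.

End Attractor.

(** * Self-similar sets on the line *)

Lemma count_le1 (T : eqType) (P : pred T) (p : seq T) : uniq p ->
  {in p &, forall x y, P x -> P y -> x = y} -> (count P p <= 1)%N.
Proof.
move=> up h; rewrite -size_filter; have fu := filter_uniq P up.
have : {in [seq x <- p | P x] &, forall x y, x = y}.
  by move=> x y; rewrite !mem_filter => /andP[Px xp] /andP[Py yp]; exact: h.
move: [seq x <- p | P x] fu => [//|x [//|y q]] /= /andP[+ _] hf.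
by rewrite (hf x y) ?inE ?eqxx ?orbT.
Qed.

Section LineCoverings.
Variable R : realType.
Implicit Types (K : set R) (f : aff R) (d : R) (s : seq R).

Local Notation N := (covering_number (@dist1 R)).
Local Notation covers := (covers (@dist1 R)).

Lemma dist1E (x y : R) : dist1 x y = `|x - y|. Proof. by []. Qed.

Lemma unit_covers d : 0 < d -> exists2 s, covers `[0, 1] d s & (size s)%:R <= d^-1 + 1.
Proof.
move=> d0; pose n := Num.truncn d^-1.
exists [seq i%:R * d | i <- iota 0 (n + 1)].
  move=> x /=; rewrite in_itv/= => /andP[x0 x1].
  have /andP[h1 h2] : (Num.truncn (x / d))%:R <= x / d < (Num.truncn (x / d)).+1%:R.
    by rewrite truncn_itv// divr_ge0// ltW.
  exists ((Num.truncn (x / d))%:R * d).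
    apply/mapP; exists (Num.truncn (x / d)) => //.
    rewrite mem_iota /= add0n addn1 ltnS; apply: le_truncn.
    by rewrite ler_pdivrMr// mulVf// gt_eqF.
  rewrite /cball /= dist1E distrC ger0_norm ?subr_ge0 -?ler_pdivlMr//.
  rewrite lerBlDr; move: h2; rewrite ltr_pdivrMr// -natr1 mulrDl mul1r addrC.
  exact: ltW.
rewrite size_map size_iota natrD lerD2r truncn_le.
by rewrite invr_ge0 ltW.
Qed.

Lemma unit_covers1 d : 1 <= d -> covers `[0, 1] d [:: 0].
Proof.
move=> d1 x /=; rewrite in_itv/= => /andP[x0 x1]; exists 0; first by rewrite /= inE.
by rewrite /cball /= dist1E sub0r normrN ger0_norm// (le_trans x1).
Qed.

Lemma unit_subset_covers K d : K `<=` `[0, 1] -> 0 < d -> exists s, covers K d s.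
Proof.
move=> K01 /unit_covers[s hs _]; exists s.
by apply: sub_covers hs.
Qed.

Lemma unit_N_le K d : K `<=` `[0, 1] -> 0 < d -> N K d <= d^-1 + 1.
Proof.
move=> K01 /unit_covers[s hs]; apply: le_trans; apply: covering_number_le.
by apply: sub_covers hs.
Qed.

Lemma unit_N_le1 K d : K `<=` `[0, 1] -> 1 <= d -> N K d <= 1.
Proof.
move=> K01 /unit_covers1 h; rewrite -[leRHS]/((size [:: (0 : R)])%:R).
by apply: covering_number_le; apply: sub_covers h.
Qed.

Lemma unit_N_mono K d d' : K `<=` `[0, 1] -> 0 < d -> d <= d' -> N K d' <= N K d.
Proof.
move=> K01 d0 dd'; have [s Ks] := unit_subset_covers K01 d0.
by apply: covering_number_mono Ks _ dd'.
Qed.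

Lemma unit_N_ge1 K d : K `<=` `[0, 1] -> K !=set0 -> 0 < d -> 1 <= N K d.
Proof.
move=> K01 Kn d0; have [s Ks] := unit_subset_covers K01 d0.
exact: covering_number_ge1 Ks Kn.
Qed.

Lemma aff_dist f x y : dist1 (aff_fun f x) (aff_fun f y) = `|f.1| * dist1 x y.
Proof. by rewrite !dist1E /aff_fun -normrM; congr (`| _ |); ring. Qed.

Lemma aff_covers f K d s : covers K d s -> covers (aff_fun f @` K) (`|f.1| * d) (map (aff_fun f) s).
Proof.
move=> Ks _ [x /Ks[c /= cs cx] <-]; exists (aff_fun f c); first exact: map_f.
by rewrite /cball /= aff_dist ler_wpM2l.
Qed.

Lemma aff_N f K d : f.1 != 0 -> K `<=` `[0, 1] -> 0 < d ->
  exists2 s, covers (aff_fun f @` K) d s & (size s)%:R = N K (d / `|f.1|).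
Proof.
move=> f0 K01 d0; have [|s0 Ks0] := @unit_subset_covers K (d / `|f.1|) K01.
  by rewrite divr_gt0 ?normr_gt0.
have [s Ks ->] := covering_number_attained Ks0.
exists (map (aff_fun f) s); last by rewrite size_map.
by have := aff_covers (f := f) Ks; rewrite mulrCA divff ?mulr1 ?normr_eq0.
Qed.

(** Centres whose balls miss the image do not contribute, so the preimages of the remaining ones
    already cover [K] at the rescaled radius. *)
Lemma N_pullback f K d s : f.1 != 0 -> covers (aff_fun f @` K) d s ->
  N K (d / `|f.1|) <=
  (count (fun c => `[< (aff_fun f @` K) `&` cball (@dist1 R) c d !=set0 >]) s)%:R.
Proof.
move=> f0 Ks; set P := (X in count X); rewrite -size_filter.
pose g c := (c - f.2) / f.1.
have gK c : aff_fun f (g c) = c by rewrite /aff_fun /g mulrCA divff// mulr1 subrK.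
rewrite -(size_map g); apply: covering_number_le => x Kx.
have [|c /= cs cx] := Ks (aff_fun f x); first by exists x.
exists (g c).
  apply/mapP; exists c => //; rewrite mem_filter cs andbT; apply/asboolP.
  by exists (aff_fun f x); split=> //; exists x.
rewrite /cball /= ler_pdivlMr ?normr_gt0// mulrC -aff_dist gK.
exact: cx.
Qed.

(** A separated set of maximal size is a cover. Sizes are bounded because a ball of radius d / 2
    holds at most one of its points; separation is strict to match closed balls. *)
Lemma exists_separated K d s : 0 < d -> covers K (d / 2) s ->
  exists p : seq R, [/\ uniq p, {in p, forall x, K x}, covers K d p &
    {in p &, forall x y, dist1 x y <= d -> x = y}].
Proof.
move=> d0 Ks.
pose sep p := [/\ uniq p, {in p, forall x, K x} &
    {in p &, forall x y, dist1 x y <= d -> x = y}].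
have exn : exists n, `[< exists2 p, sep p & size p = n >].
  by exists 0%N; apply/asboolP; exists [::].
have bnd n : `[< exists2 p, sep p & size p = n >] -> (n <= size s)%N.
  move=> /asboolP[p [up Kp sp] <-].
  pose meets (x c : R) := dist1 c x <= d / 2.
  have := @double_count _ _ p s meets (fun=> 1%N) 1.
  rewrite sum1_size mul1n; apply.
    move=> c _; apply: count_le1 => // x y xp yp; rewrite /meets !dist1E => xc yc.
    apply: sp => //; rewrite dist1E.
    have -> : x - y = (c - y) - (c - x) by ring.
    by rewrite (le_trans (ler_normB _ _))//; lra.
  move=> x /Kp/Ks[c /= cs cx]; rewrite -has_count; apply/hasP.
  by exists c.
case: (ex_maxnP exn bnd) => n /asboolP[p [up Kp sp] pn] maxn.
exists p; split=> // x Kx; apply: contrapT => nc.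
have far y : y \in p -> ~ dist1 y x <= d by move=> yp yx; apply: nc; exists y.
have : (n.+1 <= n)%N; last by rewrite ltnn.
apply: maxn; apply/asboolP; exists (x :: p); last by rewrite /= pn.
split.
- rewrite /= up andbT; apply/negP => /far; apply.
  by rewrite dist1E subrr normr0 ltW.
- by move=> y; rewrite inE => /predU1P[->|/Kp].
- move=> y z; rewrite !inE => /predU1P[->|yp] /predU1P[->|zp] //.
  + by rewrite dist1E distrC => /(far z).
  + by move/(far y).
  + exact: sp.
Qed.

End LineCoverings.

Section SelfSimilar.
Variables (R : realType) (F : {fset aff R}) (K : set R).
Variables (V : nat -> set (seq (aff R))) (r0 r1 : R).
Hypothesis hV : reduced_words (@aff_word R) F V.
Hypothesis r0_gt0 : 0 < r0.
Hypothesis r01 : r0 <= r1.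
Hypothesis r1_lt1 : r1 < 1.
Hypothesis hF : forall f, f \in F -> r0 <= `|f.1| <= r1.
Hypothesis Kn0 : K !=set0.
Hypothesis K01 : K `<=` `[0, 1].
Hypothesis hK : K = \bigcup_(f in [set` F]) (aff_fun f @` K).

Local Notation N := (covering_number (@dist1 R) K).

Let r1_gt0 : 0 < r1. Proof. exact: lt_le_trans r01. Qed.

Definition aratio (w : seq (aff R)) : R := `|(aff_word w).1|.

Lemma aratio_nil : aratio [::] = 1. Proof. by rewrite /aratio /= normr1. Qed.

Lemma aff_word_cat1 (u v : seq (aff R)) :
  (aff_word (u ++ v)).1 = (aff_word u).1 * (aff_word v).1.
Proof. by elim: u => [|f u IH] /=; [rewrite mul1r|rewrite IH mulrA]. Qed.

Lemma aratio_rcons w f : {subset rcons w f <= F} ->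
  r0 * aratio w <= aratio (rcons w f) <= r1 * aratio w.
Proof.
move=> Fw; have /hF/andP[h1 h2] : f \in F.
  by apply: Fw; rewrite mem_rcons mem_head.
rewrite /aratio -cats1 aff_word_cat1 /= mulr1 normrM [_ * `|f.1|]mulrC.
by rewrite !ler_wpM2r.
Qed.

Lemma aratio_bounds : ratio_bounds F aratio r0 r1.
Proof. by split=> //; [exact: aratio_nil|exact: aratio_rcons]. Qed.

Definition astop := stop (@aff_word R) V aratio.

Lemma astop_cover d x : 0 < d < 1 -> K x -> exists2 f, astop d f & (aff_fun f @` K) x.
Proof.
apply: (@stop_cover R _ _ (@aff_comp R) (aff_id R) (@aff_fun R) _ _ F K hK V aratio r0 r1) => //.
- exact: aff_compE.
- by move=> y; rewrite /aff_fun /= mul1r addr0.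
- exact: aratio_bounds.
Qed.

Lemma astop_ratio d f : astop d f -> r0 * d < `|f.1| <= d.
Proof. by move=> [w /(cut_ratio hV aratio_bounds) h <-]. Qed.

Lemma aff_image_unit f x y : (aff_fun f @` K) x -> (aff_fun f @` K) y ->
  dist1 x y <= `|f.1|.
Proof.
move=> [u /K01 + <-] [v /K01 + <-]; rewrite /= !in_itv/= => /andP[u0 u1] /andP[v0 v1].
rewrite aff_dist ler_piMr// dist1E ler_norml; lra.
Qed.

(* The cylinders of ratio at most [d1 / 4] through the points of a [d1]-separated
   set are so far apart that a ball of the smaller scale meets at most one. *)
Lemma N_supermul d1 d2 : 0 < d1 < 1 -> 0 < d2 < 1 ->
  N d1 * N d2 <= N (r0 / 4 * (d1 * d2)).
Proof.
move=> /andP[d1_gt0 d1_lt1] /andP[d2_gt0 d2_lt1].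
set d := r0 / 4 * (d1 * d2).
have d0 : 0 < d by rewrite !mulr_gt0 ?divr_gt0.
have [s0 hs0] := unit_subset_covers K01 d0.
have [s hs ->] := covering_number_attained hs0.
have [t0 ht0] := unit_subset_covers K01 d2_gt0.
have [t ht N2] := covering_number_attained ht0.
have d1h : 0 < d1 / 2 by rewrite divr_gt0.
have [q hq] := unit_subset_covers K01 d1h.
have [p [up Kp pK sp]] := exists_separated d1_gt0 hq.
have /choice[S hS] : forall x : R, exists f, K x -> astop (d1 / 4) f /\ (aff_fun f @` K) x.
  move=> x; have [Kx|//] := pselect (K x); last by exists (aff_id R).
  have [|f f1 f2] := @astop_cover (d1 / 4) x _ Kx; first by lra.
  by exists f.
pose meets x c := `[< (aff_fun (S x) @` K) `&` cball (@dist1 R) c d !=set0 >].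
have key : (\sum_(x <- p) size t <= 1 * size s)%N.
  apply: (@double_count _ _ p s meets).
    move=> c _; apply: count_le1 => // x y xp yp.
    move=> /asboolP[u [ux uc]] /asboolP[v [vy vc]].
    have [/astop_ratio/andP[_ hx] xx] := hS x (Kp _ xp).
    have [/astop_ratio/andP[_ hy] yy] := hS y (Kp _ yp).
    have h1 := le_trans (aff_image_unit xx ux) hx.
    have h2 := le_trans (aff_image_unit yy vy) hy.
    (* Then [x] and [y] are at distance at most d1 / 4 + d + d + d1 / 4 <= d1. *)
    have dd1 : 4 * d <= d1.
      have -> : 4 * d = r0 * d2 * d1 by rewrite /d; field.
      by rewrite ler_piMl ?(ltW d1_gt0)// mulr_ile1 ?ltW// (le_lt_trans r01).
    apply: sp => //; move: h1 h2 uc vc; rewrite /cball /= !dist1E => h1 h2 uc vc.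
    have -> : x - y = (x - u) - (c - u) + ((c - v) - (y - v)) by ring.
    have := ler_normD (x - u - (c - u)) (c - v - (y - v)).
    have := ler_normB (x - u) (c - u); have := ler_normB (c - v) (y - v).
    lra.
  move=> x xp; have [hx xx] := hS x (Kp _ xp); have /andP[h1 h2] := astop_ratio hx.
  have Sx0 : 0 < `|(S x).1| by apply: le_lt_trans h1; rewrite mulr_ge0 ?divr_ge0 ?ltW.
  rewrite -(ler_nat R) -N2.
  have hc : covers (@dist1 R) (aff_fun (S x) @` K) d s.
    apply: sub_covers hs => //; case: hx => w /(cut_size hV aratio_bounds)[_ _ Fw _ _] <-.
    apply: (@app_ev_sub _ _ (@aff_comp R) (aff_id R) (@aff_fun R)) hK _ Fw => //.
      exact: aff_compE.
    by move=> y; rewrite /aff_fun /= mul1r addr0.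
  apply: le_trans (N_pullback _ hc); last by rewrite -normr_gt0.
  apply: unit_N_mono => //; first by rewrite divr_gt0.
  rewrite ler_pdivrMr// mulrC -ler_pdivrMr//.
  (* The ratio of [S x] exceeds r0 * (d1 / 4), hence the constant r0 / 4 in the scale [d]. *)
  have -> : d / d2 = r0 * (d1 / 4) by rewrite /d; field; rewrite gt_eqF.
  exact: ltW.
rewrite N2; apply: (@le_trans _ _ ((size p)%:R * (size t)%:R)).
  by rewrite ler_wpM2r// covering_number_le.
rewrite -natrM ler_nat; move: key.
by rewrite mul1n big_const_seq count_predT iter_addn_0 mulnC.
Qed.

(** [N_supermul] iterated along the powers of one scale is the hypothesis of
    [submultiplicative_exponent] with [Z] equal to [N]; the exponent 2 leaves room for the bound
    d^(-1) + 1. *)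
Lemma N_exponent : exists2 s, 0 <= s & has_exponent N s.
Proof.
have r4 : 0 < r0 / 4 <= 1.
  by rewrite divr_gt0//=; have := le_lt_trans r01 r1_lt1; lra.
have [|||||s s0 [hs _]] := @submultiplicative_exponent R N N (r0 / 4) 2 r4.
- by move=> d /andP[d0 _]; exact: unit_N_ge1.
- by move=> d d' d0 dd' _; exact: unit_N_mono.
- near=> d; have d01 : 0 < d < 1 by near: d; exact: near_in01.
  have d2 : d < 1 / 2 by near: d; apply: nbhs_right_lt.
  case/andP: d01 => d0 d1; apply: (le_trans (unit_N_le K01 d0)).
  rewrite (powR_invn 2 (ltW d0)) -[leRHS]mul1r ler_pdivlMr ?exprn_gt0//.
  have -> : (d^-1 + 1) * d ^+ 2 = d + d ^+ 2 by field; rewrite gt_eqF.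
  by nra.
- move=> e e0; near=> d; have d01 : 0 < d < 1 by near: d; exact: near_in01.
  have d0 : 0 < d by case/andP: d01.
  rewrite ler_peMl//; first by rewrite (le_trans _ (unit_N_ge1 K01 Kn0 d0)).
  by near: d; exact: near_const_le_powRN.
- move=> e e0; near=> d; have d01 : 0 < d < 1 by near: d; exact: near_in01.
  have d0 : 0 < d by case/andP: d01.
  have cd0 : 0 < r0 / 4 * d by rewrite mulr_gt0//; case/andP: r4.
  have cd1 : r0 / 4 * d < d.
    by rewrite gtr_pMl//; have := le_lt_trans r01 r1_lt1; lra.
  exists 1 => // n n0; rewrite mul1r.
  apply: (@le_trans _ _ (N d ^+ n)).
    have Nd0 : 0 <= N d by rewrite (le_trans _ (unit_N_ge1 K01 Kn0 d0)).
    rewrite lerXn2r ?nnegrE ?mulr_ge0 ?powR_ge0// ler_piMr//.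
    rewrite -[leRHS](powRr0 d); apply: ger_powR; last exact: ltW.
    by case/andP: d01 => -> /ltW ->.
  case: n n0 => // n _; elim: n => [|n IH].
    by rewrite !expr1 unit_N_mono// ltW.
  rewrite exprSr; apply: (@le_trans _ _ (N ((r0 / 4 * d) ^+ n.+1) * N d)).
    by rewrite ler_wpM2r// (le_trans _ (unit_N_ge1 K01 Kn0 d0)).
  have -> : (r0 / 4 * d) ^+ n.+2 = r0 / 4 * ((r0 / 4 * d) ^+ n.+1 * d).
    by rewrite exprSr; ring.
  apply: N_supermul => //; rewrite exprn_gt0//= exprn_ilt1 ?ltW//.
  by rewrite (lt_trans cd1)//; case/andP: d01.
by exists s.
Unshelve. all: by end_near. Qed.

Lemma sum_const_seq (T : Type) (s : seq T) (c : R) : \sum_(x <- s) c = (size s)%:R * c.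
Proof. by rewrite big_const_seq count_predT iter_addr_0 mulr_natl. Qed.

(** Each stopped piece meets some ball of an optimal cover, and each ball meets at most [neighbours]
    pieces. *)
Lemma card_astop_le d : 0 < d < 1 ->
  (size (els (astop d)))%:R <= neighbours (@dist1 R) (@aff_fun R) K astop d * N d.
Proof.
move=> /andP[d0 d1]; have [s0 hs0] := unit_subset_covers K01 d0.
have [s hs ->] := covering_number_attained hs0.
rewrite -[leLHS]mulr1 -sum_const_seq mulrC -sum_const_seq.
pose t c := els (meeting (@aff_word R) V aratio (@dist1 R) (@aff_fun R) K d c).
apply: (@le_trans _ _ (\sum_(c <- s) \sum_(f <- t c) 1)).
  apply: ler_sum_cover => //; first exact: uniq_els.
  move=> f /elsP -/(_ (finite_stop hV aratio_bounds d0)) hf.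
  have [x Kx] := Kn0.
  have : K (aff_fun f x).
    case: (hf) => w /(cut_size hV aratio_bounds)[_ _ Fw _ _] <-.
    apply: (@app_ev_sub _ _ (@aff_comp R) (aff_id R) (@aff_fun R)) hK _ Fw _ _ => //.
    - exact: aff_compE.
    - by move=> y; rewrite /aff_fun /= mul1r addr0.
    - by exists x.
  move=> /hs[c /= cs cx]; apply/hasP; exists c => //.
  apply/elsP; first exact: (finite_meeting hV aratio_bounds).
  by split=> //; exists (aff_fun f x); split=> //; exists x.
rewrite big_seq [leRHS]big_seq; apply: ler_sum => c _.
rewrite sum_const_seq mulr1; apply: (meeting_le_neighbours hV aratio_bounds) => //.
by rewrite lexx ltW.
Qed.

End SelfSimilar.

Lemma covering_number_union (R : realType) (X : choiceType) (dist : X -> X -> R)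
    (I : eqType) (A : seq I) (B : I -> set X) (M : I -> R) (K : set X) (d : R) :
  (forall x, K x -> exists2 i, i \in A & B i x) ->
  (forall i, i \in A -> exists2 s, covers dist (B i) d s & (size s)%:R <= M i) ->
  covering_number dist K d <= \sum_(i <- A) M i.
Proof.
move=> hK hB.
suff [s hs sM] : exists2 s, covers dist (\bigcup_(i in [set` A]) B i) d s &
    (size s)%:R <= \sum_(i <- A) M i.
  apply: le_trans sM; apply: covering_number_le; exact: sub_covers hs.
elim: A hB {hK} => [|i A IH] hB.
  by exists [::] => [x [i]//|]; rewrite big_nil.
have [|s hs sM] := IH; first by move=> j jA; apply: hB; rewrite inE jA orbT.
have [t ht tM] := hB i (mem_head _ _).
exists (t ++ s); last by rewrite big_cons size_cat natrD lerD.
move=> x [j /=]; rewrite inE => /predU1P[->|jA] Bx.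
  by have [c /= ct cx] := ht x Bx; exists c => //=; rewrite mem_cat ct.
have [|c /= cs cx] := hs x; first by exists j.
by exists c => //=; rewrite mem_cat cs orbT.
Qed.

(** * Summation over scales and over word lengths *)

Section Scales.
Variable R : realType.
Implicit Types (a b c d e q x y : R).

Lemma geometric_tail q n j : 0 < q < 1 ->
  \sum_(k <- iota n j) q ^+ k <= q ^+ n / (1 - q).
Proof.
move=> /andP[q0 q1]; have q1' : 0 < 1 - q by lra.
elim: j n => [|j IH] n /=; first by rewrite big_nil divr_ge0 ?exprn_ge0 ?ltW.
rewrite big_cons; apply: (le_trans (lerD (lexx _) (IH n.+1))).
rewrite ler_pdivlMr// mulrDl divfK ?gt_eqF// exprS; lra.
Qed.

Lemma near_pow q (P : R -> Prop) : 0 < q < 1 -> (\forall d \near 0^'+, P d) ->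
  \forall n \near \oo, forall k, (n <= k)%N -> P (q ^+ k).
Proof.
move=> /andP[q0 q1] /near_right0[e e0 he].
have [|n0 hn0] := @exprn_small R q e _ e0; first by rewrite q1 ltW.
exists n0 => // n /= n0n k nk; apply: he; rewrite exprn_gt0//=.
by apply: le_lt_trans hn0; rewrite ler_wiXn2l ?ltW// (leq_trans n0n).
Qed.

(** With y = d^(-e/2) the logarithmic term is a multiple of ln y < y, while the right side is y *
    y. *)
Lemma near_gt_ln e C : 0 < e -> 0 < C ->
  \forall d \near (0 : R)^'+, 1 - ln d * C < d `^ (- e).
Proof.
move=> e0 C0; have e2 : 0 < e / 2 by lra.
near=> d; have d01 : 0 < d < 1 by near: d; exact: near_in01.
have d0 : 0 < d by case/andP: d01.
have : 1 + 2 * C / e <= d `^ (- (e / 2)) by near: d; exact: near_const_le_powRN.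
set y := d `^ (- (e / 2)) => h2; have y0 : 0 < y by exact: powR_gt0.
have h1 := ln_sublinear y0.
have -> : d `^ (- e) = y * y by rewrite -powRDn0//; congr (_ `^ _); lra.
have h3 : - ln d * C = 2 * C / e * ln y by rewrite /y ln_powR; field; rewrite gt_eqF.
have c0 : 0 < 2 * C / e by rewrite divr_gt0// mulr_gt0.
have h4 : 2 * C / e * ln y < 2 * C / e * y by rewrite ltr_pM2l.
have h5 : 1 <= y by lra.
have h6 : (1 + 2 * C / e) * y <= y * y by rewrite ler_pM2r.
by rewrite -mulNr h3; lra.
Unshelve. all: by end_near. Qed.

End Scales.

Section Levels.
Variables (R : realType) (T : choiceType) (ev : seq T -> T) (G : {fset T}).
Variables (W : nat -> set (seq T)) (m : seq T -> R) (r0 r1 : R).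
Hypothesis hW : reduced_words ev G W.
Hypothesis hm : ratio_bounds G m r0 r1.
Variable Phi : T -> R.
Hypothesis Phi_ge0 : forall S, 0 <= Phi S.

Local Notation level n := (ev @` words G n).
Local Notation stop := (stop ev W m).

Lemma finite_level n : finite_set (level n).
Proof. by apply: finite_image; exact: finite_words. Qed.

(** A word of length [n] is stopped at a scale r1^k with k >= n, where the sum is at most q^k for q
    = r1^e; the tail q^n / (1 - q) is below 1 for large [n]. *)
Lemma level_sum_small e : 0 < e ->
  (\forall d \near 0^'+, \sum_(S <- els (stop d)) Phi S <= d `^ e) ->
  \forall n \near \oo, \sum_(S <- els (level n)) Phi S < 1.
Proof.
move=> e0 h; have [r0_gt0 r01 r1_lt1 _ _] := hm.
have r1_gt0 : 0 < r1 by exact: lt_le_trans r01.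
have r1b : 0 < r1 < 1 by rewrite r1_gt0.
pose q := r1 `^ e; have q0 : 0 < q by exact: powR_gt0.
have q1 : q < 1 by rewrite /q powR_lt_ln// ln1 pmulr_rlt0// ln_lt0.
have [||n1 hn1] := @exprn_small R q (1 - q); [by rewrite q1 ltW|by lra|].
near=> n; have n0 : (0 < n)%N by near: n; exact: nbhs_infty_gt.
have hpow : forall k, (n <= k)%N ->
    \sum_(S <- els (stop (r1 ^+ k))) Phi S <= (r1 ^+ k) `^ e.
  by near: n; exact: (near_pow r1b h).
(* Ratios of words of length [n] are at least r0^n, so the exponents [k] stay below [M]. *)
have [|M hM] := @exprn_small R r1 (r0 ^+ n) _ (exprn_gt0 _ r0_gt0).
  by rewrite ltW.
apply: (@le_lt_trans _ _ (\sum_(k <- iota n M) \sum_(S <- els (stop (r1 ^+ k))) Phi S)).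
  apply: ler_sum_cover => //; first exact: uniq_els.
  move=> S /elsP -/(_ (finite_level n))[w /(reduced_ev hW n0)[v Wv <-] <-].
  have [k [nk h1 h2 h3]] := stop_pow hW hm n0 Wv.
  apply/hasP; exists k; last first.
    by apply/elsP; [apply: (finite_stop hW hm); rewrite exprn_gt0|exists v].
  rewrite mem_iota nk /=.
  have kM : (k < M)%N.
    rewrite ltnNge; apply/negP => Mk.
    have : r1 ^+ k <= r1 ^+ M by rewrite ler_wiXn2l// ltW.
    by move=> /(le_trans h2)/le_lt_trans/(_ hM); rewrite ltxx.
  by rewrite (leq_trans kM)// leq_addl.
apply: (@le_lt_trans _ _ (\sum_(k <- iota n M) q ^+ k)).
  rewrite big_seq [leRHS]big_seq; apply: ler_sum => k.
  rewrite mem_iota => /andP[nk _]; rewrite /q -powR_exprn ?(ltW r1_gt0)//.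
  exact: hpow.
apply: (le_lt_trans (geometric_tail _ _ _)); first by rewrite q0.
rewrite ltr_pdivrMr ?mul1r; last by lra.
apply: le_lt_trans hn1; rewrite ler_wiXn2l ?(ltW q0) ?(ltW q1)//.
by near: n; exact: nbhs_infty_ge.
Unshelve. all: by end_near. Qed.

Lemma stop_sum_le d : 0 < d < 1 ->
  (forall n, (0 < n)%N -> r0 ^+ n <= d -> \sum_(S <- els (level n)) Phi S <= 1) ->
  \sum_(S <- els (stop d)) Phi S <= 1 - ln d * (- ln r1)^-1.
Proof.
move=> /andP[d0 d1] h; have [r0_gt0 r01 r1_lt1 _ _] := hm.
have r1_gt0 : 0 < r1 by exact: lt_le_trans r01.
have [||M /andP[hM1 hM2]] := @exprn_between R r1 d; [by rewrite r1_gt0|by rewrite d0 ltW|].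
pose ks := [seq n <- iota 1 M.+1 | r0 ^+ n <= d].
apply: (@le_trans _ _ (\sum_(n <- ks) \sum_(S <- els (level n)) Phi S)).
  apply: ler_sum_cover => //; first exact: uniq_els.
  move=> S /elsP -/(_ (finite_stop hW hm d0)) /(stop_words hW hm)[n [n0 Sn h1 h2]].
  apply/hasP; exists n; last by apply/elsP => //; exact: finite_level.
  rewrite mem_filter h1 mem_iota n0 /= add1n ltnS.
  have := lt_trans hM1 h2; rewrite ltr_iXn2l//.
  by case: (n) n0.
apply: (@le_trans _ _ (\sum_(n <- ks) 1)).
  rewrite big_seq [leRHS]big_seq; apply: ler_sum => n.
  rewrite mem_filter mem_iota => /and3P[h1 n0 _]; exact: h.
rewrite sum_const_seq mulr1; apply: (@le_trans _ _ M.+1%:R).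
  by rewrite ler_nat size_filter (leq_trans (count_size _ _))// size_iota.
rewrite -natr1 addrC lerD2l.
have lr : 0 < - ln r1 by apply: Nln_gt0; rewrite r1_gt0.
rewrite -mulNr ler_pdivlMr// mulrN lerN2 mulr_natl -lnXn//.
by rewrite ler_ln ?posrE ?exprn_gt0.
Qed.

End Levels.

(** * Power sums as functions of the exponent *)

Section PowerSums.
Variables (R : realType) (T : eqType) (l : seq T) (a b : T -> R) (q : R).
Hypothesis q1 : q < 1.
Hypothesis a_gt0 : forall x, x \in l -> 0 < a x.
Hypothesis b_gt0 : forall x, x \in l -> 0 < b x <= q.

Definition power_sum t := \sum_(x <- l) a x * b x `^ t.

Lemma power_sum_ge0 t : 0 <= power_sum t.
Proof.
rewrite /power_sum big_seq sumr_ge0// => x /a_gt0/ltW a0.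
by rewrite mulr_ge0// powR_ge0.
Qed.

(** This one estimate yields strict decrease, hence uniqueness of the root, and the end points for
    the intermediate value theorem. *)
Lemma power_sumD t h : 0 <= h -> power_sum (t + h) <= q `^ h * power_sum t.
Proof.
move=> h0; rewrite /power_sum mulr_sumr big_seq [leRHS]big_seq; apply: ler_sum => x xl.
have /andP[b0 bq] := b_gt0 xl; rewrite powRDn0// mulrA [leRHS]mulrC.
rewrite ler_wpM2l ?mulr_ge0 ?powR_ge0 ?(ltW (a_gt0 xl))//.
by apply: ge0_ler_powR => //; rewrite nnegrE ltW// (lt_le_trans b0).
Qed.

Hypothesis l_neq0 : l != [::].

Let q0 : 0 < q.
Proof.
case: l l_neq0 b_gt0 => // x r _ /(_ x (mem_head _ _))/andP[h1 h2].
exact: lt_le_trans h2.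
Qed.

Lemma power_sum_gt0 t : 0 < power_sum t.
Proof.
rewrite /power_sum; case: l l_neq0 a_gt0 b_gt0 => // x r _ ha hb; rewrite big_cons.
have /andP[b0 _] := hb x (mem_head _ _).
rewrite ltr_pwDl// ?mulr_gt0 ?powR_gt0 ?ha ?mem_head//.
rewrite big_seq sumr_ge0// => y yr.
by rewrite mulr_ge0 ?powR_ge0// ltW// ha// inE yr orbT.
Qed.

Lemma power_sum_lt t t' : t < t' -> power_sum t' < power_sum t.
Proof.
move=> tt'; have := @power_sumD t (t' - t); rewrite [t + _]addrC subrK => h.
apply: (le_lt_trans (h _)); first by lra.
rewrite gtr_pMl ?power_sum_gt0// powR_lt_ln// ln1 pmulr_rlt0 ?subr_gt0//.
by rewrite ln_lt0// q0.
Qed.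

Lemma power_sum_le t t' : t <= t' -> power_sum t' <= power_sum t.
Proof. by rewrite le_eqVlt => /predU1P[->//|/power_sum_lt/ltW]. Qed.

Lemma continuous_power_sum : continuous power_sum.
Proof.
rewrite /power_sum; have : {subset l <= l} by [].
elim: {1 3}l => [|x r IH] rl.
  under eq_fun do rewrite big_nil.
  exact: cst_continuous.
under eq_fun do rewrite big_cons.
move=> t; apply: (@continuousD _ _ _ (fun t => a x * b x `^ t)
  (fun t => \sum_(y <- r) a y * b y `^ t)); last first.
  by apply: IH => y yr; apply: rl; rewrite inE yr orbT.
have /andP[b0 _] := b_gt0 (rl x (mem_head _ _)).
apply: continuousM; first exact: cst_continuous.
have -> : powR (b x) = fun t => expR (t * ln (b x)).
  by apply/funext => u; rewrite /powR gt_eqF.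
apply: continuous_comp; last exact: continuous_expR.
by apply: continuousM; [exact: id|exact: cst_continuous].
Qed.

Lemma power_sum_root : exists t, unique_root power_sum t.
Proof.
have lq : 0 < - ln q by apply: Nln_gt0; rewrite q0.
have big (c : R) : 0 < c -> exists2 h, 0 <= h & q `^ h <= c.
  move=> c0; exists (`|ln c| / - ln q); first by rewrite divr_ge0// ltW.
  rewrite powR_le_ln// invrN mulrN mulNr divfK; last by rewrite lt_eqF// -oppr_gt0.
  by rewrite lerNl (le_trans (ler_norm _))// normrN.
have P0 := power_sum_gt0 0.
have [|h1 h1_ge0 hh1] := big (power_sum 0)^-1; first by rewrite invr_gt0.
have [h2 h2_ge0 hh2] := big (power_sum 0) P0.
have p1 : power_sum h1 <= 1.
  rewrite -[h1]add0r; apply: (le_trans (power_sumD 0 h1_ge0)).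
  by rewrite -ler_pdivlMr// div1r.
have p2 : 1 <= power_sum (- h2).
  have := power_sumD (- h2) h2_ge0; rewrite addNr => h.
  have := le_trans h (ler_wpM2r (power_sum_ge0 (- h2)) hh2).
  by rewrite -ler_pdivrMl// mulVf// gt_eqF.
have [|||t _ ht] := @IVT R power_sum (- h2) h1 1.
- by rewrite (le_trans _ h1_ge0)// oppr_le0.
- exact/continuous_subspaceT/continuous_power_sum.
- by rewrite ge_min p1 orbT le_max p2.
exists t; split=> // t' ht'; case: (ltgtP t t') => // /power_sum_lt.
  by rewrite ht ht' ltxx.
by rewrite ht ht' ltxx.
Qed.

Lemma root_lt t u : power_sum t = 1 -> power_sum u < 1 -> t < u.
Proof. by move=> ht hu; rewrite ltNge; apply/negP => /power_sum_le; rewrite ht leNgt hu. Qed.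

Lemma root_gt t u : power_sum t = 1 -> 1 < power_sum u -> u < t.
Proof. by move=> ht hu; rewrite ltNge; apply/negP => /power_sum_le; rewrite ht leNgt hu. Qed.

End PowerSums.

Section SimilarityDimension.
Variables (R : realType) (K : set R).
Hypothesis Kn0 : K !=set0.
Hypothesis K01 : K `<=` `[0, 1].

Local Notation N := (covering_number (@dist1 R) K).

(* [N d <= \sum_f N (d / `|f.1|)] yields [N d <= C * d `^ (- t)] by induction on the
   scale. *)
Lemma exponent_le_similarity (A : seq (aff R)) (rho q s t : R) :
  has_exponent N s -> 0 < rho -> q < 1 ->
  (forall f, f \in A -> rho <= `|f.1| <= q) ->
  (forall x, K x -> exists2 f, f \in A & (aff_fun f @` K) x) ->
  0 <= t -> \sum_(f <- A) `|f.1| `^ t <= 1 -> s <= t.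
Proof.
move=> hN rho0 q1 hA hK t0 hsum.
have q0 : 0 < q.
  have [x Kx] := Kn0; have [f /hA/andP[h1 h2] _] := hK x Kx.
  exact: lt_le_trans (lt_le_trans rho0 h1) h2.
(* For d < 1 the scale d / |f.1| may pass 1 but not rho^(-1); [C] settles the range in between,
   where one ball suffices. *)
pose C := rho^-1 `^ t; have C0 : 0 < C by rewrite powR_gt0// invr_gt0.
have base d : 1 <= d <= rho^-1 -> N d <= C * d `^ (- t).
  move=> /andP[d1 d2]; apply: (le_trans (unit_N_le1 K01 d1)).
  have d0 : 0 < d by lra.
  rewrite powRN ler_pdivlMr ?powR_gt0// mul1r.
  by apply: ge0_ler_powR => //; rewrite nnegrE ?invr_ge0 ltW.
have main k d : 0 < d -> q ^+ k <= d <= rho^-1 -> N d <= C * d `^ (- t).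
  elim: k d => [|k IH] d d0 /andP[hk hd].
    by apply: base; rewrite hd -(expr0 q) hk.
  case: (leP 1 d) => d1; first by apply: base; rewrite d1.
  apply: (@le_trans _ _ (\sum_(f <- A) N (d / `|f.1|))).
    apply: (@covering_number_union R R (@dist1 R) _ A (fun f => aff_fun f @` K)) => //.
    move=> f /hA/andP[f1 f2].
    have f0 : f.1 != 0 by rewrite -normr_gt0 (lt_le_trans rho0).
    by have [u hu hsz] := aff_N f0 K01 d0; exists u => //; rewrite hsz.
  apply: (@le_trans _ _ (\sum_(f <- A) C * d `^ (- t) * `|f.1| `^ t)); last first.
    by rewrite -mulr_sumr ler_piMr// mulr_ge0 ?powR_ge0.
  rewrite big_seq [leRHS]big_seq; apply: ler_sum => f /hA/andP[f1 f2].
  have f0 : 0 < `|f.1| by exact: lt_le_trans f1.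
  have -> : C * d `^ (- t) * `|f.1| `^ t = C * (d / `|f.1|) `^ (- t).
    rewrite powRM ?invr_ge0 ?(ltW d0)// -mulrA; congr (_ * (_ * _)).
    by rewrite -powR_inv1 ?ltW// -powRrM mulN1r opprK.
  apply: IH; first by rewrite divr_gt0.
  rewrite ler_pdivlMr// ler_pdivrMr//; apply/andP; split.
    by apply: le_trans hk; rewrite exprSr ler_wpM2l// exprn_ge0// ltW.
  by apply: (le_trans (ltW d1)); rewrite -ler_pdivrMl ?invr_gt0// invrK mulr1.
rewrite leNgt; apply/negP => ts.
pose e := (s - t) / 2; have e0 : 0 < e by rewrite divr_gt0// subr_gt0.
near (0:R)^'+ => d; have d01 : 0 < d < 1 by near: d; exact: near_in01.
case/andP: (d01) => d0 d1.
have /andP[h1 _] : d `^ (- (s - e)) <= N d <= d `^ (- (s + e)) by near: d; exact: hN.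
have [|k hk] := @exprn_small R q d _ d0; first by rewrite q1 ltW.
have h2 : N d <= C * d `^ (- t).
  apply: (main k) => //; rewrite (ltW hk)/=.
  apply: (le_trans (ltW d1)); rewrite invf_ge1//.
  have [x Kx] := Kn0; have [f /hA/andP[h3 h4] _] := hK x Kx.
  by rewrite (le_trans h3)// (le_trans h4)// ltW.
have h3 : C + 1 <= d `^ (- e) by near: d; exact: near_const_le_powRN.
have := le_trans h1 h2.
have -> : - (s - e) = - e + - t by rewrite /e; lra.
rewrite powRDn0// ler_pM2r ?powR_gt0//; lra.
Unshelve. all: by end_near. Qed.

End SimilarityDimension.

Section SelfSimilarLevels.
Variables (R : realType) (F : {fset aff R}) (K : set R).
Variables (V : nat -> set (seq (aff R))) (r0 r1 : R).
Hypothesis hV : reduced_words (@aff_word R) F V.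
Hypothesis r0_gt0 : 0 < r0.
Hypothesis r01 : r0 <= r1.
Hypothesis r1_lt1 : r1 < 1.
Hypothesis hF : forall f, f \in F -> r0 <= `|f.1| <= r1.
Hypothesis Kn0 : K !=set0.
Hypothesis K01 : K `<=` `[0, 1].
Hypothesis hK : K = \bigcup_(f in [set` F]) (aff_fun f @` K).

Local Notation N := (covering_number (@dist1 R) K).
Let hm := aratio_bounds r0_gt0 r01 r1_lt1 hF.

(** A family stopped at scale [d] has at most d^(-s - eta / 2) maps, all of ratio at most [d], so
    its sum is at most d^(eta / 2); summation over scales passes to the levels. *)
Lemma similarity_sum_small s eta : 0 <= s -> has_exponent N s -> 0 < eta ->
  (forall e, 0 < e -> \forall d \near 0^'+,
     neighbours (@dist1 R) (@aff_fun R) K (astop V) d <= d `^ (- e)) ->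
  \forall n \near \oo,
    \sum_(f <- els (@aff_word R @` words F n)) `|f.1| `^ (s + eta) < 1.
Proof.
move=> s0 hN eta0 hg; pose e := eta / 4; have e0 : 0 < e by rewrite divr_gt0.
apply: (level_sum_small hV hm (Phi := fun f => `|f.1| `^ (s + eta)) _ (e := eta / 2)).
- by move=> f; exact: powR_ge0.
- by rewrite divr_gt0.
near=> d; have d01 : 0 < d < 1 by near: d; exact: near_in01.
case/andP: (d01) => d0 d1.
have h1 : neighbours (@dist1 R) (@aff_fun R) K (astop V) d <= d `^ (- e).
  by near: d; exact: hg.
have /andP[_ h2] : d `^ (- (s - e)) <= N d <= d `^ (- (s + e)) by near: d; exact: hN.
have N0 : 0 <= N d by rewrite (le_trans _ (unit_N_ge1 K01 Kn0 d0)).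
apply: (@le_trans _ _ (\sum_(f <- els (astop V d)) d `^ (s + eta))).
  rewrite big_seq [leRHS]big_seq; apply: ler_sum => f.
  move=> /elsP -/(_ (finite_stop hV hm d0))/(astop_ratio hV r0_gt0 r01 r1_lt1 hF)/andP[_ fd].
  by apply: ge0_ler_powR => //; rewrite ?nnegrE// ?(ltW d0)// addr_ge0// ltW.
rewrite sum_const_seq.
have h3 := card_astop_le hV r0_gt0 r01 r1_lt1 hF Kn0 K01 hK d01.
apply: (@le_trans _ _ (d `^ (- e) * d `^ (- (s + e)) * d `^ (s + eta))).
  rewrite ler_wpM2r ?powR_ge0// (le_trans h3)//.
  apply: (le_trans (ler_wpM2r N0 h1)); rewrite ler_wpM2l ?powR_ge0//.
rewrite -!powRDn0//.
by have -> : - e + - (s + e) + (s + eta) = eta / 2 by rewrite /e; lra.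
Unshelve. all: by end_near. Qed.

End SelfSimilarLevels.

(** * Carpets *)

Section Plane.
Variable R : realType.
Implicit Types (x y : R * R) (S T : cmap R) (l : bool) (d : R) (w : seq (cmap R)).

Definition mkpair l (u v : R) : R * R := if l then (v, u) else (u, v).

Lemma pcoord_mkpair l u v : pcoord l (mkpair l u v) = u /\ pcoord (~~ l) (mkpair l u v) = v.
Proof. by case: l. Qed.

Lemma dist2_ge x y l : dist1 (pcoord l x) (pcoord l y) <= dist2 x y.
Proof.
rewrite /dist2 dist1E -sqrtr_sqr ler_wsqrtr//.
by case: l; rewrite /= ?lerDl ?lerDr sqr_ge0.
Qed.

Lemma dist2_le x y l :
  dist2 x y <= dist1 (pcoord l x) (pcoord l y) + dist1 (pcoord (~~ l) x) (pcoord (~~ l) y).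
Proof.
rewrite /dist2 !dist1E; have h (u v : R) : Num.sqrt (u ^+ 2 + v ^+ 2) <= `|u| + `|v|.
  rewrite -[leRHS]ger0_norm ?addr_ge0// -sqrtr_sqr ler_wsqrtr// sqrrD.
  by rewrite !real_normK ?num_real// addrAC lerDl mulrn_wge0// mulr_ge0.
by case: l => /=; first rewrite [leRHS]addrC; exact: h.
Qed.

Lemma pcoord_cmap l S x : pcoord l (cmap_fun S x) = aff_fun (pcoord l S) (pcoord l x).
Proof. by case: l. Qed.

Lemma contr_comp l S T : contr l (cmap_comp S T) = contr l S * contr l T.
Proof. by rewrite /contr -normrM; case: l. Qed.

Lemma contr_id l : contr l (@cmap_id R) = 1.
Proof. by rewrite /contr; case: l; rewrite /= normr1. Qed.

Lemma contr_word l w : contr l (cmap_word w) = word_ratio l w.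
Proof.
rewrite /word_ratio; elim: w => [|S w IH]; first by rewrite big_nil contr_id.
by rewrite big_cons -IH -contr_comp.
Qed.

Lemma pcoord_word l w : pcoord l (cmap_word w) = aff_word (map (pcoord l) w).
Proof. by case: l; elim: w => //= S w ->. Qed.

Lemma dist2_cmap_ge S x y (rho : R) : 0 <= rho -> (forall l, rho <= contr l S) ->
  rho * dist2 x y <= dist2 (cmap_fun S x) (cmap_fun S y).
Proof.
move=> rho0 hS; rewrite -[rho](ger0_norm rho0) -sqrtr_sqr /dist2 -sqrtrM ?sqr_ge0//.
have h l : rho ^+ 2 * (pcoord l x - pcoord l y) ^+ 2 <=
    (pcoord l (cmap_fun S x) - pcoord l (cmap_fun S y)) ^+ 2.
  rewrite !pcoord_cmap -exprMn -[leLHS]real_normK ?num_real// -[leRHS]real_normK ?num_real//.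
  rewrite lerXn2r ?nnegrE// -[leRHS]dist1E aff_dist normrM.
  by rewrite ger0_norm// ler_wpM2r// hS.
by rewrite ler_wsqrtr// mulrDr lerD// (h false, h true).
Qed.

Lemma cmap_surj S y : (forall l, contr l S != 0) -> exists x, cmap_fun S x = y.
Proof.
move=> hS; exists ((y.1 - S.1.2) / S.1.1, (y.2 - S.2.2) / S.2.1).
have := hS false; have := hS true; rewrite /contr /= !normr_eq0 => h1 h2.
rewrite /cmap_fun /aff_fun /= !(mulrCA _ (_ - _)) !divff// !mulr1 !subrK.
by case: y.
Qed.

End Plane.

Lemma size_flatten_le (R : realType) (T I : eqType) (t : I -> seq T) (ks : seq I) (B : R) :
  (forall k, k \in ks -> (size (t k))%:R <= B) ->
  (size (flatten (map t ks)))%:R <= (size ks)%:R * B.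
Proof.
elim: ks => [|k ks IH] h /=; first by rewrite mul0r.
rewrite size_cat natrD -natr1 mulrDl mul1r addrC lerD ?h ?mem_head//.
by apply: IH => k' k'ks; apply: h; rewrite inE k'ks orbT.
Qed.

Lemma near_scale (R : realType) (r : R) (P : R -> Prop) : 0 < r ->
  (\forall d \near 0^'+, P d) -> \forall d \near 0^'+, P (r * d).
Proof.
move=> r_gt0 /near_right0[e e0 h]; apply/near_right0; exists (e / r).
  by rewrite divr_gt0.
move=> d /andP[d0 de]; apply: h; rewrite mulr_gt0//=.
by rewrite mulrC -ltr_pdivlMr.
Qed.

Lemma box_dim_exponent (R : realType) (X : choiceType) (dist : X -> X -> R) (A : set X) a :
  (forall d, 0 < d -> 1 <= covering_number dist A d) ->
  has_exponent (covering_number dist A) a ->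
  box_dim_exists dist A /\ box_dim dist A = a.
Proof.
move=> h1 ha; have c : box_ratio dist A d @[d --> 0^'+] --> a.
  apply/ln_ratio_cvgP => //; near=> d.
  by apply: lt_le_trans (h1 d _).
by split; [apply/cvg_ex; exists a|exact/cvg_lim].
Unshelve. all: by end_near. Qed.

Lemma subpolynomial_neighbours (R : realType) (F : R -> R) :
  (\forall d \near 0^'+, 1 <= F d) ->
  ln (F d) / - ln d @[d --> 0^'+] --> (0 : R) ->
  forall e, 0 < e -> \forall d \near 0^'+, F d <= d `^ (- e).
Proof.
move=> F1 /ln_ratio_cvgP h e e0; have {}h := h _ e e0.
near=> d; have : d `^ (- (0 - e)) <= F d <= d `^ (- (0 + e)).
  near: d; apply: h; near=> d'; apply: (@lt_le_trans _ _ 1) => //.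
  by near: d'.
by rewrite !add0r => /andP[].
Unshelve. all: by end_near. Qed.

(* This includes [p = 0], where [p^-1 = 0] makes the power mean equal to 1. *)
Lemma power_mean_term (R : realType) (T : choiceType) p (x : T -> R) (A : set T) d : 0 < d < 1 ->
  finite_set A -> A !=set0 -> (forall U, A U -> 0 < x U) ->
  ln (ncard R A) / - ln d + p * (1 + ln (power_mean p x A) / - ln d) =
  ln (\sum_(U <- els A) (x U / d) `^ p) / - ln d.
Proof.
move=> d01 Af [U0 AU0] x0; have ld := Nln_gt0 d01; case/andP: d01 => d0 d1.
have n0 : 0 < ncard R A.
  rewrite ncard_els ltr0n; have : U0 \in els A by apply/elsP.
  by case: (els A).
have S0 : 0 < \sum_(U <- els A) x U `^ p.
  have : U0 \in els A by apply/elsP.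
  have : forall U, U \in els A -> 0 < x U by move=> U /elsP -/(_ Af)/x0.
  case: (els A) => // U r h _; rewrite big_cons ltr_pwDl ?powR_gt0 ?h ?mem_head//.
  by rewrite sumr_ge0// => ? _; exact: powR_ge0.
have -> : \sum_(U <- els A) (x U / d) `^ p = (\sum_(U <- els A) x U `^ p) * d `^ (- p).
  rewrite mulr_suml big_seq [RHS]big_seq; apply: eq_bigr => U /elsP -/(_ Af)/x0 xU.
  by rewrite powRM ?invr_ge0 ?(ltW xU) ?(ltW d0)// powRV// ltW.
rewrite lnM ?posrE ?powR_gt0// ln_powR /power_mean fsbig_els// ln_powR.
have [->|p0] := eqVneq p 0.
  rewrite invr0 !mul0r oppr0 mul0r !addr0; congr (ln _ / _).
  under eq_bigr do rewrite powRr0.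
  by rewrite sum_const_seq mulr1 ncard_els.
rewrite lnM ?posrE ?invr_gt0// lnV ?posrE//.
by field; rewrite p0 -oppr_eq0 gt_eqF.
Qed.

Section Carpet.
Variables (R : realType) (G : {fset cmap R}) (L : set (R * R)).
Variables (W : nat -> set (seq (cmap R))) (V : bool -> nat -> set (seq (aff R))) (r0 r1 : R).
Hypothesis hW : reduced_words (@cmap_word R) G W.
Hypothesis hV : forall l, reduced_words (@aff_word R) (proj_ifs l G) (V l).
Hypothesis r0_gt0 : 0 < r0.
Hypothesis r01 : r0 <= r1.
Hypothesis r1_lt1 : r1 < 1.
Hypothesis hG : forall S, S \in G -> forall l, r0 <= contr l S <= r1.
Hypothesis Ln0 : L !=set0.
Hypothesis hL : L = \bigcup_(S in [set` G]) (cmap_fun S @` L).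
Hypothesis L01 : forall l, pcoord l @` L `<=` `[0, 1].
Implicit Types (S T : cmap R) (l : bool) (d e : R) (w : seq (cmap R)).

Local Notation N := (covering_number (@dist2 R) L).
Local Notation K l := (pcoord l @` L).
Local Notation NK l := (covering_number (@dist1 R) (K l)).

Let r1_gt0 : 0 < r1. Proof. exact: lt_le_trans r01. Qed.

Let r0_lt1 : r0 < 1. Proof. exact: le_lt_trans r1_lt1. Qed.

Let lr0 : 0 < - ln r0. Proof. by apply: Nln_gt0; rewrite r0_gt0. Qed.

Let lr1 : 0 < - ln r1. Proof. by apply: Nln_gt0; rewrite r1_gt0. Qed.

Let kappa := ln r1 / ln r0.

Let kappa_gt0 : 0 < kappa.
Proof. by rewrite /kappa -[ln r1]opprK -[ln r0]opprK invrN mulrNN divr_gt0. Qed.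

Lemma proj_nonempty l : K l !=set0.
Proof. by case: Ln0 => x Lx; exists (pcoord l x), x. Qed.

Lemma word_ratio_rcons l w S : word_ratio l (rcons w S) = word_ratio l w * contr l S.
Proof. by rewrite /word_ratio -cats1 big_cat big_seq1. Qed.

Lemma word_ratio_ge0 l w : 0 <= word_ratio l w.
Proof. by rewrite -contr_word; exact: normr_ge0. Qed.

Lemma min_ratio_bounds : ratio_bounds G (@min_ratio R) r0 r1.
Proof.
split=> // [|w S Gw]; first by rewrite /min_ratio /word_ratio !big_nil minxx.
have /hG hS : S \in G by apply: Gw; rewrite mem_rcons mem_head.
have /andP[h1 h2] := hS false; have /andP[h3 h4] := hS true.
rewrite /min_ratio !word_ratio_rcons.
have := word_ratio_ge0 false w; have := word_ratio_ge0 true w.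
move: (word_ratio _ _) (word_ratio _ _) => u v u0 v0.
rewrite !minr_pMr ?(ltW r0_gt0) ?(ltW r1_gt0)// !le_min !ge_min.
rewrite [r0 * v]mulrC [r0 * u]mulrC [r1 * v]mulrC [r1 * u]mulrC.
by rewrite !ler_wpM2l// !orbT.
Qed.

Lemma finite_stopped d : 0 < d -> finite_set (stopped W d).
Proof. exact: (finite_stop hW min_ratio_bounds). Qed.

Lemma cmap_image_sub w : {subset w <= G} -> cmap_fun (cmap_word w) @` L `<=` L.
Proof.
move=> Gw; apply: (@app_ev_sub _ _ (@cmap_comp R) (@cmap_id R) (@cmap_fun R)) hL _ Gw.
  exact: cmap_compE.
by move=> [x y]; rewrite /cmap_fun /aff_fun /= !mul1r !addr0.
Qed.

Lemma stopped_cover d x : 0 < d < 1 -> L x ->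
  exists2 S, stopped W d S & (cmap_fun S @` L) x.
Proof.
apply: (@stop_cover R _ _ (@cmap_comp R) (@cmap_id R) (@cmap_fun R) _ _ G L hL W
  (@min_ratio R) r0 r1) => //.
- exact: cmap_compE.
- by move=> [u v]; rewrite /cmap_fun /aff_fun /= !mul1r !addr0.
- exact: min_ratio_bounds.
Qed.

(* The coordinate of the larger ratio; as in [Delta_], ties go to the second one. *)
Definition long S : bool := contr false S <= contr true S.

Lemma contr_min S : Num.min (contr false S) (contr true S) = contr (~~ long S) S.
Proof. by rewrite /long; case: (leP (contr false S) (contr true S)). Qed.

Lemma contr_short S l : contr (~~ long S) S <= contr l S.
Proof. by rewrite /long; case: (leP (contr false S) (contr true S)); case: l => //= /ltW. Qed.

Lemma stopped_word d S : stopped W d S -> exists w, [/\ S = cmap_word w,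
  {subset w <= G}, (0 < size w)%N & cutset W (@min_ratio R) d w].
Proof.
move=> [w hw <-]; exists w.
by have [h1 _ h2 _ _] := cut_size hW min_ratio_bounds hw.
Qed.

Lemma contr_word_bounds l w : {subset w <= G} ->
  r0 ^+ size w <= contr l (cmap_word w) <= r1 ^+ size w.
Proof.
rewrite contr_word; elim: w => [|S w IH] Gw; first by rewrite /word_ratio big_nil !expr0 lexx.
have /IH/andP[h1 h2] : {subset w <= G}.
  by move=> T Tw; apply: Gw; rewrite inE Tw orbT.
have /andP[h3 h4] := hG (Gw S (mem_head _ _)) l.
rewrite /word_ratio big_cons !exprS; apply/andP; split.
  by rewrite ler_pM ?exprn_ge0 ?(ltW r0_gt0).
by apply: ler_pM => //; [exact: normr_ge0|exact: (word_ratio_ge0 l w)].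
Qed.

Lemma contr_word_gt0 l w : {subset w <= G} -> 0 < contr l (cmap_word w).
Proof. by move=> /(contr_word_bounds l)/andP[h _]; apply: lt_le_trans h; exact: exprn_gt0. Qed.

Lemma stopped_gt0 d S l : stopped W d S -> 0 < contr l S.
Proof. by move=> /stopped_word[w [-> Gw _ _]]; exact: contr_word_gt0. Qed.

Lemma stopped_le_r1 d S l : stopped W d S -> contr l S <= r1.
Proof.
move=> /stopped_word[w [-> Gw w0 _]]; have /andP[_ h] := contr_word_bounds l Gw.
apply: (le_trans h); case: (size w) w0 => // n _.
by rewrite exprS ler_piMr ?(ltW r1_gt0)// exprn_ile1 ?(ltW r1_gt0) ?(ltW r1_lt1).
Qed.

Lemma stopped_short d S : stopped W d S -> r0 * d < contr (~~ long S) S <= d.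
Proof.
move=> /stopped_word[w [-> Gw _ /(cut_ratio hW min_ratio_bounds)]].
by rewrite /min_ratio -!contr_word contr_min.
Qed.

Lemma stopped_gt d S l : stopped W d S -> r0 * d < contr l S.
Proof. by move=> /stopped_short/andP[h _]; apply: lt_le_trans (contr_short _ _). Qed.

(* Each letter has ratios in [r0, r1], and [r1 = r0 `^ kappa]. *)
Lemma contr_word_le_powR l l' w : {subset w <= G} ->
  contr l (cmap_word w) <= contr l' (cmap_word w) `^ kappa.
Proof.
move=> Gw; have /andP[_ h1] := contr_word_bounds l Gw.
have /andP[h2 _] := contr_word_bounds l' Gw.
apply: (le_trans h1); apply: (@le_trans _ _ ((r0 ^+ size w) `^ kappa)).
  rewrite powR_exprn ?(ltW r0_gt0)// lerXn2r ?nnegrE ?powR_ge0 ?(ltW r1_gt0)//.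
  by rewrite ln_le_powR// divfK// -oppr_eq0 gt_eqF.
apply: ge0_ler_powR; rewrite ?nnegrE ?(ltW kappa_gt0) ?exprn_ge0 ?(ltW r0_gt0)//.
by rewrite (le_trans _ h2)// exprn_ge0// ltW.
Qed.

Lemma stopped_le_powR d S l : 0 < d -> stopped W d S -> contr l S <= d `^ kappa.
Proof.
move=> d0 hS; have /andP[_ hd] := stopped_short hS.
have := hS => /stopped_word[w [Sw Gw _ _]].
have := contr_word_le_powR l (~~ long S) Gw; rewrite -Sw => /le_trans; apply.
by apply: ge0_ler_powR; rewrite ?nnegrE ?(ltW kappa_gt0) ?(ltW d0) ?(ltW (stopped_gt0 _ hS)).
Qed.

Lemma plane_covers d : 0 < d -> exists2 s, covers (@dist2 R) L d s &
  (size s)%:R <= NK false (d / 2) * NK true (d / 2).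
Proof.
move=> d0; have d2 : 0 < d / 2 by rewrite divr_gt0.
have [s0 hs0] := unit_subset_covers (L01 (l := false)) d2.
have [s hs ->] := covering_number_attained hs0.
have [t0 ht0] := unit_subset_covers (L01 (l := true)) d2.
have [t ht ->] := covering_number_attained ht0.
exists [seq (u, v) | u <- s, v <- t]; last by rewrite size_allpairs natrM.
move=> x Lx; have [|u /= us ux] := hs (pcoord false x); first by exists x.
have [|v /= vt vx] := ht (pcoord true x); first by exists x.
exists (u, v); first by apply/allpairsP; exists (u, v).
apply: (le_trans (dist2_le _ _ false)); move: ux vx; rewrite /cball /= => ux vx.
by rewrite (splitr d) lerD.
Qed.

Lemma N_mono d d' : 0 < d -> d <= d' -> N d' <= N d.
Proof. by move=> /plane_covers[s hs _] dd'; exact: covering_number_mono hs _ dd'. Qed.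

Lemma N_ge1 d : 0 < d -> 1 <= N d.
Proof. by move=> /plane_covers[s hs _]; exact: covering_number_ge1 hs Ln0. Qed.

Lemma N_le_prod d : 0 < d -> N d <= NK false (d / 2) * NK true (d / 2).
Proof. by move=> /plane_covers[s hs]; apply: le_trans; exact: covering_number_le. Qed.

Lemma N_poly : \forall d \near (0 : R)^'+, N d <= d `^ (- 3).
Proof.
near=> d; have d01 : 0 < d < 1 by near: d; exact: near_in01.
(* The two linear bounds multiply to 9 d^(-2), and d < 1 / 9 turns the constant into one more
   power. *)
have d9 : d < 1 / 9 by near: d; apply: nbhs_right_lt.
case/andP: (d01) => d0 d1; have d2 : 0 < d / 2 by rewrite divr_gt0.
apply: (le_trans (N_le_prod d0)).
have h l : 0 <= NK l (d / 2) <= 3 * d^-1.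
  have := unit_N_ge1 (L01 (l := l)) (proj_nonempty l) d2.
  have := unit_N_le (L01 (l := l)) d2; rewrite invf_div => h1 h2.
  rewrite (le_trans _ h2)//= (le_trans h1)//.
  have : 1 <= d^-1 by rewrite invf_ge1// ltW.
  by lra.
have /andP[a1 a2] := h false; have /andP[b1 b2] := h true.
apply: (le_trans (ler_pM a1 b1 a2 b2)).
rewrite (powR_invn 3 (ltW d0)) -[leRHS]mul1r ler_pdivlMr ?exprn_gt0//.
have -> : 3 / d * (3 / d) * d ^+ 3 = 9 * d by field; rewrite gt_eqF.
lra.
Unshelve. all: by end_near. Qed.

Lemma N_le_sum d : 0 < d < 1 ->
  N d <= \sum_(S <- els (stopped W d)) NK (long S) (d / (2 * contr (long S) S)).
Proof.
move=> d01; have /andP[d0 d1] := d01.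
apply: (@covering_number_union R _ (@dist2 R) _ _ (fun S => cmap_fun S @` L)).
  move=> x /(stopped_cover d01)[S hS Sx]; exists S => //.
  by apply/elsP => //; exact: finite_stopped.
move=> S /elsP -/(_ (finite_stopped d0)) hS; set l := long S.
have rl0 : 0 < contr l S := stopped_gt0 l hS.
have d2 : 0 < d / 2 by rewrite divr_gt0.
have f0 : (pcoord l S).1 != 0 by rewrite -normr_gt0.
have [u hu hsz] := aff_N f0 (L01 (l := l)) d2.
(* The centres lie on the middle line of the strip: the short side costs at most d / 2, and the
   other d / 2 is the radius along the long side. *)
exists (map (fun c => mkpair l c (aff_fun (pcoord (~~ l) S) (1 / 2))) u); last first.
  by rewrite size_map hsz invfM mulrA.
move=> _ [x Lx <-]; have [|c /= cu hc] := hu (pcoord l (cmap_fun S x)).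
  by rewrite pcoord_cmap; exists (pcoord l x) => //; exists x.
exists (mkpair l c (aff_fun (pcoord (~~ l) S) (1 / 2))); first exact: map_f.
apply: (le_trans (dist2_le _ _ l)).
have [-> ->] := pcoord_mkpair l c (aff_fun (pcoord (~~ l) S) (1 / 2)).
rewrite (splitr d) lerD// pcoord_cmap aff_dist.
have : K (~~ l) (pcoord (~~ l) x) by exists x.
move=> /L01; rewrite /= in_itv/= => /andP[x0 x1].
have hx : dist1 (1 / 2) (pcoord (~~ l) x) <= 1 / 2 by rewrite dist1E ler_norml; lra.
have /andP[_ hd] := stopped_short hS.
by have := ler_pM (normr_ge0 _) (normr_ge0 _) hd hx; rewrite mul1r.
Qed.

(** * Iterated maps of one scale *)

Section Products.
Variables (A : seq (cmap R)) (d : R) (M : nat).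
Hypothesis d01 : 0 < d < 1.
Hypothesis hA : forall S, S \in A -> cmap_fun S @` L `<=` L /\
  (forall l, r0 * d <= contr l S).
Hypothesis hM : forall x,
  (count (fun S => `[< (cmap_fun S @` L) `&` cball (@dist2 R) x d !=set0 >]) A <= M)%N.

Let eta := r0 * d.

(** A list with repetition: coinciding products are kept apart, so that [sum_products] is an exact
    power. *)
Fixpoint products n : seq (cmap R) :=
  if n is n'.+1 then [seq cmap_comp U T | U <- A, T <- products n'] else [:: cmap_id R].

Let eta_gt0 : 0 < eta. Proof. by rewrite mulr_gt0//; case/andP: d01. Qed.

Let eta_le1 : eta <= 1.
Proof.
case/andP: d01 => d0 d1; rewrite mulr_ile1 ?(ltW r0_gt0) ?(ltW d0) ?(ltW d1)//.
by rewrite (le_trans r01) ?(ltW r1_lt1).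
Qed.

Lemma productsP n T : T \in products n -> cmap_fun T @` L `<=` L /\
  (forall l, eta ^+ n <= contr l T).
Proof.
elim: n T => [|n IH] T /=.
  rewrite inE => /eqP ->; split=> [_ [[u v] Lu <-]|l].
    by rewrite /cmap_fun /aff_fun /= !mul1r !addr0.
  by rewrite contr_id.
case/allpairsP => -[S T'] /= [/hA[SL hS] /IH[TL hT] ->]; split=> [_ [x Lx <-]|l].
  rewrite cmap_compE /=; apply: SL; exists (cmap_fun T' x) => //.
  by apply: TL; exists x.
by rewrite contr_comp exprS ler_pM ?exprn_ge0 ?(ltW eta_gt0).
Qed.

(* Pulling a ball of radius [eta ^ n.+1] back by [S] gives a subset of a ball of
   radius [eta ^ n], because both ratios of [S] are at least [eta]. *)
Lemma count_products n x :
  (count (fun T => `[< (cmap_fun T @` L) `&` cball (@dist2 R) x (eta ^+ n) !=set0 >])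
     (products n) <= M ^ n)%N.
Proof.
elim: n x => [|n IH] x /=; first by rewrite addn0 expn0; case: asboolP.
pose meets r S y := `[< (cmap_fun S @` L) `&` cball (@dist2 R) y r !=set0 >].
rewrite -sum1_count big_mkcond /= big_allpairs_dep /=.
apply: (@leq_trans (\sum_(S <- A) meets d S x * M ^ n)%N); last first.
  rewrite -big_distrl /= expnS leq_mul2r; apply/orP; right.
  by apply: leq_trans (hM x); rewrite -sum1_count [leqRHS]big_mkcond.
rewrite big_seq [leqRHS]big_seq; apply: leq_sum => S SA.
have [SL hS] := hA SA; rewrite -big_mkcond /= sum1_count.
have [y yx] : exists y, cmap_fun S y = x.
  by apply: cmap_surj => l; rewrite gt_eqF// (lt_le_trans eta_gt0).
(* If the image of [S] misses the larger ball, no product starting with [S] meets the smaller one;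
   otherwise the ball is pulled back by [S]. *)
have [mS|nmS] := boolP (meets d S x); last first.
  rewrite mul0n leqn0 -leqn0 leqNgt -has_count; apply/negP => /hasP[T Tn].
  move=> /asboolP[_ [[z Lz <-] hz]]; move/asboolP: nmS; apply.
  exists (cmap_fun (cmap_comp S T) z); split.
    rewrite cmap_compE; exists (cmap_fun T z) => //.
    by apply: (productsP Tn).1; exists z.
  apply: (le_trans hz); rewrite exprS; case/andP: d01 => d0 d1.
  rewrite {1}/eta mulrAC ler_piMl ?(ltW d0)//.
  rewrite mulr_ile1 ?exprn_ge0 ?(ltW eta_gt0) ?(ltW r0_gt0) ?exprn_ile1 ?(ltW eta_gt0)//.
  by rewrite (le_trans r01) ?(ltW r1_lt1).
rewrite mul1n; apply: leq_trans (IH y); apply: sub_count => T.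
move=> /asboolP[_ [[z Lz <-] hz]]; apply/asboolP; exists (cmap_fun T z); split.
  by exists z.
rewrite /cball /= -(ler_pM2l eta_gt0) -exprS; apply: le_trans hz.
rewrite -yx cmap_compE /=; apply: dist2_cmap_ge; first exact: ltW.
exact: hS.
Qed.

Lemma sum_products l p n :
  \sum_(T <- products n) (contr l T / eta ^+ n) `^ p =
  (\sum_(S <- A) (contr l S / eta) `^ p) ^+ n.
Proof.
elim: n => [|n IH] /=; first by rewrite big_seq1 contr_id !expr0 divr1 powR1.
rewrite big_allpairs_dep /= [RHS]exprS mulr_suml; apply: eq_bigr => S _.
rewrite -IH mulr_sumr; apply: eq_bigr => T _.
rewrite contr_comp -powRM ?divr_ge0 ?exprn_ge0 ?(ltW eta_gt0)//; try exact: normr_ge0.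
by congr (_ `^ _); rewrite exprS invfM mulrACA.
Qed.

(** A cover of [L] restricts to each image, where its projection to direction [l] already needs
    [NK l] centres; each centre serves at most M^n products. *)
Lemma sum_products_le l n :
  \sum_(T <- products n) NK l (eta ^+ n / contr l T) <= N (eta ^+ n) * (M ^ n)%:R.
Proof.
have en0 : 0 < eta ^+ n by exact: exprn_gt0.
have [s0 hs0 _] := plane_covers en0.
have [s hs ->] := covering_number_attained hs0.
pose meets T c := `[< (cmap_fun T @` L) `&` cball (@dist2 R) c (eta ^+ n) !=set0 >].
have := @double_count _ _ (products n) s meets (fun T => count (meets T) s) (M ^ n).
move=> /(_ (fun x _ => count_products n x) (fun _ _ => leqnn _)).
rewrite -(ler_nat R) natrM [in leRHS]mulrC natr_sum; apply: le_trans.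
rewrite [leLHS]big_seq [leRHS]big_seq; apply: ler_sum => T /productsP[TL hT].
have f0 : (pcoord l T).1 != 0 by rewrite -normr_gt0 (lt_le_trans en0) ?hT.
have hc : covers (@dist1 R) (aff_fun (pcoord l T) @` K l) (eta ^+ n)
    (map (pcoord l) [seq c <- s | meets T c]).
  move=> _ [_ [x Lx <-] <-]; have TxL : L (cmap_fun T x) by apply: TL; exists x.
  have [c /= cs cx] := hs _ TxL; exists (pcoord l c).
    apply/mapP; exists c => //; rewrite mem_filter cs andbT; apply/asboolP.
    by exists (cmap_fun T x); split=> //; exists x.
  by rewrite -pcoord_cmap; apply: le_trans cx; exact: dist2_ge.
apply: (le_trans (N_pullback f0 hc)); rewrite ler_nat.
by rewrite (leq_trans (count_size _ _))// size_map size_filter.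
Qed.

End Products.

(** * The covering number and the sums over long sides *)

Variable s : bool -> R.
Hypothesis s_ge0 : forall l, 0 <= s l.
Hypothesis hs : forall l, has_exponent (NK l) (s l).

(** Its logarithm divided by - ln d is the bracket of the dimension formula; see [dim_termE]. *)
Definition long_sum l d := \sum_(S <- els (stopped W d) | long S == l)
  (contr l S / d) `^ s l.

Definition total_sum d := long_sum false d + long_sum true d.

Lemma long_sum_ge0 l d : 0 <= long_sum l d.
Proof. by rewrite /long_sum sumr_ge0// => S _; exact: powR_ge0. Qed.

Lemma total_sumE d : total_sum d =
  \sum_(S <- els (stopped W d)) (contr (long S) S / d) `^ s (long S).
Proof.
rewrite (bigID (fun S => long S == false)) /=; congr (_ + _).
  by apply: eq_bigr => S /eqP ->.
rewrite (eq_bigl (fun S => long S == true)); last by move=> S; case: (long S).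
by apply: eq_bigr => S /eqP ->.
Qed.

Lemma N_le_total e : 0 < e -> \forall d \near 0^'+, N d <= d `^ (- e) * total_sum d.
Proof.
move=> e0; have e2 : 0 < e / 2 by rewrite divr_gt0.
(* Every ratio of a stopped map exceeds r0 * d, so the scales d / (2 * contr l S) stay below
   r0^(-1). *)
have hC l : exists2 C, 0 < C &
    forall d, 0 < d <= r0^-1 -> NK l d <= C * d `^ (- (s l + e / 2)).
  apply: exponent_upper => //.
  by move=> d d' d0 dd'; exact: (unit_N_mono (L01 (l := l))).
have /choice[C hC'] : forall l, exists C, 0 < C /\
    forall d, 0 < d <= r0^-1 -> NK l d <= C * d `^ (- (s l + e / 2)).
  by move=> l; have [C C0 h] := hC l; exists C.
pose B l := C l * 2 `^ (s l + e / 2).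
have B0 l : 0 <= B l by rewrite mulr_ge0 ?powR_ge0 ?ltW//; have [] := hC' l.
near=> d; have d01 : 0 < d < 1 by near: d; exact: near_in01.
case/andP: (d01) => d0 d1.
have hB : B false + B true <= d `^ (- (e / 2)) by near: d; exact: near_const_le_powRN.
apply: (le_trans (N_le_sum d01)).
rewrite total_sumE mulr_sumr big_seq [leRHS]big_seq; apply: ler_sum => S.
move=> /elsP -/(_ (finite_stopped d0)) hS; set l := long S.
have hl : 0 < contr l S := stopped_gt0 l hS.
have hl1 : contr l S <= 1.
  by apply: (le_trans (stopped_le_r1 l hS)); exact: ltW.
have hl2 : r0 * d < contr l S := stopped_gt l hS.
have [C0 hCl] := hC' l.
have x0 : 0 < d / (2 * contr l S) by rewrite divr_gt0// mulr_gt0.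
apply: (le_trans (hCl _ _)).
  rewrite x0 /= ler_pdivrMr ?mulr_gt0// -ler_pdivrMl ?invr_gt0// invrK.
  by rewrite (le_trans (ltW hl2))// ler_peMl ?(ltW hl)//; lra.
have -> : (d / (2 * contr l S)) `^ (- (s l + e / 2)) =
    2 `^ (s l + e / 2) * (contr l S / d) `^ (s l + e / 2).
  rewrite powRN -powRM ?divr_ge0 ?(ltW hl) ?(ltW d0)//.
  have -> : 2 * (contr l S / d) = (d / (2 * contr l S))^-1 by rewrite invf_div mulrA.
  by rewrite -[in RHS]powR_inv1 ?(ltW x0)// -powRrM mulN1r powRN.
rewrite mulrA -/(B l) powRDn0 ?divr_gt0// [leRHS]mulrC mulrCA ler_wpM2l ?powR_ge0//.
have -> : - e = - (e / 2) + - (e / 2) by lra.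
rewrite powRDn0//; apply: ler_pM => //; first exact: powR_ge0.
  by apply: le_trans hB; have := B0 false; have := B0 true; case: (l); lra.
rewrite powRM ?(ltW hl) ?invr_ge0 ?(ltW d0)//.
rewrite powRN -[d^-1]powR_inv1 ?(ltW d0)// -powRrM mulN1r powRN ler_piMl ?invr_ge0 ?powR_ge0//.
suff : contr l S `^ (e / 2) <= 1 `^ (e / 2) by rewrite powR1.
by apply: ge0_ler_powR; rewrite ?nnegrE ?(ltW e2) ?(ltW hl).
Unshelve. all: by end_near. Qed.

Hypothesis hanc : forall e, 0 < e -> \forall d \near 0^'+,
  neighbours (@dist2 R) (@cmap_fun R) L (stopped W) d <= d `^ (- e).

Lemma long_sum_pow_le l e : 0 < e -> \forall d \near 0^'+, exists2 k, 0 < k &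
  forall n, (0 < n)%N -> k * (2 * long_sum l d * d `^ e) ^+ n <= N ((r0 * d) ^+ n).
Proof.
(* One [u] lowers the exponent [s l], one bounds the number of neighbours, one absorbs the constants
   2 and r0, and one is spare. The factor 2 in the statement pays for passing to the larger half in
   [carpet_exponent]. *)
move=> e0; pose u := e / 4; have u0 : 0 < u by rewrite divr_gt0.
have hC : exists2 C, 0 < C &
    forall d, 0 < d <= 1 -> C * d `^ (- (s l - u)) <= NK l d.
  apply: exponent_lower => //.
  by move=> d d0; exact: (unit_N_ge1 (L01 (l := l)) (proj_nonempty l)).
have {hC}[k k0 hk] := hC.
near=> d; have d01 : 0 < d < 1 by near: d; exact: near_in01.
have hf : neighbours (@dist2 R) (@cmap_fun R) L (stopped W) d <= d `^ (- u).
  by near: d; exact: hanc.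
have hc : 2 * r0 `^ (- u) <= d `^ (- u) by near: d; exact: near_const_le_powRN.
case/andP: (d01) => d0 d1.
exists k => // n n0.
pose f := neighbours (@dist2 R) (@cmap_fun R) L (stopped W) d.
pose M := Num.truncn f; pose A := [seq U <- els (stopped W d) | long U == l].
pose eta := r0 * d; have eta0 : 0 < eta by rewrite mulr_gt0.
have hA S : S \in A -> cmap_fun S @` L `<=` L /\ (forall l, r0 * d <= contr l S).
  rewrite mem_filter => /andP[_ /elsP -/(_ (finite_stopped d0)) hS].
  split=> [|l']; last exact/ltW/(stopped_gt l' hS).
  have [w [-> Gw _ _]] := stopped_word hS.
  exact: (cmap_image_sub Gw).
have hb := min_ratio_bounds.
have hM x : (count (fun S => `[< (cmap_fun S @` L) `&` cball (@dist2 R) x d !=set0 >]) A <= M)%N.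
  have h : ncard R (meeting (@cmap_word R) W (@min_ratio R) (@dist2 R) (@cmap_fun R) L d x) <= f.
    by apply: (meeting_le_neighbours hW hb) => //; rewrite lexx ltW.
  have f0 : 0 <= f by apply: le_trans h; rewrite ncard_els.
  rewrite truncn_ge_nat//; apply: le_trans h; rewrite ncard_els ler_nat -size_filter.
  apply: size_els_ge.
  - exact: (finite_meeting hW hb).
  - by rewrite !filter_uniq// uniq_els.
  - move=> S; rewrite !mem_filter => /and3P[/asboolP hS _].
    by move=> /elsP -/(_ (finite_stopped d0)).
have f0 : 0 <= f.
  have [x Lx] := Ln0.
  apply: le_trans (meeting_le_neighbours hW hb (@dist2 R) (@cmap_fun R) L (c := d) x d0 _).
    by rewrite ncard_els.
  by rewrite lexx ltW.
have Mf : M%:R <= d `^ (- u) by apply: le_trans hf; rewrite truncn_le.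
have h1 := sum_products_le d01 hA hM l n.
have h2 : k * (\sum_(S <- A) (contr l S / eta) `^ (s l - u)) ^+ n <=
    \sum_(T <- products A n) NK l (eta ^+ n / contr l T).
  rewrite -(sum_products A d01) mulr_sumr big_seq [leRHS]big_seq; apply: ler_sum => T.
  move=> /(productsP d01 hA)[TL hT].
  have cT : 0 < contr l T by apply: lt_le_trans (hT l); rewrite exprn_gt0.
  have x0 : 0 < eta ^+ n / contr l T by rewrite divr_gt0// exprn_gt0.
  apply: le_trans (hk _ _); last by rewrite x0 /= ler_pdivrMr// mul1r.
  by rewrite -powRV ?(ltW x0)// invf_div.
have h3 : long_sum l d * eta `^ u <= \sum_(S <- A) (contr l S / eta) `^ (s l - u).
  rewrite /long_sum -big_filter -/A mulr_suml big_seq [leRHS]big_seq; apply: ler_sum => S SA.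
  have [SL hS] := hA S SA; have cS : 0 < contr l S by apply: lt_le_trans (hS l).
  rewrite powRDn0 ?divr_gt0//; apply: ler_pM; rewrite ?powR_ge0//.
    apply: ge0_ler_powR; rewrite ?nnegrE ?divr_ge0 ?(ltW cS) ?(ltW d0) ?(ltW eta0)//.
    rewrite ler_wpM2l ?(ltW cS)// lef_pV2 ?posrE// ler_piMl ?(ltW d0)//.
    by rewrite (le_trans r01)// ltW.
  rewrite powR_le_ln ?powR_gt0 ?divr_gt0// ln_powR mulNr -mulrN ler_wpM2l ?(ltW u0)//.
  rewrite ln_div ?posrE// opprB lerBrDr gerDl; apply: ln_le0.
  rewrite mem_filter in SA; case/andP: SA => _.
  move=> /elsP -/(_ (finite_stopped d0)) hS'.
  by apply: (le_trans (stopped_le_r1 l hS')); exact: ltW.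
set Sig := \sum_(S <- A) _ in h2 h3.
have h4 : 2 * long_sum l d * d `^ e <= Sig * d `^ u.
  apply: le_trans (ler_wpM2r (powR_ge0 _ _) h3).
  rewrite -[leRHS]mulrA.
  have -> : 2 * long_sum l d * d `^ e = long_sum l d * (2 * d `^ e) by ring.
  rewrite ler_wpM2l ?long_sum_ge0//.
  have -> : e = 4 * u by rewrite /u; field.
  have -> : 4 * u = u + (u + (u + u)) by ring.
  rewrite !(powRDn0 (d := d))// powRM ?(ltW r0_gt0) ?(ltW d0)//.
  move: hc; rewrite !powRN -[leRHS]div1r ler_pdivlMr ?powR_gt0// mulrAC ler_pdivrMr ?powR_gt0// mul1r.
  have : d `^ u <= 1.
    by rewrite powR_le_ln// ln1 mulr_ge0_le0 ?(ltW u0)// ln_le0// ltW.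
  have := powR_gt0 u d0; have := powR_gt0 u r0_gt0.
  move: (d `^ u) (r0 `^ u) => x y y0 x0 x1 hxy.
  rewrite [leLHS](_ : _ = (2 * x) * x * (x * x)); last by ring.
  rewrite [leRHS](_ : _ = y * (x * x)); last by ring.
  rewrite ler_wpM2r ?mulr_ge0 ?(ltW x0)//; apply: le_trans hxy.
  by rewrite ler_piMr// mulr_ge0// ltW.
have h5 := le_trans h2 h1.
have h6 : k * (Sig * d `^ u) ^+ n <= N (eta ^+ n).
  rewrite exprMn mulrA -ler_pdivlMr ?exprn_gt0 ?powR_gt0//; apply: (le_trans h5).
  have N0 : 0 <= N (eta ^+ n).
    by rewrite (le_trans _ (N_ge1 _))// exprn_gt0.
  rewrite ler_wpM2l// natrX -exprVn -powRN lerXn2r// nnegrE ?powR_ge0//.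
apply: le_trans h6; rewrite ler_wpM2l ?(ltW k0)// lerXn2r// ?nnegrE.
  by rewrite !mulr_ge0 ?powR_ge0 ?long_sum_ge0.
by apply: le_trans h4; rewrite !mulr_ge0 ?powR_ge0 ?long_sum_ge0.
Unshelve. all: by end_near. Qed.

Lemma carpet_exponent : exists2 a, 0 <= a & has_exponent N a /\ has_exponent total_sum a.
Proof.
apply: (@submultiplicative_exponent R N total_sum r0 3).
- by rewrite r0_gt0 (le_trans r01)// ltW.
- by move=> d /andP[d0 _]; exact: N_ge1.
- by move=> d d' d0 dd' _; exact: N_mono.
- exact: N_poly.
- exact: N_le_total.
move=> e e0; near=> d.
have d01 : 0 < d < 1 by near: d; exact: near_in01.
have [k1 k1_gt0 hk1] : exists2 k, 0 < k & forall n, (0 < n)%N ->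
    k * (2 * long_sum false d * d `^ e) ^+ n <= N ((r0 * d) ^+ n).
  by near: d; exact: long_sum_pow_le.
have [k2 k2_gt0 hk2] : exists2 k, 0 < k & forall n, (0 < n)%N ->
    k * (2 * long_sum true d * d `^ e) ^+ n <= N ((r0 * d) ^+ n).
  by near: d; exact: long_sum_pow_le.
have t0 : 0 <= total_sum d * d `^ e.
  by rewrite mulr_ge0 ?powR_ge0// addr_ge0// long_sum_ge0.
case: (leP (long_sum false d) (long_sum true d)) => h.
  exists k2 => // n n0; apply: le_trans (hk2 n n0).
  have h' : total_sum d * d `^ e <= 2 * long_sum true d * d `^ e.
    by rewrite ler_wpM2r ?powR_ge0// /total_sum; lra.
  by rewrite ler_wpM2l ?(ltW k2_gt0)// lerXn2r ?nnegrE ?(le_trans t0).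
exists k1 => // n n0; apply: le_trans (hk1 n n0).
have h' : total_sum d * d `^ e <= 2 * long_sum false d * d `^ e.
  by rewrite ler_wpM2r ?powR_ge0// /total_sum; lra.
by rewrite ler_wpM2l ?(ltW k1_gt0)// lerXn2r ?nnegrE ?(le_trans t0).
Unshelve. all: by end_near. Qed.

Variable a : R.
Hypothesis a_ge0 : 0 <= a.
Hypothesis hN : has_exponent N a.

Hypothesis hZ : has_exponent total_sum a.

(** [L] lies in the product of its projections, so [N] is at most the product of their covering
    numbers at half the scale. *)
Lemma exponent_le_prod : a <= s false + s true.
Proof.
rewrite leNgt; apply/negP => sa.
pose e := (a - (s false + s true)) / 4; have e0 : 0 < e by rewrite divr_gt0// subr_gt0.
have hC l : exists2 C, 0 < C & forall d, 0 < d <= 1 -> NK l d <= C * d `^ (- (s l + e)).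
  apply: exponent_upper => //.
  by move=> d d' d0 dd'; exact: (unit_N_mono (L01 (l := l))).
have [C1 C10 h1] := hC false; have [C2 C20 h2] := hC true.
pose C := C1 * C2 * (2^-1 `^ (- (s false + e)) * 2^-1 `^ (- (s true + e))).
near (0:R)^'+ => d; have d01 : 0 < d < 1 by near: d; exact: near_in01.
have /andP[h3 _] : d `^ (- (a - e)) <= N d <= d `^ (- (a + e)) by near: d; exact: hN.
have h4 : C + 1 <= d `^ (- e) by near: d; exact: near_const_le_powRN.
case/andP: (d01) => d0 d1; have d2 : 0 < d / 2 <= 1 by rewrite divr_gt0//=; lra.
have h5 : N d <= C * d `^ (- (s false + s true + 2 * e)).
  apply: (le_trans (N_le_prod d0)).
  have n1 : 0 <= NK false (d / 2).
    by rewrite (le_trans _ (unit_N_ge1 (L01 (l := false)) (proj_nonempty false) _))//; case/andP: d2.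
  have n2 : 0 <= NK true (d / 2).
    by rewrite (le_trans _ (unit_N_ge1 (L01 (l := true)) (proj_nonempty true) _))//; case/andP: d2.
  apply: (le_trans (ler_pM n1 n2 (h1 _ d2) (h2 _ d2))).
  have i2 : 0 <= 2^-1 :> R by rewrite invr_ge0.
  rewrite !(powRM _ (ltW d0) i2) /C.
  have -> : - (s false + s true + 2 * e) = - (s false + e) + - (s true + e) by ring.
  rewrite powRDn0// le_eqVlt; apply/orP; left; apply/eqP; ring.
have := le_trans h3 h5.
have -> : - (a - e) = - e + - (s false + s true + 2 * e) by rewrite /e; field.
by rewrite powRDn0// ler_pM2r ?powR_gt0//; lra.
Unshelve. all: by end_near. Qed.

(** * Pressure sums near the exponent [a] *)

Definition pressure_term l t S : R :=
  (contr l S / contr (~~ l) S) `^ s l * contr (~~ l) S `^ t.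

Lemma pressure_term_ge0 l t S : 0 <= pressure_term l t S.
Proof. by rewrite mulr_ge0 ?powR_ge0. Qed.

(** With y the ratio in direction ~~ l, the first two summands bound (y / d)^(a - s l) for y / d in
    [r0, 1]. The last bounds (y / d)^(a - s l - s (~~ l)) for y / d > r0, the exponent being at most
    0. *)
Let term_const l := r0 `^ (a - s l) + 1 + r0 `^ (a - s l - s (~~ l)).

(* When [l] is the short direction, the bound [a <= s false + s true] lets the
   long direction of [S] pay for its contribution. *)
Lemma pressure_term_le l eta d S : 0 < eta -> 0 < d -> stopped W d S ->
  pressure_term l (a + eta) S <=
  term_const l * d `^ (a + kappa * eta) * (contr (long S) S / d) `^ s (long S).
Proof.
move=> eta0 d0 hS.
have cgt l' : 0 < contr l' S := stopped_gt0 l' hS.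
have cd l' : r0 < contr l' S / d.
  by rewrite ltr_pdivlMr// (stopped_gt l' hS).
have /andP[_ sh] := stopped_short hS.
(* The ratio in direction ~~ l may be the long one, for which only the bound d^kappa is at hand;
   hence the gain kappa * eta instead of eta. *)
have eta_le : contr (~~ l) S `^ eta <= d `^ (kappa * eta).
  rewrite powRrM; apply: ge0_ler_powR; rewrite ?nnegrE ?powR_ge0 ?(ltW eta0) ?(ltW (cgt _))//.
  exact: (stopped_le_powR (~~ l) d0 hS).
have sum_ne0 := exponent_le_prod.
rewrite /pressure_term !powRDn0// mulrA [_ * (d `^ a * _)]mulrA [leRHS]mulrAC.
apply: ler_pM => //; rewrite ?mulr_ge0 ?powR_ge0//.
set x := contr l S in cgt cd sh eta_le *; set y := contr (~~ l) S in cgt cd sh eta_le *.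
have x0 : 0 < x := cgt l; have y0 : 0 < y := cgt (~~ l).
have xd : r0 < x / d := cd l; have yd : r0 < y / d := cd (~~ l).
have -> : y `^ a = d `^ a * (y / d) `^ a.
  by rewrite -powRM ?divr_ge0 ?(ltW y0) ?(ltW d0)// mulrCA divff ?gt_eqF// mulr1.
case: (eqVneq (long S) l) => [lS|].
  rewrite lS -/x in sh *; rewrite -/y in sh.
  have -> : (x / y) `^ s l = (x / d) `^ s l * (y / d) `^ (- s l).
    rewrite -powRV ?divr_ge0 ?(ltW y0) ?(ltW d0)//
      -powRM ?invr_ge0 ?divr_ge0 ?(ltW x0) ?(ltW y0) ?(ltW d0)//.
    by congr (_ `^ _); field; rewrite !gt_eqF.
  have h : (y / d) `^ (a - s l) <= term_const l.
    apply: (@le_trans _ _ (r0 `^ (a - s l) + 1 `^ (a - s l))).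
      by apply: powR_between => //; rewrite (ltW yd) ler_pdivrMr// mul1r.
    by rewrite powR1 /term_const lerDl powR_ge0.
  have -> : (x / d) `^ s l * (y / d) `^ (- s l) * (d `^ a * (y / d) `^ a) =
      (y / d) `^ (a - s l) * d `^ a * (x / d) `^ s l.
    rewrite powRDn0 ?divr_gt0//; ring.
  by rewrite -!mulrA ler_wpM2r// mulr_ge0 ?powR_ge0.
move=> nl; have lS : long S = ~~ l by case: (long S) (l) nl => -[].
rewrite lS negbK -/x in sh; rewrite lS -/y.
have -> : (x / y) `^ s l = (x / d) `^ s l * (y / d) `^ (- s l).
  rewrite -powRV ?divr_ge0 ?(ltW y0) ?(ltW d0)//
      -powRM ?invr_ge0 ?divr_ge0 ?(ltW x0) ?(ltW y0) ?(ltW d0)//.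
  by congr (_ `^ _); field; rewrite !gt_eqF.
have h1 : (x / d) `^ s l <= 1.
  suff : (x / d) `^ s l <= 1 `^ s l by rewrite powR1.
  by apply: ge0_ler_powR; rewrite ?nnegrE ?divr_ge0 ?(ltW x0) ?(ltW d0)// ler_pdivrMr// mul1r.
have h2 : (y / d) `^ (a - s l - s (~~ l)) <= term_const l.
  apply: (@le_trans _ _ (r0 `^ (a - s l - s (~~ l)))).
    rewrite powR_le_ln ?powR_gt0 ?divr_gt0// ln_powR ler_wnM2l//.
      by move: sum_ne0; case: (l) => /=; lra.
    by rewrite ler_ln ?posrE ?divr_gt0// ltW.
  by rewrite /term_const lerDr addr_ge0 ?powR_ge0.
have -> : (x / d) `^ s l * (y / d) `^ (- s l) * (d `^ a * (y / d) `^ a) =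
    (x / d) `^ s l * ((y / d) `^ (a - s l - s (~~ l)) * (d `^ a * (y / d) `^ s (~~ l))).
  rewrite !(powRDn0 (d := y / d)) ?divr_gt0// [(y / d) `^ (- s (~~ l))]powRN.
  by field; rewrite gt_eqF// powR_gt0// divr_gt0.
apply: (le_trans (ler_wpM2r _ h1)); first by rewrite !mulr_ge0 ?powR_ge0.
by rewrite mul1r -[leRHS]mulrA ler_wpM2r// mulr_ge0 ?powR_ge0.
Qed.

Lemma pressure_sum_small l eta : 0 < eta ->
  \forall d \near 0^'+, \sum_(S <- els (stopped W d)) pressure_term l (a + eta) S
    <= d `^ (kappa * eta / 2).
Proof.
(* Half of the gain kappa * eta is given up: one [e] for [term_const], one for the upper bound of
   [total_sum]. *)
move=> eta0; pose e := kappa * eta / 4.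
have e0 : 0 < e by rewrite divr_gt0// mulr_gt0.
have C0 : 0 <= term_const l by rewrite !addr_ge0 ?powR_ge0.
near=> d; have d01 : 0 < d < 1 by near: d; exact: near_in01.
case/andP: (d01) => d0 d1.
have /andP[_ h1] : d `^ (- (a - e)) <= total_sum d <= d `^ (- (a + e)) by near: d; exact: hZ.
have h2 : term_const l <= d `^ (- e) by near: d; exact: near_const_le_powRN.
apply: (@le_trans _ _ (term_const l * d `^ (a + kappa * eta) * total_sum d)).
  rewrite total_sumE mulr_sumr big_seq [leRHS]big_seq; apply: ler_sum => S.
  move=> /elsP -/(_ (finite_stopped d0)) hS.
  exact: pressure_term_le.
apply: (@le_trans _ _ (d `^ (- e) * d `^ (a + kappa * eta) * d `^ (- (a + e)))).
  apply: ler_pM => //; first by rewrite mulr_ge0 ?powR_ge0.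
    by rewrite addr_ge0// long_sum_ge0.
  by rewrite ler_wpM2r ?powR_ge0.
by rewrite -!powRDn0// le_eqVlt; apply/orP; left; apply/eqP; congr (_ `^ _); rewrite /e; field.
Unshelve. all: by end_near. Qed.

Lemma long_sum_large e : 0 < e -> \forall d \near 0^'+, exists l, d `^ (- (a - e)) <= long_sum l d.
Proof.
move=> e0; have e2 : 0 < e / 2 by rewrite divr_gt0.
near=> d; have d01 : 0 < d < 1 by near: d; exact: near_in01.
case/andP: (d01) => d0 d1.
have /andP[h1 _] : d `^ (- (a - e / 2)) <= total_sum d <= d `^ (- (a + e / 2)).
  by near: d; exact: hZ.
have h2 : 2 <= d `^ (- (e / 2)) by near: d; exact: near_const_le_powRN.
have : 2 * d `^ (- (a - e)) <= total_sum d.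
  apply: le_trans h1.
  have -> : - (a - e / 2) = - (e / 2) + - (a - e) by field.
  by rewrite powRDn0// ler_wpM2r// powR_ge0.
rewrite /total_sum => h.
case: (leP (long_sum false d) (long_sum true d)) => h3; [exists true|exists false]; lra.
Unshelve. all: by end_near. Qed.

(** Only the maps with long side [l] are kept. Their short ratio lies between r0 * d and d, so its
    power is comparable with that of [d] whatever the sign of a - eta. *)
Lemma pressure_sum_large eta : 0 < eta -> \forall d \near 0^'+, exists l,
  d `^ (- (eta / 2)) <= \sum_(S <- els (stopped W d)) pressure_term l (a - eta) S.
Proof.
move=> eta0; pose e := eta / 4; have e0 : 0 < e by rewrite divr_gt0.
pose p := a - eta; pose c := r0 `^ (- p) + 1.
have c0 : 0 < c by rewrite ltr_wpDl ?powR_ge0.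
near=> d; have d01 : 0 < d < 1 by near: d; exact: near_in01.
case/andP: (d01) => d0 d1.
have [l hl] : exists l, d `^ (- (a - e)) <= long_sum l d by near: d; exact: long_sum_large.
have hc : c <= d `^ (- e) by near: d; exact: near_const_le_powRN.
exists l.
apply: (@le_trans _ _ (c^-1 * d `^ p * long_sum l d)).
  apply: (@le_trans _ _ (c^-1 * d `^ p * d `^ (- (a - e)))); last first.
    by rewrite ler_wpM2l// mulr_ge0 ?powR_ge0 ?invr_ge0 ?(ltW c0).
  rewrite -mulrA ler_pdivlMl// -powRDn0//.
  apply: (le_trans (ler_wpM2r (powR_ge0 _ _) hc)); rewrite -powRDn0//.
  by rewrite le_eqVlt; apply/orP; left; apply/eqP; congr (_ `^ _); rewrite /p /e; field.
rewrite /long_sum mulr_sumr [leRHS](bigID (fun S => long S == l)) /=.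
apply: ler_wpDr; first by rewrite sumr_ge0// => S _; exact: pressure_term_ge0.
rewrite -big_filter -[leRHS]big_filter big_seq [leRHS]big_seq; apply: ler_sum => S.
rewrite mem_filter => /andP[/eqP lS].
move=> /elsP -/(_ (finite_stopped d0)) hS.
have cgt l' : 0 < contr l' S := stopped_gt0 l' hS.
have /andP[sh1 sh2] := stopped_short hS; rewrite lS in sh1 sh2.
have h1 : (contr l S / d) `^ s l <= (contr l S / contr (~~ l) S) `^ s l.
  apply: ge0_ler_powR; rewrite ?nnegrE ?divr_ge0 ?(ltW (cgt _)) ?(ltW d0)//.
  by rewrite ler_wpM2l ?(ltW (cgt _))// lef_pV2 ?posrE.
have h2 : c^-1 * d `^ p <= contr (~~ l) S `^ p.
  have -> : contr (~~ l) S `^ p = d `^ p * (contr (~~ l) S / d) `^ p.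
    by rewrite -powRM ?divr_ge0 ?(ltW (cgt _)) ?(ltW d0)// mulrCA divff ?gt_eqF// mulr1.
  rewrite mulrC ler_wpM2l ?powR_ge0// -[p]opprK powRN lef_pV2 ?posrE ?powR_gt0 ?divr_gt0//.
  have -> : c = r0 `^ (- p) + 1 `^ (- p) by rewrite powR1.
  by apply: powR_between => //; rewrite ler_pdivlMr// ler_pdivrMr// mul1r sh2 ltW.
rewrite /pressure_term mulrC; apply: ler_pM => //; rewrite ?powR_ge0//.
by rewrite mulr_ge0 ?powR_ge0 ?invr_ge0 ?(ltW c0).
Unshelve. all: by end_near. Qed.

(** * Projections and their neighbour counts *)

Lemma proj_ifs_ratio l f : f \in proj_ifs l G -> r0 <= `|f.1| <= r1.
Proof. by move=> /imfsetP[S /= SG ->]; have := hG SG l. Qed.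

Lemma proj_attractor l : K l = \bigcup_(f in [set` proj_ifs l G]) (aff_fun f @` K l).
Proof.
apply/seteqP; split=> [_ [x Lx <-]|y [f /= /imfsetP[S /= SG ->] [_ [x Lx <-] <-]]].
  move: Lx; rewrite {1}hL => -[S /= SG [y Ly <-]].
  exists (pcoord l S); first by apply/imfsetP; exists S.
  by exists (pcoord l y); [exists y|rewrite pcoord_cmap].
exists (cmap_fun S x); last by rewrite pcoord_cmap.
by rewrite hL; exists S => //; exists x.
Qed.

Lemma proj_words l n w : words G n w -> words (proj_ifs l G) n (map (pcoord l) w).
Proof.
move=> [sw Gw]; split; first by rewrite size_map.
by move=> f /mapP[S Sw ->]; apply/imfsetP; exists S => //=; exact: Gw.
Qed.

Lemma proj_comps l n : pcoord l @` comps G n = @aff_word R @` words (proj_ifs l G) n.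
Proof.
apply/seteqP; split=> [_ [_ [w hw <-] <-]|_ [v [sv Fv] <-]].
  by rewrite pcoord_word; exists (map (pcoord l) w) => //; exact: proj_words.
suff [w [hw <-]] : exists w, words G n w /\ map (pcoord l) w = v.
  by exists (cmap_word w); [exists w|rewrite pcoord_word].
elim: v n sv Fv => [|f v IH] n /= sv Fv; first by exists [::]; rewrite -sv.
have [|w [[sw Gw] wv]] := IH _ erefl; first by move=> g gv; apply: Fv; rewrite inE gv orbT.
have /imfsetP[S /= SG fS] := Fv f (mem_head _ _).
exists (S :: w); split; last by rewrite /= wv fS.
split; first by rewrite /= sw.
by move=> U; rewrite inE => /predU1P[->|/Gw].
Qed.

(** Enough points at spacing r0 * c to go across an interval of length 2 * c. *)
Let grid := (Num.truncn (2 / r0)).+1.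

(* A projection [pcoord l S] has ratio comparable with a power of [r1], which may
   be smaller than [c] by the factor [r0]; hence the ball of radius [c] is split
   into boundedly many balls of radius [r0 * c]. *)
Lemma proj_meeting l d c x : 0 < d < 1 -> d <= c <= 1 ->
  exists s : seq (aff R),
    (forall S, meeting (@cmap_word R) W (@min_ratio R) (@dist2 R) (@cmap_fun R) L c x S ->
       pcoord l S \in s) /\
    (size s)%:R <= (1 - ln (r0 * d) * (- ln r1)^-1) * grid%:R *
      neighbours (@dist1 R) (@aff_fun R) (K l) (astop (V l)) (r0 * d).
Proof.
move=> /andP[d0 d1] /andP[dc c1]; have c0 : 0 < c by exact: lt_le_trans dc.
have hb := aratio_bounds r0_gt0 r01 r1_lt1 (@proj_ifs_ratio l).
have rd0 : 0 < r0 * d by rewrite mulr_gt0.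
have rd1 : r0 * d <= 1.
  by rewrite mulr_ile1 ?(ltW r0_gt0) ?(ltW d0) ?(ltW d1)// (le_trans r01)// ltW.
have [||M /andP[hM1 hM2]] := @exprn_between R r1 (r0 * d); [by rewrite r1_gt0|by rewrite rd0|].
pose centers := [seq pcoord l x - c + i%:R * (r0 * c) | i <- iota 0 grid].
pose t (kc : nat * R) := els (meeting (@aff_word R) (V l) (@aratio R) (@dist1 R)
  (@aff_fun R) (K l) (r1 ^+ kc.1) kc.2).
pose ks := [seq (k, z) | k <- iota 0 M.+1, z <- centers].
exists (flatten (map t ks)); split; last first.
  apply: (@le_trans _ _ ((size ks)%:R *
      neighbours (@dist1 R) (@aff_fun R) (K l) (astop (V l)) (r0 * d))).
    apply: size_flatten_le => _ /allpairsP[[k z] [kM _ ->]].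
    apply: (meeting_le_neighbours (hV l) hb) => //.
    rewrite exprn_ile1 ?(ltW r1_gt0) ?(ltW r1_lt1)// andbT; apply: (le_trans hM2).
    rewrite ler_wiXn2l ?(ltW r1_gt0) ?(ltW r1_lt1)//.
    by move: kM; rewrite mem_iota /= add0n ltnS.
  have n0 : 0 <= neighbours (@dist1 R) (@aff_fun R) (K l) (astop (V l)) (r0 * d).
    have rd : r0 * d <= r0 * d <= 1 by rewrite lexx.
    apply: le_trans (meeting_le_neighbours (hV l) hb (@dist1 R) (@aff_fun R) (K l) 0 rd0 rd).
    by rewrite ncard_els.
  rewrite ler_wpM2r// size_allpairs !size_map !size_iota natrM ler_wpM2r//.
  rewrite -natr1 addrC lerD2l.
  have lr : 0 < - ln r1 by apply: Nln_gt0; rewrite r1_gt0.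
  rewrite -mulNr ler_pdivlMr// mulrN lerN2 mulr_natl -lnXn//.
  by rewrite ler_ln ?posrE ?exprn_gt0.
move=> S [hS [_ [[z Lz <-] hz]]].
have [w [Sw Gw w0 _]] := stopped_word hS.
have hw : words (proj_ifs l G) (size w) (map (pcoord l) w) by apply: proj_words.
(* The projected word need not be reduced; [v] is the reduced word of the same map of the line. *)
have [v Vv vw] := reduced_ev (hV l) w0 hw.
rewrite -pcoord_word -Sw in vw.
have [k [_ _ _ hk]] := stop_pow (hV l) hb w0 Vv.
have /andP[_ hk2] := cut_ratio (hV l) hb hk.
have hk3 : r0 * c < r1 ^+ k.
  apply: lt_le_trans hk2; rewrite /aratio vw.
  exact: (stopped_gt l hS).
pose y := aff_fun (pcoord l S) (pcoord l z).
have /ler_normlP[y1 y2] : `|pcoord l x - y| <= c.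
  by rewrite -dist1E /y -pcoord_cmap; apply: le_trans hz; exact: dist2_ge.
have rc0 : 0 < r0 * c by rewrite mulr_gt0.
pose q := (y - (pcoord l x - c)) / (r0 * c).
have q0 : 0 <= q by apply: divr_ge0; [lra|exact: ltW].
have /andP[q1 q2] : (Num.truncn q)%:R <= q < (Num.truncn q).+1%:R by rewrite truncn_itv.
rewrite mem_flatten_map; apply/hasP.
exists (k, pcoord l x - c + (Num.truncn q)%:R * (r0 * c)).
  apply/allpairsP; exists (k, pcoord l x - c + (Num.truncn q)%:R * (r0 * c)); split=> //.
    rewrite mem_iota /= add0n ltnS leqNgt; apply/negP => Mk.
    have : r1 ^+ k <= r1 ^+ M.+1 by rewrite ler_wiXn2l ?(ltW r1_gt0) ?(ltW r1_lt1).
    move=> /(lt_le_trans hk3)/lt_trans/(_ hM1).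
    by rewrite ltr_pM2l// ltNge dc.
  apply/mapP; exists (Num.truncn q) => //.
  rewrite mem_iota /= add0n /grid ltnS; apply: le_truncn.
  by rewrite ler_pdivrMr// mulrA divfK ?gt_eqF//; lra.
rewrite /t /=; apply/elsP.
  by apply: (finite_meeting (hV l) hb); rewrite exprn_gt0.
split; first by exists v.
exists y; split; first by exists (pcoord l z) => //; exists z.
rewrite /cball /= dist1E; apply: le_trans (ltW hk3).
rewrite -natr1 in q2.
have e1 : y = pcoord l x - c + q * (r0 * c) by rewrite /q divfK ?gt_eqF//; ring.
have -> : pcoord l x - c + (Num.truncn q)%:R * (r0 * c) - y =
    - ((q - (Num.truncn q)%:R) * (r0 * c)) by rewrite [in LHS]e1; ring.
rewrite normrN ger0_norm; last by apply: mulr_ge0; [rewrite subr_ge0|exact: ltW].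
by apply: ler_piMl; [exact: ltW|lra].
Qed.

Hypothesis hsep : forall l e, 0 < e -> \forall d \near 0^'+,
  neighbours (@dist1 R) (@aff_fun R) (K l) (astop (V l)) d <= d `^ (- e).

Lemma neighbours_of_projections e : 0 < e -> \forall d \near 0^'+,
  neighbours (@dist2 R) (@cmap_fun R) L (stopped W) d <= d `^ (- e).
Proof.
(* Each projection costs 4 * u: one for the logarithmic number of scales, one for its neighbours,
   two for the constant [C]. *)
move=> e0; pose u := e / 8; have u0 : 0 < u by rewrite divr_gt0.
have lr : 0 < - ln r1 by apply: Nln_gt0; rewrite r1_gt0.
have hlog := near_scale r0_gt0 (near_gt_ln u0 (etrans (invr_gt0 _) lr)).
have hs1 := near_scale r0_gt0 (hsep false u0).
have hs2 := near_scale r0_gt0 (hsep true u0).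
pose C := grid%:R * (r0 `^ (- u) * r0 `^ (- u)).
near=> d; have d01 : 0 < d < 1 by near: d; exact: near_in01.
have h1 : 1 - ln (r0 * d) * (- ln r1)^-1 < (r0 * d) `^ (- u) by near: d; exact: hlog.
have h2 l : neighbours (@dist1 R) (@aff_fun R) (K l) (astop (V l)) (r0 * d) <= (r0 * d) `^ (- u).
  by case: l; near: d; [exact: hs2|exact: hs1].
have hC : C <= d `^ (- (2 * u)).
  by near: d; apply: near_const_le_powRN; rewrite mulr_gt0.
case/andP: (d01) => d0 d1.
have hb := min_ratio_bounds.
apply: (neighbours_le ((0, 0) : R * R)); first exact: ltW.
move=> c x dc.
have bnd l v : (size v)%:R <= (1 - ln (r0 * d) * (- ln r1)^-1) * grid%:R *
      neighbours (@dist1 R) (@aff_fun R) (K l) (astop (V l)) (r0 * d) ->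
    (size (v : seq (aff R)))%:R <= d `^ (- (4 * u)).
  move=> /le_trans; apply.
  apply: (@le_trans _ _ ((r0 * d) `^ (- u) * grid%:R * (r0 * d) `^ (- u))).
    have h0 : 0 <= 1 - ln (r0 * d) * (- ln r1)^-1.
      have : ln (r0 * d) <= 0.
        rewrite ln_le0// mulr_ile1 ?(ltW r0_gt0) ?(ltW d0) ?(ltW d1)//.
        by rewrite (le_trans r01)// ltW.
      have : 0 < (- ln r1)^-1 by rewrite invr_gt0.
      by nra.
    apply: ler_pM; rewrite ?mulr_ge0 ?powR_ge0 ?h2 ?ler_wpM2r ?(ltW h1)//.
    apply: le_trans (meeting_le_neighbours (hV l)
      (aratio_bounds r0_gt0 r01 r1_lt1 (@proj_ifs_ratio l)) (@dist1 R) (@aff_fun R) (K l)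
      (c := r0 * d) 0 _ _).
    - by rewrite ncard_els.
    - by rewrite mulr_gt0.
    - rewrite lexx mulr_ile1 ?(ltW r0_gt0) ?(ltW d0) ?(ltW d1)//.
      by rewrite (le_trans r01)// ltW.
  rewrite powRM ?(ltW r0_gt0) ?(ltW d0)//.
  have -> : r0 `^ (- u) * d `^ (- u) * grid%:R * (r0 `^ (- u) * d `^ (- u)) =
    C * (d `^ (- u) * d `^ (- u)) by rewrite /C; ring.
  have -> : - (4 * u) = - (2 * u) + (- u + - u) by ring.
  by rewrite -powRDn0// [leRHS]powRDn0// ler_wpM2r// powR_ge0.
have [s1 [hs1' b1]] := proj_meeting false x d01 dc.
have [s2 [hs2' b2]] := proj_meeting true x d01 dc.
apply: (@le_trans _ _ ((size s1)%:R * (size s2)%:R)).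
  rewrite ncard_els -natrM ler_nat -(size_allpairs pair s1 s2).
  apply: size_els_le => S hS; apply/allpairsP; exists S; split.
  - exact: hs1'.
  - exact: hs2'.
  - by case: (S).
apply: (le_trans (ler_pM _ _ (bnd _ _ b1) (bnd _ _ b2))) => //.
by rewrite -powRDn0// le_eqVlt; apply/orP; left; apply/eqP; congr (_ `^ _); rewrite /u; field.
Unshelve. all: by end_near. Qed.

(** * Box dimensions and the power mean formula *)

Lemma carpet_box_dim : box_dim_exists (@dist2 R) L /\ box_dim (@dist2 R) L = a.
Proof. by apply: box_dim_exponent hN => d; exact: N_ge1. Qed.

Lemma proj_box_dim l : box_dim (@dist1 R) (K l) = s l.
Proof.
apply: (box_dim_exponent _ (hs l)).2 => d.
exact: (unit_N_ge1 (L01 (l := l)) (proj_nonempty l)).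
Qed.

Lemma stopped_E l d : stopped_ W l d = [set U | stopped W d U /\ long U = l].
Proof.
have h (w : seq (cmap R)) : (if l then word_ratio true w >= word_ratio false w
    else word_ratio false w > word_ratio true w) <-> long (cmap_word w) = l.
  rewrite /long !contr_word; case: l; first by [].
  by rewrite ltNge; split=> [/negbTE|->].
apply/seteqP; split=> [_ [w [hw /h wl] <-]|_ [[w hw <-] wl]].
  by split=> //; exists w.
by exists w => //; split=> //; exact/h.
Qed.

Lemma perm_els_stopped_ l d : 0 < d ->
  perm_eq (els (stopped_ W l d)) [seq U <- els (stopped W d) | long U == l].
Proof.
move=> d0; have fin := finite_stopped d0.
apply: uniq_perm; [exact: uniq_els|by rewrite filter_uniq// uniq_els|move=> S].
have fin' : finite_set (stopped_ W l d).
  by rewrite stopped_E; apply: sub_finite_set fin => U [].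
rewrite mem_filter; apply/idP/andP => [/elsP -/(_ fin')|[/eqP lS /elsP -/(_ fin) hS]].
  by rewrite stopped_E => -[hS /eqP lS]; split=> //; exact/elsP.
by apply/elsP => //; rewrite stopped_E.
Qed.

Lemma dim_termE l d : 0 < d < 1 -> dim_term L W l d =
  if stopped_ W l d == set0 then -oo%E else (ln (long_sum l d) / - ln d)%:E.
Proof.
move=> d01; have d0 : 0 < d by case/andP: d01.
rewrite /dim_term proj_box_dim; case: ifPn => // /set0P hne.
have hsub : stopped_ W l d `<=` stopped W d by rewrite stopped_E => U [].
rewrite power_mean_term//.
- by rewrite (perm_big _ (perm_els_stopped_ l d0)) big_filter.
- by apply: sub_finite_set hsub _; exact: (finite_stopped d0).
- by move=> U /hsub; exact: (stopped_gt0).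
Qed.

(** The larger half may alternate with [d], yet two upper limits below a - e would make both halves
    small at one common scale, against [long_sum_large]. *)
Lemma limsup_dim_term :
  maxe (limf_esup (dim_term L W false) 0^'+) (limf_esup (dim_term L W true) 0^'+) = a%:E.
Proof.
apply/le_anti/andP; split.
  have h l : (limf_esup (dim_term L W l) 0^'+ <= a%:E)%E.
    apply: limf_esup_le => e e0; near=> d.
    have d01 : 0 < d < 1 by near: d; exact: near_in01.
    have /andP[_ h] : d `^ (- (a - e)) <= total_sum d <= d `^ (- (a + e)).
      by near: d; exact: hZ.
    rewrite dim_termE//; case: ifPn => [_|_]; first exact: leNye.
    have ld := Nln_gt0 d01; case/andP: d01 => d0 d1.
    have h' : long_sum l d <= d `^ (- (a + e)).
      apply: le_trans h; rewrite /total_sum.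
      have := long_sum_ge0 false d; have := long_sum_ge0 true d.
      by case: (l); lra.
    rewrite lee_fin ler_pdivrMr//.
    (* [ln 0] is 0, which respects the bound because a + e >= 0. *)
    have [lz|lp] := eqVneq (long_sum l d) 0.
      by rewrite lz ln0// mulr_ge0// ?(ltW ld) ?addr_ge0// ltW.
    have lpos : 0 < long_sum l d by rewrite lt_def lp long_sum_ge0.
    by move: h'; rewrite ln_le_powR//; lra.
  by rewrite ge_max; apply/andP; split; exact: h.
apply/lee_subgt0Pr => e e0; rewrite leNgt; apply/negP.
rewrite gt_max => /andP[h1 h2].
have hlt : \forall d \near 0^'+, forall l, (dim_term L W l d < (a - e)%:E)%E.
  by apply: filterS2 (limf_esup_lt _ h1) (limf_esup_lt _ h2) => d p1 p2 [];
    [exact: p2|exact: p1].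
have hl := long_sum_large e0.
near (0 : R)^'+ => d.
have d01 : 0 < d < 1 by near: d; exact: near_in01.
have [l hl'] : exists l, d `^ (- (a - e)) <= long_sum l d by near: d; exact: hl.
have : (dim_term L W l d < (a - e)%:E)%E by move: l {hl'}; near: d; exact: hlt.
have ld := Nln_gt0 d01; case/andP: (d01) => d0 d1.
have lpos : 0 < long_sum l d by apply: lt_le_trans hl'; exact: powR_gt0.
(* An empty family gives a vanishing [long_sum], which the lower bound excludes. *)
rewrite dim_termE//; case: ifPn => [/eqP h0 _|_].
  have : long_sum l d = 0.
    rewrite /long_sum -big_filter -(perm_big _ (perm_els_stopped_ l d0)) h0 /els fset_set0.
    by rewrite big_nil.
  by move=> lz; rewrite lz ltxx in lpos.
rewrite lte_fin ltr_pdivrMr// ltNge; apply/negP/negPn.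
by move: hl'; rewrite powR_le_ln//; lra.
Unshelve. all: by end_near. Qed.

(** * Roots of the pressure equations *)

Definition contracting_family (A : set (cmap R)) : Prop :=
  [/\ finite_set A, A !=set0 & forall U, A U -> forall l, 0 < contr l U <= r1].

Lemma stopped_family d : 0 < d < 1 -> contracting_family (stopped W d).
Proof.
move=> d01; have /andP[d0 d1] := d01; split.
- exact: (finite_stopped d0).
- have [x Lx] := Ln0.
  by have [U hU _] := stopped_cover d01 Lx; exists U.
- move=> U hU l; rewrite (stopped_gt0 l hU).
  exact: (stopped_le_r1 l hU).
Qed.

Lemma words_nonempty n : words G n !=set0.
Proof.
have [x Lx] := Ln0; have : exists f, f \in G.
  by move: Lx; rewrite hL => -[f fG _]; exists f.
case=> f fG; exists (nseq n f); split; first by rewrite size_nseq.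
by move=> g; rewrite mem_nseq => /andP[_ /eqP ->].
Qed.

Lemma comps_ratio n U l : comps G n U -> r0 ^+ n <= contr l U <= r1 ^+ n.
Proof. by move=> [w [<- Gw] <-]; exact: (contr_word_bounds l Gw). Qed.

Lemma comps_family n : (0 < n)%N -> contracting_family (comps G n).
Proof.
move=> n0; split.
- exact: finite_image (finite_words _ _).
- by have [w hw] := words_nonempty n; exists (cmap_word w), w.
- move=> U /comps_ratio h l; have /andP[h1 h2] := h l.
  rewrite (lt_le_trans _ h1) ?exprn_gt0//= (le_trans h2)//.
  case: (n) n0 => // k _.
  by rewrite exprS ler_piMr ?(ltW r1_gt0)// exprn_ile1 ?(ltW r1_gt0) ?(ltW r1_lt1).
Qed.

Section Family.
Variables (A : set (cmap R)) (l : bool) (p : R).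
Hypothesis hA : contracting_family A.

Let coef U := (contr l U / contr (~~ l) U) `^ p.

Let coef_gt0 U : U \in els A -> 0 < coef U.
Proof.
case: hA => Af _ h /elsP -/(_ Af)/h hU.
have /andP[h1 _] := hU l; have /andP[h2 _] := hU (~~ l).
by rewrite powR_gt0// divr_gt0.
Qed.

Let ratio_bound U : U \in els A -> 0 < contr (~~ l) U <= r1.
Proof. by case: hA => Af _ h /elsP -/(_ Af)/h. Qed.

Let els_neq0 : els A != [::].
Proof.
case: hA => Af [U AU] _; have : U \in els A by apply/elsP.
by case: (els A).
Qed.

Let pressureE : pressure l A p = power_sum (els A) coef (contr (~~ l)).
Proof. by apply/funext => t; rewrite /pressure fsbig_els//; case: hA. Qed.

Lemma pressure_root : exists t, unique_root (pressure l A p) t.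
Proof. by rewrite pressureE; exact: (power_sum_root r1_lt1 coef_gt0 ratio_bound els_neq0). Qed.

Lemma pressure_root_lt t u : unique_root (pressure l A p) t -> pressure l A p u < 1 -> t < u.
Proof.
rewrite pressureE => -[ht _].
exact: (root_lt r1_lt1 coef_gt0 ratio_bound els_neq0 ht).
Qed.

Lemma pressure_root_gt t u : unique_root (pressure l A p) t -> 1 < pressure l A p u -> u < t.
Proof.
rewrite pressureE => -[ht _].
exact: (root_gt r1_lt1 coef_gt0 ratio_bound els_neq0 ht).
Qed.

End Family.

Lemma pressure_els l A t : finite_set A ->
  pressure l A (s l) t = \sum_(U <- els A) pressure_term l t U.
Proof. by move=> Af; rewrite /pressure fsbig_els. Qed.

Lemma stopped_root_near eta : 0 < eta -> \forall d \near 0^'+,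
  (forall l t, unique_root (pressure l (stopped W d) (s l)) t -> t < a + eta) /\
  exists l, forall t, unique_root (pressure l (stopped W d) (s l)) t -> a - eta < t.
Proof.
move=> eta0; have ke : 0 < kappa * eta / 2 by rewrite divr_gt0// mulr_gt0.
have small l := pressure_sum_small l eta0.
have large := pressure_sum_large eta0.
have small' : \forall d \near 0^'+, forall l,
   \sum_(U <- els (stopped W d)) pressure_term l (a + eta) U <= d `^ (kappa * eta / 2).
  by apply: filterS2 (small false) (small true) => d p1 p2 []; [exact: p2|exact: p1].
near=> d; have d01 : 0 < d < 1 by near: d; exact: near_in01.
have h1 : forall l,
   \sum_(U <- els (stopped W d)) pressure_term l (a + eta) U <= d `^ (kappa * eta / 2).
  by near: d; exact: small'.
have [l h2] : exists l,
    d `^ (- (eta / 2)) <= \sum_(U <- els (stopped W d)) pressure_term l (a - eta) U.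
  by near: d; exact: large.
have hf := stopped_family d01; have fin : finite_set (stopped W d) by case: hf.
case/andP: (d01) => d0 d1; have ld := Nln_gt0 d01.
split=> [l' t ht|].
  apply: (pressure_root_lt hf ht); rewrite pressure_els//; apply: le_lt_trans (h1 l') _.
  by rewrite powR_lt_ln// ln1 pmulr_rlt0// -oppr_gt0.
exists l => t ht; apply: (pressure_root_gt hf ht); rewrite pressure_els//.
apply: lt_le_trans h2; rewrite -ltr_ln ?posrE ?powR_gt0// ln1 ln_powR mulNr -mulrN.
by rewrite mulr_gt0// divr_gt0.
Unshelve. all: by end_near. Qed.

Lemma comps_root_upper eta : 0 < eta -> \forall n \near \oo,
  forall l t, unique_root (pressure l (comps G n) (s l)) t -> t < a + eta.
Proof.
move=> eta0; have ke : 0 < kappa * eta / 2 by rewrite divr_gt0// mulr_gt0.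
have hm := min_ratio_bounds.
have small l := level_sum_small hW hm (pressure_term_ge0 l (a + eta)) ke
  (pressure_sum_small l eta0).
near=> n; have n0 : (0 < n)%N by near: n; exact: nbhs_infty_gt.
have hs1 : \sum_(U <- els (comps G n)) pressure_term false (a + eta) U < 1.
  by near: n; exact: (small false).
have hs2 : \sum_(U <- els (comps G n)) pressure_term true (a + eta) U < 1.
  by near: n; exact: (small true).
have hf := comps_family n0; have fin : finite_set (comps G n) by case: hf.
by move=> [] t ht; apply: (pressure_root_lt hf ht); rewrite pressure_els.
Unshelve. all: by end_near. Qed.

Lemma comps_root_lower eta n0 : 0 < eta -> exists n, [/\ (n0 <= n)%N, (0 < n)%N &
  exists l, forall t, unique_root (pressure l (comps G n) (s l)) t -> a - eta < t].
Proof.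
move=> eta0; have e2 : 0 < eta / 2 by rewrite divr_gt0.
have hm := min_ratio_bounds.
have large := pressure_sum_large eta0.
have ilr1 : 0 < (- ln r1)^-1 by rewrite invr_gt0.
have hlog := near_gt_ln e2 ilr1.
near (0 : R)^'+ => d; have d01 : 0 < d < 1 by near: d; exact: near_in01.
have [l h] : exists l,
    d `^ (- (eta / 2)) <= \sum_(U <- els (stopped W d)) pressure_term l (a - eta) U.
  by near: d; exact: large.
have h1 : 1 - ln d * (- ln r1)^-1 < d `^ (- (eta / 2)) by near: d; exact: hlog.
(* This forces n0 <= n for every length n with r0^n <= d. *)
have dn0 : d < r0 ^+ n0 by near: d; apply: nbhs_right_lt; exact: exprn_gt0.
(* Otherwise all levels with r0^n <= d have sum at most 1, and the stopped sum is at most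
   logarithmic in [d], which contradicts [large]. *)
apply: contrapT => no.
suff hall : forall n, (0 < n)%N -> r0 ^+ n <= d ->
    \sum_(U <- els (comps G n)) pressure_term l (a - eta) U <= 1.
  have := stop_sum_le hW hm (pressure_term_ge0 l (a - eta)) d01 hall.
  by move=> /(le_trans h)/le_lt_trans/(_ h1); rewrite ltxx.
move=> n n_gt0 nd; rewrite leNgt; apply/negP => big; apply: no.
exists n; split=> //; last first.
  exists l => t ht; have hf := comps_family n_gt0.
  by apply: (pressure_root_gt hf ht); rewrite pressure_els//; case: hf.
rewrite leqNgt; apply/negP => nn0.
have : r0 ^+ n0 <= r0 ^+ n by rewrite ler_wiXn2l ?(ltW r0_gt0) ?(ltW r0_lt1)// ltnW.
by move=> /(lt_le_trans dn0)/lt_le_trans/(_ nd); rewrite ltxx.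
Unshelve. all: by end_near. Qed.

(** The quotient of the two ratios of an n-fold product lies between r0^n and r0^(-n). Cost and gain
    are both exponential in [n], so [root_shift] can compare them by a condition free of [n]. *)
Lemma pressure_shift l n p q t eta : 0 <= eta ->
  pressure l (comps G n) q (t + eta) <=
  (r0 ^+ n) `^ (- `|q - p|) * (r1 ^+ n) `^ eta * pressure l (comps G n) p t.
Proof.
move=> eta0; have fin : finite_set (comps G n) by exact: finite_image (finite_words _ _).
rewrite /pressure !fsbig_els// mulr_sumr big_seq [leRHS]big_seq; apply: ler_sum => U.
move=> /elsP -/(_ fin) hU.
have /andP[x1 x2] := comps_ratio l hU; have /andP[y1 y2] := comps_ratio (~~ l) hU.
move: (contr l U) (contr (~~ l) U) x1 x2 y1 y2 => x y x1 x2 y1 y2.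
have r0n : 0 < r0 ^+ n by exact: exprn_gt0.
have r1n : r1 ^+ n <= 1 by rewrite exprn_ile1 ?(ltW r1_gt0) ?(ltW r1_lt1).
have x0 : 0 < x := lt_le_trans r0n x1; have y0 : 0 < y := lt_le_trans r0n y1.
have xy0 : 0 < x / y by rewrite divr_gt0.
have -> : (x / y) `^ q = (x / y) `^ p * (x / y) `^ (q - p).
  by rewrite -powRDn0// [p + _]addrC subrK.
rewrite (powRDn0 t eta y0).
have h1 : (x / y) `^ (q - p) <= (r0 ^+ n) `^ (- `|q - p|).
  rewrite powR_le_ln ?powR_gt0// ln_powR; apply: le_trans (ler_norm _) _.
  rewrite normrM mulNr -mulrN ler_wpM2l//.
  have lx : ln (r0 ^+ n) <= ln x by rewrite ler_ln ?posrE.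
  have ly : ln (r0 ^+ n) <= ln y by rewrite ler_ln ?posrE.
  have lx0 : ln x <= 0 by apply: ln_le0; exact: le_trans r1n.
  have ly0 : ln y <= 0 by apply: ln_le0; exact: le_trans r1n.
  by rewrite ln_div ?posrE// ler_norml; lra.
have h2 : y `^ eta <= (r1 ^+ n) `^ eta.
  by apply: ge0_ler_powR; rewrite ?nnegrE ?(ltW y0) ?exprn_ge0 ?(ltW r1_gt0).
have -> : (x / y) `^ p * (x / y) `^ (q - p) * (y `^ t * y `^ eta) =
  (x / y) `^ (q - p) * y `^ eta * ((x / y) `^ p * y `^ t) by ring.
rewrite ler_wpM2r ?mulr_ge0 ?powR_ge0//.
by apply: ler_pM; rewrite ?powR_ge0.
Qed.

Lemma root_shift l n p q t u eta : (0 < n)%N -> 0 < eta -> `|q - p| < kappa * eta ->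
  unique_root (pressure l (comps G n) p) t -> unique_root (pressure l (comps G n) q) u ->
  u < t + eta.
Proof.
move=> n0 eta0 pq ht hu; apply: (pressure_root_lt (comps_family n0) hu).
apply: (le_lt_trans (pressure_shift l n p q t (ltW eta0))).
have -> : pressure l (comps G n) p t = 1 by case: ht.
rewrite mulr1 -ltr_ln ?posrE ?mulr_gt0 ?powR_gt0 ?exprn_gt0//.
rewrite lnM ?posrE ?powR_gt0 ?exprn_gt0// !ln_powR !lnXn// ln1.
have -> : - `|q - p| * (ln r0 *+ n) + eta * (ln r1 *+ n) =
   (`|q - p| * - ln r0 + eta * ln r1) *+ n.
  by rewrite !mulrnAr -mulrnDl mulrN mulNr.
rewrite pmulrn_llt0//.
have : `|q - p| * - ln r0 < kappa * eta * - ln r0 by rewrite ltr_pM2r.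
have -> : kappa * eta * - ln r0 = - (eta * ln r1).
  by rewrite /kappa; field; rewrite -oppr_eq0 gt_eqF.
lra.
Qed.

Section Similarity.
Variables (l : bool) (n : nat).
Hypothesis n_gt0 : (0 < n)%N.

Local Notation P := (pcoord l @` comps G n).

Lemma proj_comps_finite : finite_set P.
Proof. by apply: finite_image; exact: finite_image (finite_words _ _). Qed.

Let ratio_bound f : f \in els P -> 0 < `|f.1| <= r1.
Proof.
move=> /elsP -/(_ proj_comps_finite)[U hU <-].
by have [_ _ /(_ U hU l)] := comps_family n_gt0.
Qed.

Let els_neq0 : els P != [::].
Proof.
have [_ [U hU] _] := comps_family n_gt0.
have : pcoord l U \in els P by apply/elsP; [exact: proj_comps_finite|exists U].
by case: (els P).
Qed.

Let coef_gt0 (f : aff R) : f \in els P -> 0 < (1 : R). Proof. by []. Qed.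

Let similarityE : similarity_sum P = power_sum (els P) (fun=> 1) (fun f => `|f.1|).
Proof.
apply/funext => t; rewrite /similarity_sum /power_sum fsbig_els; last exact: proj_comps_finite.
by under [RHS]eq_bigr do rewrite mul1r.
Qed.

Lemma similarity_root : exists t, unique_root (similarity_sum P) t.
Proof. by rewrite similarityE; exact: (power_sum_root r1_lt1 coef_gt0 ratio_bound els_neq0). Qed.

Lemma similarity_root_ge t : unique_root (similarity_sum P) t -> s l <= t.
Proof.
rewrite similarityE => -[ht _].
(* At exponent 0 the sum is the number of maps, which is at least 1, so the root is not negative. *)
have t0 : 0 <= t.
  rewrite leNgt; apply/negP => /(power_sum_lt r1_lt1 coef_gt0 ratio_bound els_neq0).
  rewrite ht /power_sum; under eq_bigr do rewrite powRr0 mulr1.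
  rewrite sum_const_seq mulr1 ltrn1; case: (els P) els_neq0 => //.
apply: (@exponent_le_similarity R (K l) (proj_nonempty l) (L01 (l := l)) (els P) (r0 ^+ n) r1) => //.
- exact: exprn_gt0.
- move=> f fP; have /andP[_ ->] := ratio_bound fP; rewrite andbT.
  move: fP => /elsP -/(_ proj_comps_finite)[U hU <-].
  by have /andP[] := comps_ratio l hU.
- move=> _ [x Lx <-].
  have hid : forall y, cmap_fun (@cmap_id R) y = y.
    by move=> [y1 y2]; rewrite /cmap_fun /aff_fun /= !mul1r !addr0.
  have [w [hw [y Ly yx]]] := app_ev_cover (@cmap_compE R) hid hL n Lx.
  exists (pcoord l (cmap_word w)).
    by apply/elsP; [exact: proj_comps_finite|exists (cmap_word w) => //; exists w].
  by exists (pcoord l y); [exists y|rewrite -pcoord_cmap yx].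
- have := ht; rewrite /power_sum; under eq_bigr do rewrite mul1r.
  by move=> ->.
Qed.

Lemma similarity_root_lt t u : unique_root (similarity_sum P) t ->
  \sum_(f <- els P) `|f.1| `^ u < 1 -> t < u.
Proof.
rewrite similarityE => -[ht _] hu.
apply: (root_lt r1_lt1 coef_gt0 ratio_bound els_neq0 ht).
by rewrite /power_sum; under eq_bigr do rewrite mul1r.
Qed.

End Similarity.

Lemma similarity_root_upper l eta : 0 < eta ->
  (forall e, 0 < e -> \forall d \near 0^'+,
     neighbours (@dist1 R) (@aff_fun R) (K l) (astop (V l)) d <= d `^ (- e)) ->
  \forall n \near \oo, forall t,
    unique_root (similarity_sum (pcoord l @` comps G n)) t -> t < s l + eta.
Proof.
move=> eta0 hg.
have small := similarity_sum_small (hV l) r0_gt0 r01 r1_lt1 (@proj_ifs_ratio l)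
  (proj_nonempty l) (L01 (l := l)) (proj_attractor l) (s_ge0 l) (hs l) eta0 hg.
near=> n; have n0 : (0 < n)%N by near: n; exact: nbhs_infty_gt.
have h : \sum_(f <- els (@aff_word R @` words (proj_ifs l G) n)) `|f.1| `^ (s l + eta) < 1.
  by near: n; exact: small.
by move=> t ht; apply: (similarity_root_lt n0 ht); rewrite proj_comps.
Unshelve. all: by end_near. Qed.

Lemma roots_close l eta : 0 < eta ->
  (forall e, 0 < e -> \forall d \near 0^'+,
     neighbours (@dist1 R) (@aff_fun R) (K l) (astop (V l)) d <= d `^ (- e)) ->
  \forall n \near \oo, forall p t u,
    unique_root (similarity_sum (pcoord l @` comps G n)) p ->
    unique_root (pressure l (comps G n) (s l)) t ->
    unique_root (pressure l (comps G n) p) u -> u < t + eta /\ t < u + eta.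
Proof.
move=> eta0 hg; have ke : 0 < kappa * eta by rewrite mulr_gt0.
(* An exponent error below kappa * eta is what [root_shift] tolerates for a displacement [eta] of
   the root. *)
have hu := similarity_root_upper ke hg.
near=> n; have n0 : (0 < n)%N by near: n; exact: nbhs_infty_gt.
have h : forall t, unique_root (similarity_sum (pcoord l @` comps G n)) t ->
    t < s l + kappa * eta by near: n; exact: hu.
move=> p t u hp ht hu'.
have p1 := similarity_root_ge n0 hp; have p2 := h p hp.
have d1 : `|p - s l| < kappa * eta by rewrite ger0_norm; lra.
split; first exact: root_shift d1 ht hu'.
by apply: root_shift hu' ht => //; rewrite distrC.
Unshelve. all: by end_near. Qed.

End Carpet.

(** * The dimension formulas *)

Section ConvexHull.
Variable R : realType.
Implicit Types (K : set R).

Lemma convex_set_itv (m M : R) : @convex_set R R^o `[m, M].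
Proof.
apply/convex_setW => x y; rewrite !inE/= !in_itv/= => /andP[x1 x2] /andP[y1 y2] k k0 k1.
rewrite inE; change (is_true ((k%:num * x + (1 - k%:num) * y : R) \in `[m, M])).
move: k0 k1; move: (k%:num : R) => t t0 t1; rewrite in_itv/=.
by apply/andP; split; nra.
Qed.

Lemma conv_hull_subset K (m M : R) : K `<=` `[m, M] -> conv_hull K `<=` `[m, M].
Proof. by move=> h; apply: smallest_sub h; exact: convex_set_itv. Qed.

Lemma subset_conv_hull K : K `<=` conv_hull K.
Proof. exact: sub_gen_smallest. Qed.

(** The AWSC is phrased with diameters, the stopping families with ratios; this makes the two agree.
    A hull equal to [0, 1] gives [K] infimum 0 and supremum 1, and points of [K] close to these
    realise the diameter in the limit. *)
Lemma diam_unit_image K (f : aff R) : K !=set0 -> conv_hull K = `[0, 1]%classic ->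
  diam (aff_fun f @` K) = `|f.1|.
Proof.
move=> proj_nonempty hK; have K01 : K `<=` `[0, 1] by rewrite -hK; exact: subset_conv_hull.
have [k Kk] := proj_nonempty.
have bd : has_ubound K by exists 1 => x /K01; rewrite /= in_itv/= => /andP[].
have bdl : has_lbound K by exists 0 => x /K01; rewrite /= in_itv/= => /andP[].
have hs : has_sup K by []. have hi : has_inf K by [].
have [h0 h1] : inf K <= 0 /\ 1 <= sup K.
  have : `[0, 1] `<=` `[inf K, sup K].
    rewrite -hK; apply: conv_hull_subset => x Kx; rewrite /= in_itv/=.
    by rewrite ge_inf ?ub_le_sup.
  move=> h; have := h 0; have := h 1; rewrite /= !in_itv/= !lexx !ler01.
  by move=> /(_ isT)/andP[_ ->] /(_ isT)/andP[->].
apply/le_anti/andP; split.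
  apply: ge_sup.
    exists (dist1 (aff_fun f k) (aff_fun f k)), (aff_fun f k); first by exists k.
    by exists (aff_fun f k); [exists k|].
  by move=> _ [x Kx [y Ky <-]]; exact: (aff_image_unit K01).
apply/ler_addgt0Pr => e e0.
have [f0|f0] := eqVneq f.1 0.
  rewrite f0 normr0 addr_ge0 ?(ltW e0)//; apply: ub_le_sup.
    exists `|f.1| => _ [x Kx [y Ky <-]]; exact: (aff_image_unit K01).
  exists (aff_fun f k); first by exists k.
  by exists (aff_fun f k); [exists k|rewrite dist1E subrr normr0].
have fn : 0 < `|f.1| by rewrite normr_gt0.
pose u := e / `|f.1| / 2; have u0 : 0 < u by rewrite !divr_gt0.
have [x Kx hx] := sup_adherent u0 hs; have [y Ky hy] := inf_adherent u0 hi.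
rewrite -lerBlDr; apply: (@le_trans _ _ (dist1 (aff_fun f x) (aff_fun f y))); last first.
  apply: ub_le_sup.
    exists `|f.1| => _ [x' Kx' [y' Ky' <-]]; exact: (aff_image_unit K01).
  by exists (aff_fun f x); [exists x|exists (aff_fun f y); [exists y|]].
rewrite aff_dist; apply: (@le_trans _ _ (`|f.1| * (1 - 2 * u))).
  have -> : `|f.1| * (1 - 2 * u) = `|f.1| - e; last exact: lexx.
  by rewrite /u; field; rewrite gt_eqF.
rewrite ler_wpM2l// dist1E; apply: le_trans (ler_norm _); lra.
Qed.

End ConvexHull.

Lemma carpet_ratio_bounds (R : realType) (G : {fset cmap R}) : is_carpet G ->
  exists r0 r1, [/\ 0 < r0, r0 <= r1, r1 < 1 &
    forall S, S \in G -> forall l, r0 <= contr l S <= r1].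
Proof.
move=> hG; suff [r0 [r1 [h1 h2 h3 h4]]] : exists r0 r1, [/\ 0 < r0, r0 <= r1, r1 < 1 &
    forall S, S \in enum_fset G -> forall l, r0 <= contr l S <= r1].
  by exists r0, r1; split.
have : forall S, S \in enum_fset G -> forall l, 0 < contr l S < 1 by [].
elim: (enum_fset G) => [|S s IH] h.
  by exists (1 / 2), (1 / 2); split=> //; lra.
have [|r0 [r1 [h1 h2 h3 h4]]] := IH; first by move=> T Ts; apply: h; rewrite inE Ts orbT.
have hS := h S (mem_head _ _).
have /andP[a1 a2] := hS false; have /andP[b1 b2] := hS true.
exists (Num.min r0 (Num.min (contr false S) (contr true S))).
exists (Num.max r1 (Num.max (contr false S) (contr true S))); split.
- by rewrite !lt_min h1 a1 b1.
- by rewrite ge_min le_max h2.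
- by rewrite !gt_max h3 a2 b2.
- move=> T; rewrite inE => /predU1P[->|/h4 hT] l; rewrite !ge_min !le_max.
    by case: l; rewrite lexx ?orbT.
  by have /andP[-> ->] := hT l.
Qed.

Lemma limn_esup_unique (R : realType) (u : nat -> R) (a : R) :
  (forall e, 0 < e -> \forall n \near \oo, u n <= a + e) ->
  (forall e n0, 0 < e -> exists2 n, (n0 <= n)%N & a - e <= u n) ->
  a%:E = limn_esup (fun n => (u n)%:E).
Proof.
move=> hu hl; apply/le_anti/andP; split.
  apply: limf_esup_ge => e A e0 [n0 _ hA].
  have [n nn hn] := hl e n0 e0; exists n; first exact: hA.
  by rewrite lee_fin.
apply: limf_esup_le => e e0; apply: filterS (hu e e0) => n.
by rewrite lee_fin.
Qed.

Theorem theorem4p1 (R : realType) (G : {fset cmap R}) (L : set (R * R))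
  (W : nat -> set (seq (cmap R))) (V : bool -> nat -> set (seq (aff R)))
  (hG : is_carpet G) (hL : is_attractor G L)
  (hconv : conv_hull (pcoord false @` L) `*` conv_hull (pcoord true @` L)
           = `[0, 1] `*` `[0, 1])
  (hW : reduced_words (@cmap_word R) G W)
  (hV : forall l, reduced_words (@aff_word R) (proj_ifs l G) (V l))
  (hsep : (forall l, AWSC (pcoord l @` L) (V l)) \/
          [/\ coordinate_ordering G, ANC L W
            & AWSC (pcoord true @` L) (V true)]) :
  [/\ box_dim_exists (@dist2 R) L,
      (box_dim (@dist2 R) L)%:E
        = maxe (limf_esup (dim_term L W false) 0^'+)
               (limf_esup (dim_term L W true) 0^'+) &
      exists (D : bool -> R -> R) (d : bool -> nat -> R)
             (s : bool -> nat -> R) (D' : bool -> nat -> R),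
        [/\ forall l delta, 0 < delta < 1 ->
              unique_root (pressure l (stopped W delta)
                             (box_dim (@dist1 R) (pcoord l @` L))) (D l delta),
            forall l n, (0 < n)%N ->
              [/\ unique_root (pressure l (comps G n)
                                 (box_dim (@dist1 R) (pcoord l @` L))) (d l n),
                  unique_root (similarity_sum (pcoord l @` comps G n)) (s l n) &
                  unique_root (pressure l (comps G n) (s l n)) (D' l n)],
            (box_dim (@dist2 R) L)%:E
              = limf_esup (fun delta =>
                  (Num.max (D false delta) (D true delta))%:E) 0^'+,
            (box_dim (@dist2 R) L)%:E
              = limn_esup (fun n => (Num.max (d false n) (d true n))%:E) &
            forall I : pred bool,
              (forall l, I l -> AWSC (pcoord l @` L) (V l)) ->
              let e l n := if I l then D' l n else d l n in
              (box_dim (@dist2 R) L)%:E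
                = limn_esup (fun n => (Num.max (e false n) (e true n))%:E)]].
Proof.
have [Ln0 Lcompact LE] := hL.
have [r0 [r1 [r0_gt0 r01 r1_lt1 hr]]] := carpet_ratio_bounds hG.
(* Both hulls are non-empty, so their product determines each factor. *)
have hull l : conv_hull (pcoord l @` L) = `[0, 1]%classic.
  have ne l' : conv_hull (pcoord l' @` L) !=set0.
    by have [x Lx] := Ln0; exists (pcoord l' x); apply: subset_conv_hull; exists x.
  have [u hu] := ne false; have [v hv] := ne true.
  have h x y : conv_hull (pcoord false @` L) x /\ conv_hull (pcoord true @` L) y <->
      x \in `[0, 1] /\ y \in `[0, 1].
    by have := congr1 (fun B => B (x, y)) hconv => /= <-.
  have [u1 v1] := (h u v).1 (conj hu hv).
  apply/seteqP; case: l; split=> x /=.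
  - by move=> hx; have [] := (h u x).1 (conj hu hx).
  - by move=> hx; have [] := (h u x).2 (conj u1 hx).
  - by move=> hx; have [] := (h x v).1 (conj hx hv).
  - by move=> hx; have [] := (h x v).2 (conj hx v1).
have L01 l : pcoord l @` L `<=` `[0, 1] by rewrite -(hull l); exact: subset_conv_hull.
have Kne l := proj_nonempty Ln0 l.
have KE l := proj_attractor LE l.
have hF l := @proj_ifs_ratio _ G r0 r1 hr l.
have familyE l : awsc_family (pcoord l @` L) (V l) = astop (V l).
  have dE f : diam (aff_fun f @` (pcoord l @` L)) = `|f.1|.
    exact: diam_unit_image (Kne l) (hull l).
  apply/funext => d; rewrite /awsc_family /astop /stop /cutset.
  by congr (_ @` _); apply/funext => w; rewrite /mkset /aratio !dE.
have sep l : AWSC (pcoord l @` L) (V l) -> forall e, 0 < e -> \forall d \near 0^'+,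
    neighbours (@dist1 R) (@aff_fun R) (pcoord l @` L) (astop (V l)) d <= d `^ (- e).
  rewrite /AWSC familyE; apply: subpolynomial_neighbours; near=> d.
  have d01 : 0 < d < 1 by near: d; exact: near_in01.
  have hb := aratio_bounds r0_gt0 r01 r1_lt1 (hF l).
  have [x Kx] := Kne l.
  have [f hf fx] := astop_cover (hV l) r0_gt0 r01 r1_lt1 (hF l) (KE l) d01 Kx.
  case/andP: d01 => d0 d1.
  apply: (neighbours_ge1 (hV l) hb (S := f) (x := x)); first by rewrite d0 ltW.
  by split=> //; exists x; split=> //; rewrite /cball /= dist1E subrr normr0 ltW.
(* Both alternatives of [hsep] are reduced to this bound; after it the AWSC returns only in
   comparing [D'] with [d]. *)
have hanc : forall e, 0 < e -> \forall d \near 0^'+,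
    neighbours (@dist2 R) (@cmap_fun R) L (stopped W) d <= d `^ (- e).
  case: hsep => [hawsc|[_ hanc _]].
    apply: (neighbours_of_projections hW hV r0_gt0 r01 r1_lt1 hr) => l.
    exact: sep.
  apply: subpolynomial_neighbours; last first.
    have -> : (fun d => ln (neighbours (@dist2 R) (@cmap_fun R) L (stopped W) d) / - ln d) =
        (fun d => - (ln (neighbours (@dist2 R) (@cmap_fun R) L (stopped W) d) / ln d)).
      by apply/funext => d; rewrite invrN mulrN.
    by have := cvgN hanc; rewrite oppr0; exact.
  near=> d; have d01 : 0 < d < 1 by near: d; exact: near_in01.
  have hb := min_ratio_bounds r0_gt0 r01 r1_lt1 hr.
  have [x Lx] := Ln0.
  have [f hf fx] := stopped_cover hW r0_gt0 r01 r1_lt1 hr LE d01 Lx.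
  case/andP: d01 => d0 d1.
  apply: (neighbours_ge1 hW hb (S := f) (x := x)); first by rewrite d0 ltW.
  split=> //; exists x; split=> //.
  by rewrite /cball /= /dist2 !subrr expr0n addr0 sqrtr0 ltW.
have /choice[s hs'] : forall l, exists s, 0 <= s /\
    has_exponent (covering_number (@dist1 R) (pcoord l @` L)) s.
  move=> l; have [s s0 hs] := N_exponent (hV l) r0_gt0 r01 r1_lt1 (hF l) (Kne l) (L01 l) (KE l).
  by exists s.
have s_ge0 l : 0 <= s l by have [] := hs' l.
have hs l : has_exponent (covering_number (@dist1 R) (pcoord l @` L)) (s l) by have [] := hs' l.
have [a a_ge0 [hN hZ]] := carpet_exponent hW r0_gt0 r01 r1_lt1 hr Ln0 LE L01 s_ge0 hs hanc.
have [ex ->] := carpet_box_dim Ln0 L01 hN.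
have sE l : box_dim (@dist1 R) (pcoord l @` L) = s l := proj_box_dim Ln0 L01 hs l.
split=> //.
  by rewrite (limsup_dim_term hW r0_gt0 r01 r1_lt1 hr Ln0 L01 hs a_ge0 hZ).
have fam := comps_family r0_gt0 r01 r1_lt1 hr Ln0 LE.
(* Roots are chosen for all arguments at once; outside the admissible scales and lengths the value 0
   is arbitrary. *)
have /choice[D hD] : forall p : bool * R, exists t, 0 < p.2 < 1 ->
    unique_root (pressure p.1 (stopped W p.2) (s p.1)) t.
  move=> [l d] /=; have [d01|_] := boolP (0 < d < 1); last by exists 0.
  have [t ht] := pressure_root r1_lt1 l (s l)
    (stopped_family hW r0_gt0 r01 r1_lt1 hr Ln0 LE d01).
  by exists t.
have /choice[c hc] : forall p : bool * nat, exists t : R * (R * R), (0 < p.2)%N ->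
    [/\ unique_root (pressure p.1 (comps G p.2) (s p.1)) t.1,
        unique_root (similarity_sum (pcoord p.1 @` comps G p.2)) t.2.1 &
        unique_root (pressure p.1 (comps G p.2) t.2.1) t.2.2].
  move=> [l n] /=; have [n0|_] := boolP (0 < n)%N; last by exists (0, (0, 0)).
  have [t1 h1] := pressure_root r1_lt1 l (s l) (fam _ n0).
  have [t2 h2] := similarity_root r0_gt0 r01 r1_lt1 hr Ln0 LE l n0.
  have [t3 h3] := pressure_root r1_lt1 l t2 (fam _ n0).
  by exists (t1, (t2, t3)).
pose d l n := (c (l, n)).1; pose s' l n := (c (l, n)).2.1; pose D' l n := (c (l, n)).2.2.
have hd l n : (0 < n)%N -> [/\ unique_root (pressure l (comps G n) (s l)) (d l n),
    unique_root (similarity_sum (pcoord l @` comps G n)) (s' l n) &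
    unique_root (pressure l (comps G n) (s' l n)) (D' l n)].
  by move=> n0; exact: (hc (l, n)).
have upper eta : 0 < eta -> \forall n \near \oo, forall l, d l n < a + eta.
  move=> eta0.
  have := comps_root_upper hW r0_gt0 r01 r1_lt1 hr Ln0 LE L01 s_ge0 hs hN hZ eta0.
  move=> h; near=> n; have n0 : (0 < n)%N by near: n; exact: nbhs_infty_gt.
  have hn : forall l t, unique_root (pressure l (comps G n) (s l)) t -> t < a + eta.
    by near: n; exact: h.
  by move=> l; apply: (hn l); have [] := hd l n n0.
have lower eta n0 : 0 < eta -> exists n, [/\ (n0 <= n)%N, (0 < n)%N & exists l, a - eta < d l n].
  move=> eta0.
  have [n [nn n_gt0 [l h]]] :=
    comps_root_lower hW r0_gt0 r01 r1_lt1 hr Ln0 LE s_ge0 hZ n0 eta0.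
  by exists n; split=> //; exists l; apply: h; have [] := hd l n n_gt0.
have close l eta : AWSC (pcoord l @` L) (V l) -> 0 < eta ->
    \forall n \near \oo, D' l n < d l n + eta /\ d l n < D' l n + eta.
  move=> hl eta0.
  have h := roots_close hV r0_gt0 r01 r1_lt1 hr Ln0 LE L01 s_ge0 hs eta0 (sep l hl).
  near=> n; have n0 : (0 < n)%N by near: n; exact: nbhs_infty_gt.
  have hn : forall p t u,
    unique_root (similarity_sum (pcoord l @` comps G n)) p ->
    unique_root (pressure l (comps G n) (s l)) t ->
    unique_root (pressure l (comps G n) p) u -> u < t + eta /\ t < u + eta.
    by near: n; exact: h.
  by have [h1 h2 h3] := hd l n n0; exact: hn h2 h1 h3.
exists (fun l delta => D (l, delta)), d, s', D'; split.
- by move=> l delta hdelta; rewrite sE; exact: (hD (l, delta)).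
- by move=> l n n0; rewrite sE; exact: hd.
- have near_roots := stopped_root_near hW r0_gt0 r01 r1_lt1 hr Ln0 LE L01 s_ge0 hs hN hZ.
  have bounds eta : 0 < eta -> \forall delta \near 0^'+,
      a - eta <= Num.max (D (false, delta)) (D (true, delta)) <= a + eta.
    move=> eta0; have := near_roots _ eta0 => h.
    near=> delta; have d01 : 0 < delta < 1 by near: delta; exact: near_in01.
    have [h1 [l h2]] : (forall l t, unique_root (pressure l (stopped W delta) (s l)) t ->
        t < a + eta) /\ exists l, forall t,
        unique_root (pressure l (stopped W delta) (s l)) t -> a - eta < t.
      by near: delta; exact: h.
    have hr' l' : unique_root (pressure l' (stopped W delta) (s l')) (D (l', delta)).
      exact: (hD (l', delta)).
    rewrite le_max ge_max !(ltW (h1 _ _ (hr' _))) andbT.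
    by have := h2 _ (hr' l); case: (l) => /ltW ->; rewrite ?orbT.
  apply/le_anti/andP; split.
    apply: limf_esup_ge => e A e0 HA; near (0 : R)^'+ => delta.
    exists delta; first by near: delta.
    rewrite lee_fin.
    have /andP[] : a - e <= Num.max (D (false, delta)) (D (true, delta)) <= a + e => //.
    by near: delta; exact: bounds.
  apply: limf_esup_le => e e0; apply: filterS (bounds e e0) => delta /andP[_].
  by rewrite lee_fin.
- apply: limn_esup_unique => [e e0|e n0 e0].
    by apply: filterS (upper e e0) => n h; rewrite ge_max !ltW.
  have [n [nn _ [l hl]]] := lower e n0 e0; exists n => //.
  by rewrite le_max; case: l hl => /ltW ->; rewrite ?orbT.
- move=> I hI e.
  (* [e] equals [d] outside [I] and is asymptotically close to it inside, so its upper limit follows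
     from the bounds for [d]. *)
  have closeI eta : 0 < eta -> \forall n \near \oo, forall l,
      e l n < d l n + eta /\ d l n < e l n + eta.
    move=> eta0; have h l : \forall n \near \oo, e l n < d l n + eta /\ d l n < e l n + eta.
      rewrite /e; case: (boolP (I l)) => [Il|_]; first exact: (close l eta (hI l Il) eta0).
      by near=> n; rewrite !ltrDl eta0.
    by apply: filterS2 (h false) (h true) => n p1 p2 []; [exact: p2|exact: p1].
  apply: limn_esup_unique => [eta eta0|eta n0 eta0].
    have eta2 : 0 < eta / 2 by rewrite divr_gt0.
    near=> n.
    have h1 : forall l, e l n < d l n + eta / 2 /\ d l n < e l n + eta / 2.
      by near: n; exact: closeI.
    have h2 : forall l, d l n < a + eta / 2 by near: n; exact: upper.
    have h l : e l n <= a + eta by have [] := h1 l; have := h2 l; lra.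
    by rewrite ge_max; apply/andP; split; exact: h.
  have eta2 : 0 < eta / 2 by rewrite divr_gt0.
  have [n1 _ h1] := closeI _ eta2.
  (* The index has to pass both [n0] and the threshold [n1] of [closeI]. *)
  have [n [nn _ [l hl]]] := lower _ (maxn n0 n1) eta2; exists n.
    by apply: leq_trans nn; exact: leq_maxl.
  have [_ h2] := h1 n (leq_trans (leq_maxr _ _) nn) l.
  have h : a - eta <= e l n by lra.
  by rewrite le_max; case: (l) h => ->; rewrite ?orbT.
Unshelve. all: by end_near. Qed.
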